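(* Let $F\in C^1(\mathbf{R})$ with $F'\in L^\infty(\mathbf{R})$. For $u,v\in\mathcal{V}_h\cap C^0(\Omega)$ and $i=1,2,\dots,d$, there holds $$\partial_{h,x_i}(uv)=\mathcal{P}_r^h\bigl(u\,\partial_{x_i}v+v\,\partial_{x_i}u\bigr),\qquad \partial_{h,x_i}F(u)=\mathcal{P}_r^h\bigl(F'(u)\,\partial_{x_i}u\bigr).$$
   Context: Mesh and spaces. $\Omega\subset\mathbf{R}^d$ is a bounded open domain and $\mathcal{T}_h$ is a locally quasi-uniform, shape-regular partition of $\Omega$ into (finitely many, polytopal) elements with flat faces. $\mathcal{E}_h^I$, $\mathcal{E}_h^B$ denote the sets of interior and boundary faces/edges, $\mathcal{E}_h=\mathcal{E}_h^I\cup\mathcal{E}_h^B$. $W^{m,p}(\mathcal{T}_h)=\prod_{K}W^{m,p}(K)$, $C^m(\mathcal{T}_h)=\prod_K C^m(\overline K)$. For a fixed integer $r\ge 0$, $V_r^h=\prod_{K\in\mathcal{T}_h}\mathbb{P}_r(K)$, where $\mathbb{P}_r(K)$ is the set of polynomials on $K$ of degree at most $r$. $\mathcal{V}_h=W^{1,1}(\mathcal{T}_h)\cap C^0(\mathcal{T}_h)$. $(v,w)_{\mathcal{T}_h}=\sum_K\int_K vw\,dx$, and $\langle v,w\rangle_{\mathcal{S}}=\sum_{e\in\mathcal{S}}\int_e vw\,ds$ for $\mathcal{S}\subset\mathcal{E}_h$; derivatives of piecewise functions inside $(\cdot,\cdot)_{\mathcal{T}_h}$ are taken elementwise. $\mathcal{P}_r^h$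 is the $L^2$-projection onto $V_r^h$; for $w\in L^1(\Omega)$, $\mathcal{P}_r^hw\in V_r^h$ is the unique function with $(\mathcal{P}_r^hw,\varphi_h)_{\mathcal{T}_h}=(w,\varphi_h)_{\mathcal{T}_h}$ for all $\varphi_h\in V_r^h$. Jumps, averages, normals. Elements are globally numbered. For $e=\partial K\cap\partial K'\in\mathcal{E}_h^I$ with $K$ having the smaller number: $[v]=v|_K-v|_{K'}$, $\{v\}=\frac12(v|_K+v|_{K'})$, $n_e=n_K|_e=-n_{K'}|_e$ ($n_K$ is the outward unit normal of $K$). On $e\in\mathcal{E}_h^B$: $[v]=\{v\}=v$ and $n_e$ is the outward unit normal of $\Omega$. $n^{(i)}$ is the piecewise constant function on faces with $n^{(i)}|_e=n_e^{(i)}$, the $i$th component of $n_e$. Trace operators. On $e=\partial K\cap \partial K'\in\mathcal{E}_h^I$ ($K$ with smaller number): $\mathcal{Q}_i^-(v)$ is the trace of $v|_K$ if $n_e^{(i)}<0$ and of $v|_{K'}$ if $n_e^{(i)}\ge0$; $\mathcal{Q}_i^+(v)$ is the trace of $v|_{K'}$ if $n_e^{(i)}<0$ and of $v|_K$ if $n_e^{(i)}\ge 0$. On $e\in\mathcal{E}_h^B$, $\mathcal{Q}_i^\pm(v)$ is the trace of $v$. Discrete derivatives. Let $\gamma_i^\pm$ be given functions that are piecewise constant with respect to $\mathcal{E}_h^I$. For $v\in\mathcal{V}_h$, $\partial_{h,x_i}^\pm v\in V_r^h$ is defined by $$(\partial_{h,x_i}^\pm v,\varphi_h)_{\mathcal{T}_h}=\langle\mathcal{Q}_i^\pm(v)n^{(i)},[\varphi_h]\rangle_{\mathcal{E}_h}-(v,\partial_{x_i}\varphi_h)_{\mathcal{T}_h}+\langle\gamma_i^\pm[v],[\varphi_h]\rangle_{\mathcal{E}_h^I}\quad\forall\varphi_h\in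 V_r^h,$$ and $\partial_{h,x_i}v=\frac12(\partial_{h,x_i}^-v+\partial_{h,x_i}^+v)$. *)

(* Defs.v *)
From HB Require Import structures.
From mathcomp Require Import all_boot all_order all_algebra.
From mathcomp Require mpoly.
Import -(notations) mpoly.
From mathcomp Require Import all_classical all_reals all_analysis.
From mathcomp Require Import measurable_realfun.

Set Implicit Arguments.
Unset Strict Implicit.
Unset Printing Implicit Defensive.
Import Order.TTheory GRing.Theory Num.Theory.
Import numFieldNormedType.Exports.

Local Open Scope classical_set_scope.
Local Open Scope ring_scope.

(* The product sigma-algebra on 'rV[R]_n is its Borel sigma-algebra. *)
Definition rV_display : measure_display. Proof. exact. Qed.

Section measurable_rV.
Context {R : realType} {n : nat}.

Let coords : 'I_n -> 'rV[R]_n -> measurableTypeR R := fun i x => x ord0 i.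

Let rV_set0 : g_sigma_preimage coords set0.
Proof. exact: sigma_algebra0. Qed.

Let rV_setC A : g_sigma_preimage coords A -> g_sigma_preimage coords (~` A).
Proof. exact: sigma_algebraC. Qed.

Let rV_bigcup (F : _^nat) : (forall i, g_sigma_preimage coords (F i)) ->
  g_sigma_preimage coords (\bigcup_i (F i)).
Proof. exact: sigma_algebra_bigcup. Qed.

HB.instance Definition _ := @isMeasurable.Build rV_display
  'rV[R]_n (g_sigma_preimage coords) rV_set0 rV_setC rV_bigcup.

Lemma measurable_coord (i : 'I_n) :
  measurable_fun [set: 'rV[R]_n] (fun x => x ord0 i : measurableTypeR R).
Proof.
move=> _ Y mY; rewrite setTI; apply: sub_sigma_algebra => /=.
rewrite -bigcup_seq/=; exists i => /=; first by rewrite mem_index_enum.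
by exists Y => //; rewrite setTI.
Qed.

Lemma measurable_fun_rV d (T : measurableType d) (f : T -> 'rV[R]_n) :
  (forall i, measurable_fun [set: T] (fun x => f x ord0 i : measurableTypeR R)) ->
  measurable_fun [set: T] f.
Proof.
move=> mf.
suff sub : g_sigma_preimage coords `<=` [set A | measurable (f @^-1` A)].
  by move=> _ A mA; rewrite setTI; exact: sub.
apply: smallest_sub.
  split=> /=; first by rewrite preimage_set0.
    by move=> A mA; rewrite setTD preimage_setC; exact: measurableC.
  by move=> F mF; rewrite preimage_bigcup; exact: bigcup_measurable.
move=> A /=; rewrite -bigcup_seq/= => -[i _ [B mB <-]].
have := mf i measurableT B mB.
by rewrite !setTI.
Qed.

End measurable_rV.

Definition pushforward_measure d1 d2 (T1 : measurableType d1)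
    (T2 : measurableType d2) (R : realType) (m : {measure set T1 -> \bar R})
    (f : T1 -> T2) (mf : measurable_fun setT f) :
  {measure set T2 -> \bar R} :=
  measure_function_pushforward__canonical__measure_function_Measure m mf.

Section lebesgue_rV.
Context {R : realType}.

Definition cons_rV n (p : measurableTypeR R * 'rV[R]_n) : 'rV[R]_n.+1 :=
  \row_k oapp (fun k' => p.2 ord0 k') p.1 (unlift ord0 k).

Lemma measurable_cons_rV n : measurable_fun setT (@cons_rV n).
Proof.
apply: measurable_fun_rV => i.
case: (unliftP ord0 i) => [j ->|->].
  rewrite (_ : (fun _ => _) =
    (fun x : 'rV[R]_n => x ord0 j : measurableTypeR R) \o snd).
    by apply: measurableT_comp; [exact: measurable_coord|exact: measurable_snd].
  by apply/funext => x; rewrite mxE liftK.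
rewrite (_ : (fun _ => _) = fst); first exact: measurable_fst.
by apply/funext => x; rewrite mxE unlift_none.
Qed.

Section step.
Context n (m : {sigma_finite_measure set 'rV[R]_n -> \bar R}).

Definition lebesgue_step : set 'rV[R]_n.+1 -> \bar R :=
  pushforward (lebesgue_measure \x m)%E (@cons_rV n).

Let pushforward_step : {measure set 'rV[R]_n.+1 -> \bar R} :=
  pushforward_measure (lebesgue_measure \x m)%E (@measurable_cons_rV n).

HB.instance Definition _ := isMeasure.Build _ _ _ lebesgue_step
  (measure0 pushforward_step) (measure_ge0 pushforward_step)
  (@measure_semi_sigma_additive _ _ _ pushforward_step).

Let lebesgue_step_sigma_finite : sigma_finite setT lebesgue_step.
Proof.
have /sigma_finiteP[F [TF ndF Foo]] := sigma_finiteT (@lebesgue_measure R).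
have /sigma_finiteP[G [TG ndG Goo]] := sigma_finiteT m.
have FGT : \bigcup_k (F k `*` G k) = setT.
  rewrite -subTset => -[x y] _.
  have [j _ Fjx] : (\bigcup_k F k) x by rewrite -TF.
  have [k _ Gky] : (\bigcup_k G k) y by rewrite -TG.
  exists (maxn j k) => //; split.
    by move: x Fjx; exact/subsetPset/ndF/leq_maxl.
  by move: y Gky; exact/subsetPset/ndG/leq_maxr.
pose unc := fun x : 'rV[R]_n.+1 =>
  (x ord0 ord0 : measurableTypeR R, \row_k x ord0 (lift ord0 k) : 'rV[R]_n).
have munc : measurable_fun setT unc.
  apply: measurable_fun_pair; first exact: measurable_coord.
  apply: measurable_fun_rV => i.
  rewrite [X in measurable_fun _ X](_ : _ =
    fun x : 'rV[R]_n.+1 => x ord0 (lift ord0 i) : measurableTypeR R).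
    exact: measurable_coord.
  by apply/funext => x; rewrite mxE.
have consK : cancel (@cons_rV n) unc.
  move=> [a v]; rewrite /unc /cons_rV/= mxE unlift_none/=; congr pair.
  by apply/rowP => k; rewrite !mxE liftK.
exists (fun k => unc @^-1` (F k `*` G k)).
  by rewrite -preimage_bigcup FGT preimage_setT.
move=> k; have [mF Fk] := Foo k; have [mG Gk] := Goo k; split.
  by rewrite -[X in measurable X]setTI; apply: munc => //; exact: measurableX.
rewrite /lebesgue_step /pushforward -comp_preimage.
rewrite (_ : unc \o _ = idfun) ?preimage_id//; last first.
  by apply/funext => x /=; rewrite consK.
by rewrite product_measure1E// lte_mul_pinfty// ge0_fin_numE.
Qed.

HB.instance Definition _ :=
  Measure_isSigmaFinite.Build _ _ _ lebesgue_step lebesgue_step_sigma_finite.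

End step.

Fixpoint lebesgue_rV n : {sigma_finite_measure set 'rV[R]_n -> \bar R} :=
  if n is n'.+1 then lebesgue_step (lebesgue_rV n') else \d_(0 : 'rV[R]_0).

End lebesgue_rV.

Section hypersurface.
Context {R : realType} {d : nat}.
Implicit Types (x y n : 'rV[R]_d.+1) (c : R).

Definition dotp x y : R := \sum_(k < d.+1) x ord0 k * y ord0 k.

Definition enorm x : R := Num.sqrt (dotp x x).

Definition pivot n : 'I_d.+1 := odflt ord0 [pick k | n ord0 k != 0].

(* The hyperplane dotp n x = c as the graph of an affine function of the
   coordinates of x other than the pivot one. *)
Definition hyperplane_graph n c (y : 'rV[R]_d) : 'rV[R]_d.+1 :=
  let j := pivot n in
  \row_k oapp (fun k' => y ord0 k')
    ((c - \sum_(k' < d) n ord0 (lift j k') * y ord0 k') / n ord0 j)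
    (unlift j k).

Lemma measurable_hyperplane_graph n c :
  measurable_fun setT (hyperplane_graph n c).
Proof.
apply: measurable_fun_rV => i.
case: (unliftP (pivot n) i) => [k ->|->].
  rewrite [X in measurable_fun _ X](_ : _ =
    fun y : 'rV[R]_d => y ord0 k : measurableTypeR R).
    exact: measurable_coord.
  by apply/funext => y; rewrite mxE liftK.
rewrite [X in measurable_fun _ X](_ : _ = fun y : 'rV[R]_d =>
    (c - \sum_(k' < d) n ord0 (lift (pivot n) k') * y ord0 k') *
    (n ord0 (pivot n))^-1).
  apply: measurable_funM; last exact: measurable_cst.
  apply: measurable_funB; first exact: measurable_cst.
  apply: measurable_sum => k.
  by apply: measurable_funM; [exact: measurable_cst|exact: measurable_coord].
by apply/funext => y; rewrite mxE unlift_none.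
Qed.

(* Surface measure ds of the hyperplane dotp n x = c, for n a unit vector: the
   area element sqrt (1 + |grad g|^2) of the graph of the affine function g
   given by hyperplane_graph equals 1 / |n_j|, with j the pivot. *)
Definition surface_measure n c : {measure set 'rV[R]_d.+1 -> \bar R} :=
  mscale (`|n ord0 (pivot n)|^-1)%:nng
    (pushforward_measure (lebesgue_rV d) (@measurable_hyperplane_graph n c)).

(* near x, the set A is the open half-space that n points out of *)
Definition outward_normal (A : set 'rV[R]_d.+1) n x : Prop :=
  \forall y \near x, A y <-> dotp n (y - x) < 0.

Definition diam (A : set 'rV[R]_d.+1) : R :=
  sup [set enorm (x - y) | x in A & y in A].

Definition inradius (A : set 'rV[R]_d.+1) : R :=
  sup [set rho | exists x, forall y, enorm (y - x) < rho -> A y].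

End hypersurface.

Section sobolev.
Context {R : realType} {d : nat}.
Local Notation V := 'rV[R]_d.+1.
Local Notation lambda := (lebesgue_rV d.+1).
Implicit Types (f v g : V -> R) (K : set V) (i : 'I_d.+1).

Definition basis_vec i : V := delta_mx ord0 i.

Definition partial i f : V -> R := fun x => 'D_(basis_vec i) f x.

Definition smooth f : Prop := forall s : seq 'I_d.+1,
  continuous (foldr partial f s) /\
  forall x i, derivable (foldr partial f s) x (basis_vec i).

Definition test_function K f : Prop :=
  smooth f /\ exists2 C, compact C /\ C `<=` K & forall x, ~ C x -> f x = 0.

Definition weak_partial K i v g : Prop :=
  lambda.-integrable K (EFin \o g) /\
  forall psi, test_function K psi ->
    \int[lambda]_(x in K) (v x * partial i psi x) =
    - \int[lambda]_(x in K) (g x * psi x).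

Definition W11 K v : Prop :=
  lambda.-integrable K (EFin \o v) /\ forall i, exists g, weak_partial K i v g.

(* Weak derivatives are unique up to a null set; one of them is chosen. *)
Definition wpartial K i v : V -> R := xget (cst 0) [set g | weak_partial K i v g].

(* msize is 1 + the total degree *)
Definition Pr (r : nat) : set (V -> R) :=
  [set p | exists2 q : mpoly d.+1 R, (msize q <= r.+1)%N &
    p = fun x : V => meval (x ord0) q].

End sobolev.

(* A partition of a bounded domain of R^(d+1) into open polytopes, together
   with its faces.  The faces inl e are interior, the faces inr e lie on
   the boundary of the domain.  A face is represented by a relatively open subset of a
   hyperplane, whose closure differs from it by a set of surface measure zero:
   this changes no integral, and both sides of the face are then half-spaces
   near each of its points.  Cells need not be convex, nor is the partition
   assumed to be conforming; when the intersection of the boundaries of two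
   cells consists of several flat pieces, each of them is a face. *)
Record mesh (R : realType) (d : nat) := Mesh {
  domain : set 'rV[R]_d.+1;
  ncells : nat;
  cell : 'I_ncells -> set 'rV[R]_d.+1;
  nifaces : nat;
  nbfaces : nat;
  face : 'I_nifaces + 'I_nbfaces -> set 'rV[R]_d.+1;
  fnormal : 'I_nifaces + 'I_nbfaces -> 'rV[R]_d.+1;
  foffset : 'I_nifaces + 'I_nbfaces -> R;
  icells : 'I_nifaces -> 'I_ncells * 'I_ncells;
  bcell : 'I_nbfaces -> 'I_ncells;
  domain_open : open domain;
  domain_bounded : bounded_set domain;
  domain_connected : connected domain;
  cell_open : forall k, open (cell k);
  cell_nonempty : forall k, cell k !=set0;
  cell_sub : forall k, cell k `<=` domain;
  cell_disjoint : trivIset setT cell;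
  domain_cover : domain `<=` \bigcup_k closure (cell k);
  fnormal_unit : forall e, enorm (fnormal e) = 1;
  face_nonempty : forall e, face e !=set0;
  face_flat : forall e x, face e x -> dotp (fnormal e) x = foffset e;
  face_relopen : forall e x, face e x ->
    \forall y \near x, dotp (fnormal e) y = foffset e -> face e y;
  face_boundary_null : forall e,
    surface_measure (fnormal e) (foffset e) (closure (face e) `\` face e) = 0%E;
  face_disjoint : trivIset setT face;
  iface_order : forall e, ((icells e).1 < (icells e).2)%N;
  iface_domain : forall e, face (inl e) `<=` domain;
  iface_normal1 : forall e x, face (inl e) x ->
    outward_normal (cell (icells e).1) (fnormal (inl e)) x;
  iface_normal2 : forall e x, face (inl e) x ->
    outward_normal (cell (icells e).2) (- fnormal (inl e)) x;
  bface_normal : forall e x, face (inr e) x ->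
    outward_normal (cell (bcell e)) (fnormal (inr e)) x;
  bface_domain_normal : forall e x, face (inr e) x ->
    outward_normal domain (fnormal (inr e)) x;
  cell_boundary : forall k, closure (cell k) `\` cell k `<=`
    \bigcup_(e in [set e | match e with
                           | inl e => k = (icells e).1 \/ k = (icells e).2
                           | inr e => k = bcell e
                           end]) closure (face e)
}.

Arguments cell {R d} m _ _.
Arguments face {R d} m _ _.
Arguments fnormal {R d} m _.
Arguments foffset {R d} m _.
Arguments icells {R d} m _.
Arguments bcell {R d} m _.

Inductive side := Minus | Plus.

Section discrete_derivative.
Context {R : realType} {d : nat} (M : mesh R d).
Local Notation V := 'rV[R]_d.+1.
Local Notation lambda := (lebesgue_rV d.+1).
Local Notation iface := 'I_(nifaces M).
Local Notation bface := 'I_(nbfaces M).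

Definition shape_regular (sigma : R) : Prop :=
  forall k, diam (cell M k) <= sigma * inradius (cell M k).

Definition locally_quasi_uniform (kappa : R) : Prop :=
  forall k l, closure (cell M k) `&` closure (cell M l) !=set0 ->
    diam (cell M k) <= kappa * diam (cell M l).

(* An element of a product over the cells K is a family indexed by the cells;
   the values of its k-th member outside of closure (cell M k) are junk. *)
Definition pwfun := 'I_(ncells M) -> V -> R.
Implicit Types (v w phi : pwfun) (i : 'I_d.+1) (s : side).

Definition Vrh (r : nat) : set pwfun := [set p | forall k, Pr r (p k)].

Definition Vh : set pwfun := [set v | forall k,
  W11 (cell M k) (v k) /\ {within closure (cell M k), continuous (v k)}].

Definition C0_domain : set pwfun := [set v |
  exists2 f : V -> R, {within domain M, continuous f} &
    forall k x, cell M k x -> v k x = f x].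

Definition innerT v w : R :=
  \sum_k \int[lambda]_(x in cell M k) (v k x * w k x).

Definition face_integral (e : iface + bface) (f : V -> R) : R :=
  \int[surface_measure (fnormal M e) (foffset M e)]_(x in face M e) f x.

Definition jump v (e : iface + bface) : V -> R :=
  match e with
  | inl e => fun x => v (icells M e).1 x - v (icells M e).2 x
  | inr e => v (bcell M e)
  end.

Definition trace_op s i v (e : iface + bface) : V -> R :=
  match e with
  | inl e =>
      let '(k, k') := icells M e in
      let n_neg := fnormal M (inl e) ord0 i < 0 in
      match s with
      | Minus => if n_neg then v k else v k'
      | Plus => if n_neg then v k' else v k
      end
  | inr e => v (bcell M e)
  end.

(* Here and below the default of xget is irrelevant: innerT is positive definite
   on the finite-dimensional space Vrh r, so there is exactly one solution. *)
Definition L2proj (r : nat) w : pwfun :=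
  xget (fun _ => cst 0)
    [set p | Vrh r p /\ forall phi, Vrh r phi -> innerT p phi = innerT w phi].

Definition deriv_form (gamma : iface -> R) s i v phi : R :=
  \sum_e face_integral e
    (fun x => trace_op s i v e x * fnormal M e ord0 i * jump phi e x)
  - innerT v (fun k => partial i (phi k))
  + \sum_(e : iface) face_integral (inl e)
    (fun x => gamma e * jump v (inl e) x * jump phi (inl e) x).

Definition disc_deriv_side (r : nat) (gamma : iface -> R) s i v : pwfun :=
  xget (fun _ => cst 0)
    [set g | Vrh r g /\
      forall phi, Vrh r phi -> innerT g phi = deriv_form gamma s i v phi].

(* gamma s i e is the value of gamma_i^s on the interior face e *)
Definition disc_deriv (r : nat) (gamma : side -> 'I_d.+1 -> iface -> R) i v
    : pwfun := fun k x =>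
  2^-1 * (disc_deriv_side r (gamma Minus i) Minus i v k x +
          disc_deriv_side r (gamma Plus i) Plus i v k x).

End discrete_derivative.

Arguments shape_regular {R d} M sigma.
Arguments locally_quasi_uniform {R d} M kappa.
Arguments Vh {R d} M _.
Arguments C0_domain {R d} M _.
Arguments L2proj {R d} M r w _ _.
Arguments disc_deriv {R d} M r gamma i v _ _.

(* Main.v *)
Require Import Defs.
From mathcomp Require Import all_boot all_order all_algebra.
From mathcomp Require mpoly.
From mathcomp Require Import all_classical all_reals all_analysis.
From mathcomp Require Import measurable_realfun.
From mathcomp Require Import ring lra zify.
Import Order.TTheory GRing.Theory Num.Theory.
Import numFieldNormedType.Exports.
Local Open Scope classical_set_scope.
Local Open Scope ring_scope.

(** Both identities come from a divergence theorem in the single direction i,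
   on a cell K and for a function W that is continuous on the closure of K and
   has an integrable weak derivative G: the integral of G over K is the sum over
   the faces of K of the integrals of W times the component i of the outward
   normal (cell_divergence). It is applied to W = w phi, where w is u v or F(u)
   and phi is a polynomial on each cell, and summed over the cells. The values of
   a function continuous in the domain agree on the two sides of an interior
   face; hence the jump of w vanishes there, both trace operators give the common
   value, and the form defining the discrete derivative of w reduces to the
   product (G, phi) for the function G that the product or chain rule provides
   (deriv_form_acl). The discrete derivatives and the projection of G are thus
   solutions of one and the same variational problem, and coincide.

   The functions u and v are only weakly differentiable, and the cells are
   arbitrary polytopes. Both difficulties are met by restriction to the lines of
   direction i. The class acl i K consists of the pairs (W, G) with W continuous
   on the closure of K, G integrable on K and, on almost every line, W locally
   an antiderivative of G. A continuous function and its weak derivative form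
   such a pair (weak_acl): testing the weak equation with products of a cut-off
   in the direction i and of bells in the other directions shows, by Fubini, that
   the equation holds on almost every line, for countably many cut-offs at once;
   these approximate the indicators of intervals with rational end points, whence
   the fundamental theorem of calculus on the line (du_bois_reymond). Products
   and compositions with functions of class C1 preserve the class (acl_mul,
   acl_comp), by the product and chain rules for antiderivatives on an interval.

   The divergence theorem itself reduces by Fubini to almost every line
   (line_formula). Such a line avoids the relative boundaries of the faces and
   the faces parallel to it, so its intersection with K is near every boundary
   point a half-line, on the side given by the normal of the face. The integral
   of G along it is then a signed sum of values of W at the crossings
   (divergence_line). Integrating the values over all lines restores the surface
   integrals, because the surface measure of a hyperplane is the Lebesgue measure
   of its projection along any direction i transverse to it, divided by the
   modulus of the component i of the unit normal (surface_measureE). *)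

Set Implicit Arguments.
Unset Strict Implicit.
Unset Printing Implicit Defensive.

(** * Inserting a coordinate *)
Section insertion.
Context {R : realType}.

(** The point of abscissa p.1 on the line of direction i that projects to p.2. *)
Definition ins n (i : 'I_n.+1) (p : measurableTypeR R * 'rV[R]_n) : 'rV[R]_n.+1 :=
  \row_k oapp (fun k' => p.2 ord0 k') p.1 (unlift i k).

Definition del n (i : 'I_n.+1) (x : 'rV[R]_n.+1) : 'rV[R]_n :=
  \row_k x ord0 (lift i k).

Lemma ins_at n (i : 'I_n.+1) p : ins i p ord0 i = p.1.
Proof. by rewrite mxE unlift_none. Qed.

Lemma ins_lift n (i : 'I_n.+1) p k : ins i p ord0 (lift i k) = p.2 ord0 k.
Proof. by rewrite mxE liftK. Qed.

Lemma del_ins n (i : 'I_n.+1) p : del i (ins i p) = p.2.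
Proof. by apply/rowP => k; rewrite mxE ins_lift. Qed.

Lemma ins_del n (i : 'I_n.+1) (x : 'rV[R]_n.+1) : ins i (x ord0 i, del i x) = x.
Proof.
by apply/rowP => k; case: (unliftP i k) => [j ->|->]; rewrite ?ins_at// ins_lift mxE.
Qed.

Lemma ins_eq n (i : 'I_n.+1) (x : 'rV[R]_n.+1) p : x ord0 i = p.1 -> del i x = p.2 -> x = ins i p.
Proof. by rewrite -{3}(ins_del i x) => -> ->; case: p. Qed.

Lemma measurable_ins n (i : 'I_n.+1) : measurable_fun setT (ins i).
Proof.
apply: measurable_fun_rV => k.
case: (unliftP i k) => [j ->|->].
  rewrite (_ : (fun _ => _) =
    (fun x : 'rV[R]_n => x ord0 j : measurableTypeR R) \o snd).
    by apply: measurableT_comp; [exact: measurable_coord|exact: measurable_snd].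
  by apply/funext => x; rewrite ins_lift.
rewrite (_ : (fun _ => _) = fst); first exact: measurable_fst.
by apply/funext => x; rewrite ins_at.
Qed.

Lemma measurable_del n (i : 'I_n.+1) : measurable_fun setT (del i).
Proof.
apply: measurable_fun_rV => k.
rewrite (_ : (fun _ => _) = (fun x : 'rV[R]_n.+1 => x ord0 (lift i k) : measurableTypeR R)).
  exact: measurable_coord.
by apply/funext => x; rewrite mxE.
Qed.

Lemma lift_swap n (i j : 'I_n.+2) (i' j' : 'I_n.+1) (k : 'I_n) :
  i = lift j i' -> j = lift i j' -> lift j (lift i' k) = lift i (lift j' k).
Proof.
move=> hi hj; apply/val_inj => /=.
have {hi} hi : i = bump j i' :> nat by rewrite [in LHS]hi.
have {hj} hj : j = bump i j' :> nat by rewrite [in LHS]hj.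
rewrite /bump in hi hj *.
case: (leqP j i') hi => h1 hi; case: (leqP i j') hj => h2 hj; 
 case: (leqP i' k) => h3; case: (leqP j' k) => h4; 
 try (repeat case: leqP => ?; lia).
Qed.

Lemma ins_swap n (i j : 'I_n.+2) (i' j' : 'I_n.+1) s t (z : 'rV[R]_n) :
  i = lift j i' -> j = lift i j' -> ins i (s, ins j' (t, z)) = ins j (t, ins i' (s, z)).
Proof.
move=> hi hj; apply: ins_eq => /=; first by rewrite hj ins_lift ins_at.
apply: ins_eq => /=; first by rewrite mxE -hi ins_at.
apply/rowP => k; rewrite !mxE (lift_swap k hi hj).
by rewrite liftK /= mxE liftK.
Qed.

Local Notation lam := (@lebesgue_rV R).

(** The measure lebesgue_rV splits off the coordinate 0. For i = lift ord0 i1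
   the induction hypothesis splits off i1 from the remaining coordinates, and
   the two outer integrals are then exchanged by Tonelli. *)
Lemma lebesgue_ins n (i : 'I_n.+1) (A : set 'rV[R]_n.+1) : measurable A ->
  lam n.+1 A = (lebesgue_measure \x lam n)%E (ins i @^-1` A).
Proof.
elim: n i A => [|n IH] i A mA; first by rewrite ord1.
case: (unliftP ord0 i) => [i' hi|->//].
have mI m (j : 'I_m.+1) (B : set 'rV[R]_m.+1) : measurable B -> measurable (ins j @^-1` B).
  by move=> mB; rewrite -[X in measurable X]setTI; exact: measurable_ins.
pose phi (q : (measurableTypeR R * measurableTypeR R) * 'rV[R]_n) : 'rV[R]_n.+2 :=
  ins ord0 (q.1.1, ins i' (q.1.2, q.2)).
have mphi : measurable_fun setT phi.
  apply: (measurableT_comp (measurable_ins _)).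
  apply: measurable_fun_pair.
    by apply: (measurableT_comp (f:=fst)) => //; exact: measurable_fst.
  apply: (measurableT_comp (measurable_ins _)).
  apply: measurable_fun_pair; last exact: measurable_snd.
  by apply: (measurableT_comp (f:=snd)) => //; exact: measurable_snd.
have mphiA : measurable (phi @^-1` A) by rewrite -[X in measurable X]setTI; exact: mphi.
pose f (p : measurableTypeR R * measurableTypeR R) : \bar R :=
  lam n (xsection (phi @^-1` A) p).
have mf : measurable_fun setT f by exact: measurable_fun_xsection.
have f0 p : (0 <= f p)%E by exact: measure_ge0.
have h1 : lam n.+2 A = (\int[lebesgue_measure]_s \int[lebesgue_measure]_t f (s, t))%E.
  rewrite /= /lebesgue_step /pushforward /product_measure1.
  apply: eq_integral => s _.
  rewrite [LHS](IH i'); last by apply: measurable_xsection; exact: mI.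
  rewrite [LHS]/product_measure1.
  apply: eq_integral => t _ /=; congr (lam n _).
  by apply/seteqP; split => w /xsectionP; [move=> /xsectionP h; apply/xsectionP|
    move=> h; apply/xsectionP; apply/xsectionP].
have h2 : (lebesgue_measure \x lam n.+1)%E (ins i @^-1` A) =
    (\int[lebesgue_measure]_t \int[lebesgue_measure]_s f (s, t))%E.
  rewrite [LHS]/product_measure1.
  apply: eq_integral => t _.
  rewrite [LHS](IH ord0); last by apply: measurable_xsection; exact: mI.
  rewrite [LHS]/product_measure1.
  apply: eq_integral => s _ /=; congr (lam n _).
  have h0 : ord0 = lift i (ord0 : 'I_n.+1).
    by apply/val_inj; rewrite /= hi /bump.
  apply/seteqP; split => w /xsectionP.
    move=> /xsectionP /= h; apply/xsectionP; rewrite /phi /=.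
    by rewrite -(ins_swap _ _ _ hi h0).
  rewrite /phi /= -(ins_swap _ _ _ hi h0) => h.
  by apply/xsectionP; apply/xsectionP.
by rewrite h1 h2; exact: fubini_tonelli.
Qed.
End insertion.

(** * Fubini along a coordinate, boxes and Borel sets *)
Section rV_measure.
Context {R : realType}.
Local Notation lam := (@lebesgue_rV R).
Local Notation leb := (@lebesgue_measure R).

Lemma integrable_ins n (i : 'I_n.+1) (f : 'rV[R]_n.+1 -> \bar R) :
  (lam n.+1).-integrable setT f ->
  (leb \x lam n)%E.-integrable setT (f \o ins i).
Proof.
move=> /integrableP[mf fi]; apply/integrableP; split.
  exact: (measurableT_comp mf (measurable_ins i)).
rewrite (_ : integral _ _ _ = \int[lam n.+1]_x `|f x|)%E//.
transitivity (\int[pushforward_measure (leb \x lam n)%E (measurable_ins i)]_x `|f x|)%E.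
  rewrite ge0_integral_pushforward//; last exact: measurableT_comp.
  exact: measurable_ins.
by apply: eq_measure_integral => A mA _; exact/esym/lebesgue_ins.
Qed.

Lemma integral_ins n (i : 'I_n.+1) (f : 'rV[R]_n.+1 -> \bar R) :
  (lam n.+1).-integrable setT f ->
  (\int[lam n.+1]_x f x = \int[lam n]_y \int[leb]_t f (ins i (t, y)))%E.
Proof.
move=> fi; have fi' := integrable_ins i fi.
rewrite (integral21_prod_meas1 fi').
transitivity (\int[pushforward_measure (leb \x lam n)%E (measurable_ins i)]_x f x)%E.
  by apply: eq_measure_integral => A mA _; exact: lebesgue_ins.
rewrite integral_pushforward//; first exact: measurable_ins.
by case/integrableP : fi.
Qed.

Lemma integrable_slice n (i : 'I_n.+1) (f : 'rV[R]_n.+1 -> \bar R) :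
  (lam n.+1).-integrable setT f ->
  {ae lam n, forall y, leb.-integrable setT (fun t => f (ins i (t, y)))}.
Proof. by move=> /(integrable_ins i) /ae_integrable2. Qed.

Lemma integrable_slice_integral n (i : 'I_n.+1) (f : 'rV[R]_n.+1 -> \bar R) :
  (lam n.+1).-integrable setT f ->
  (lam n).-integrable setT (fun y => \int[leb]_t f (ins i (t, y)))%E.
Proof.
move=> /(integrable_ins i) fi; have mf := measurable_int _ fi.
apply/integrableP; split; first exact: measurable_fubini_G fi.
have := (integrable21ltyP leb (lam n) mf).1 fi; apply: le_lt_trans.
have mG := measurable_fubini_G fi.
apply: ge0_le_integral => //; first exact: measurableT_comp mG.
  apply: (measurable_fun_fubini_tonelli_G (abse \o (f \o ins i))) => //=.
  exact: measurableT_comp.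
move=> y _; apply: le_abse_integral => //.
exact: (measurableT_comp mf (measurable_pair2 y)).
Qed.

Lemma lebesgue_ysection n (i : 'I_n.+1) (A : set 'rV[R]_n.+1) : measurable A ->
  (lam n.+1 A = \int[lam n]_y leb [set t | A (ins i (t, y))])%E.
Proof.
move=> mA; have mI : measurable (ins i @^-1` A).
  by rewrite -[X in measurable X]setTI; exact: measurable_ins.
rewrite (lebesgue_ins i)//.
rewrite (@product_measure_unique _ _ _ _ _ _ _ (leb \x^ lam n)%E)//; last first.
  by move=> B C mB mC; exact: product_measure2E.
rewrite /product_measure2; apply: eq_integral => y _ /=; congr (leb _).
by apply/seteqP; split => t; [move/ysectionP|move=> ?; apply/ysectionP].
Qed.

Lemma measurable_line n (i : 'I_n.+1) (A : set 'rV[R]_n.+1) y : measurable A ->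
  measurable ([set t | A (ins i (t, y))] : set (measurableTypeR R)).
Proof.
move=> mA; have := measurable_ins (R:=R) i measurableT mA.
rewrite setTI => /measurable_ysection -/(_ y).
by congr measurable; apply/seteqP; split => t; [move/ysectionP|move=> ?; apply/ysectionP].
Qed.

Lemma measurable_fun_line n (i : 'I_n.+1) (A : set 'rV[R]_n.+1) : measurable A ->
  measurable_fun setT (fun y : 'rV[R]_n => leb [set t | A (ins i (t, y))]).
Proof.
move=> mA; have := measurable_ins (R:=R) i measurableT mA.
rewrite setTI => /(measurable_fun_ysection leb).
congr measurable_fun; apply/funext => y /=; congr (leb _).
by apply/seteqP; split => t; [move/ysectionP|move=> ?; apply/ysectionP].
Qed.

(** A bounded set is contained in a cube; this form of boundedness passes to
   slices and projections for free. *)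
Definition cube n (N : R) : set 'rV[R]_n := [set x | forall k, `|x ord0 k| <= N].

Local Arguments cube : clear implicits.

Lemma measurable_forall n (P : 'I_n -> set R) : (forall k, measurable (P k)) ->
  measurable [set x : 'rV[R]_n | forall k, P k (x ord0 k)].
Proof.
move=> mP; rewrite (_ : [set _ | _] = \bigcap_k
    ((fun x : 'rV[R]_n => x ord0 k : measurableTypeR R) @^-1` P k)).
  apply: fin_bigcap_measurable => // k _.
  rewrite -[X in measurable X]setTI.
  exact: (@measurable_coord R n k measurableT _ (mP k)).
by apply/seteqP; split => x /= h k; [move=> _; exact: h|exact: (h k I)].
Qed.

Lemma measurable_cube n N : measurable (cube n N).
Proof.
apply: (@measurable_forall n (fun=> [set t | `|t| <= N])) => k.
rewrite (_ : [set _ | _] = `[-N, N]%classic); first exact: measurable_itv.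
by apply/seteqP; split => t /=; rewrite in_itv/= ler_norml.
Qed.

Lemma lebesgue_cube n N : (lam n (cube n N) < +oo)%E.
Proof.
elim: n => [|n IH]; first by rewrite /= diracE ltry.
rewrite (lebesgue_ins ord0); last exact: measurable_cube.
rewrite (_ : _ @^-1` _ = `[-N, N]%classic `*` cube n N).
  rewrite product_measure1E//; last exact: measurable_cube.
  rewrite lte_mul_pinfty//=; first by rewrite lebesgue_measure_itv/=; case: ifP.
by apply/seteqP; split => -[t y] /=; rewrite in_itv/= -ler_norml => h;
  [split => [|k]|case: h => h1 h2 k]; [have := h ord0|have := h (lift ord0 k)|];
  rewrite ?ins_at ?ins_lift//; case: (unliftP ord0 k) => [j ->|->];
  rewrite ?ins_at ?ins_lift.
Qed.

Definition obox n (p q : 'rV[R]_n) : set 'rV[R]_n :=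
  [set x | forall k, x ord0 k \in `]p ord0 k, q ord0 k[].
Definition cbox n (p q : 'rV[R]_n) : set 'rV[R]_n :=
  [set x | forall k, x ord0 k \in `[p ord0 k, q ord0 k]].

Definition ratv n (p : 'rV[rat]_n) : 'rV[R]_n := map_mx ratr p.

(** Countably many boxes suffice: open sets are Borel, and a statement that
   holds almost everywhere for each box holds almost everywhere for all of
   them. *)
Lemma open_rat_box n (U : set 'rV[R]_n) x : nbhs x U ->
  exists p q : 'rV[rat]_n, obox (ratv p) (ratv q) x /\ cbox (ratv p) (ratv q) `<=` U.
Proof.
move=> /nbhs_ballP[e /= e0 xeU].
have /choice[p Hp] : forall k, exists p : rat, ratr p \in `]x ord0 k - e, x ord0 k[.
  by move=> k; apply: rat_in_itvoo; rewrite gtrBl.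
have /choice[q Hq] : forall k, exists q : rat, ratr q \in `]x ord0 k, x ord0 k + e[.
  by move=> k; apply: rat_in_itvoo; rewrite ltrDl.
exists (\row_k p k), (\row_k q k); split.
  move=> k; rewrite !mxE in_itv/=.
  by have := Hp k; have := Hq k; rewrite !in_itv/= => /andP[-> _] /andP[_ ->].
move=> y hy; apply: xeU; split => // i k; rewrite (ord1 i).
have := hy k; have := Hp k; have := Hq k; rewrite !in_itv/= !mxE.
move=> /andP[_ a] /andP[b _] /andP[c d].
by rewrite /ball/= ltr_distlC; apply/andP; split; lra.
Qed.

Lemma measurable_obox n p q : measurable (@obox n p q).
Proof.
by apply: (@measurable_forall n (fun k => `]p ord0 k, q ord0 k[%classic)) => k.
Qed.

Lemma open_measurable_rV n (U : set 'rV[R]_n) : open U -> measurable U.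
Proof.
move=> oU; pose F (pq : 'rV[rat]_n * 'rV[rat]_n) :=
  if `[<cbox (ratv pq.1) (ratv pq.2) `<=` U>] then obox (ratv pq.1) (ratv pq.2) else set0.
rewrite (_ : U = \bigcup_pq F pq).
  apply: countable_bigcupT_measurable => [|pq]; first exact: countableP.
  by rewrite /F; case: ifP => _; [exact: measurable_obox|exact: measurable0].
apply/seteqP; split => [x Ux|x [[p q] _]].
  have [p [q [xpq pqU]]] := open_rat_box (open_nbhs_nbhs (conj oU Ux)).
  by exists (p, q) => //; rewrite /F/=; case: asboolP.
rewrite /F/=; case: asboolP => // pqU h; apply: pqU => k.
by have := h k; rewrite !in_itv/= => /andP[/ltW -> /ltW ->].
Qed.

Lemma closed_measurable_rV n (U : set 'rV[R]_n) : closed U -> measurable U.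
Proof. by move/closed_openC/open_measurable_rV/measurableC; rewrite setCK. Qed.

Lemma within_continuous_measurable n (D : set 'rV[R]_n) (f : 'rV[R]_n -> R) :
  measurable D -> {within D, continuous f} -> measurable_fun D f.
Proof.
move=> mD /continuousP cf; apply: (measurability _ (RGenOpens.measurableE R)).
move=> _ [_ [a [b ->] <-]].
have /open_subspaceP [V oV VD] : open (f @^-1` `]a, b[%classic : set (subspace D)).
  exact/cf/interval_open.
by rewrite setIC -VD; apply: measurableI => //; exact: open_measurable_rV.
Qed.
End rV_measure.

(** * Surface measure of a hyperplane *)
Section surface.
Context {R : realType}.
Local Notation lam := (@lebesgue_rV R).
Local Notation leb := (@lebesgue_measure R).

Lemma lebesgue_affine (a b : R) (A : set (measurableTypeR R)) : a != 0 ->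
  measurable A -> (leb A = `|a|%:E * leb ((fun s => a * s + b)%R @^-1` A))%E.
Proof.
move=> a0 mA.
have mf : measurable_fun setT ((fun s => a * s + b) : measurableTypeR R -> measurableTypeR R).
  by apply: measurable_funD => //; exact: measurable_funM.
have an0 : `|a| != 0 by rewrite normr_eq0.
apply: (@lebesgue_measure_unique _
  (mscale (`|a|)%:nng (pushforward_measure leb mf))) => // _ [[p q] _ <-].
rewrite /= /mscale/= /pushforward/= lebesgue_measure_itv/= lte_fin.
have [a_gt0|a_lt0] : a > 0 \/ a < 0 by apply/orP; rewrite -neq_lt eq_sym.
  rewrite (_ : _ @^-1` _ = `](p - b) / a, (q - b) / a]%classic); last first.
    apply/seteqP; split => s /=; rewrite !in_itv/= ltr_pdivrMr// ler_pdivlMr//;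
      by rewrite mulrC ltrBlDr lerBrDr.
  rewrite lebesgue_measure_itv/= lte_fin ltr_pM2r ?invr_gt0// ltrD2r.
  case: ifPn => // _; rewrite ?mule0// -!EFinB -EFinM gtr0_norm//; congr EFin.
  by field; rewrite gt_eqF.
rewrite (_ : _ @^-1` _ = `[(q - b) / a, (p - b) / a[%classic); last first.
  apply/seteqP; split => s /=; rewrite !in_itv/= ltr_ndivlMr// ler_ndivrMr//;
    by rewrite [s * a]mulrC ltrBlDr lerBrDr andbC.
rewrite lebesgue_measure_itv/= lte_fin ltr_nM2r ?invr_lt0// ltrD2r.
case: ifPn => // _; rewrite ?mule0// -!EFinB -EFinM ltr0_norm//; congr EFin.
by field; rewrite lt_eqF.
Qed.

Lemma dotp_ins d (i : 'I_d.+1) (n : 'rV[R]_d.+1) (p : R * 'rV[R]_d) :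
  dotp n (ins i p) =
  n ord0 i * p.1 + \sum_(k < d) n ord0 (lift i k) * p.2 ord0 k.
Proof.
rewrite /dotp (bigD1_ord i)//= ins_at; congr (_ + _).
by apply: eq_bigr => k _; rewrite ins_lift.
Qed.

(** The coordinate i of the point of the hyperplane dotp n x = c whose other
   coordinates are y, when n ord0 i is nonzero. *)
Definition plane_at d (i : 'I_d.+1) (n : 'rV[R]_d.+1) (c : R) (y : 'rV[R]_d) : R :=
  (c - \sum_(k < d) n ord0 (lift i k) * y ord0 k) / n ord0 i.

(** The parametrisation hyperplane_graph with an arbitrary coordinate in place
   of the pivot. *)
Definition graph_at d (i : 'I_d.+1) (n : 'rV[R]_d.+1) (c : R) (y : 'rV[R]_d) :
  'rV[R]_d.+1 := ins i (plane_at i n c y, y).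

Lemma dotp_graph_at d (i : 'I_d.+1) (n : 'rV[R]_d.+1) c y : n ord0 i != 0 ->
  dotp n (graph_at i n c y) = c.
Proof. by move=> ni; rewrite dotp_ins /plane_at /=; field. Qed.

Lemma graph_at_uniq d (i : 'I_d.+1) (n : 'rV[R]_d.+1) c (x : 'rV[R]_d.+1) :
  n ord0 i != 0 -> dotp n x = c -> x = graph_at i n c (del i x).
Proof.
move=> ni <-; rewrite -{1 2}(ins_del i x) dotp_ins /graph_at /plane_at /=.
by rewrite addrK mulrAC divff// mul1r.
Qed.

Lemma measurable_plane_at d (i : 'I_d.+1) (n : 'rV[R]_d.+1) c :
  measurable_fun setT (plane_at i n c : _ -> measurableTypeR R).
Proof.
apply: measurable_funM; last exact: measurable_cst.
apply: measurable_funB; first exact: measurable_cst.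
apply: measurable_sum => k.
by apply: measurable_funM; [exact: measurable_cst|exact: measurable_coord].
Qed.

Lemma measurable_graph_at d (i : 'I_d.+1) (n : 'rV[R]_d.+1) c :
  measurable_fun setT (graph_at i n c).
Proof.
apply: (measurableT_comp (measurable_ins i)).
by apply: measurable_fun_pair => //; exact: measurable_plane_at.
Qed.

(** Two parametrisations of a hyperplane, over the coordinates other than i
   and over those other than j, differ by an affine change of one variable of
   slope - n_i / n_j, the coordinates z other than i and j being parameters. *)
Lemma graph_at_ins d (i j : 'I_d.+2) (i' j' : 'I_d.+1) (n : 'rV[R]_d.+2) c z :
  i = lift j i' -> j = lift i j' -> n ord0 i != 0 -> n ord0 j != 0 ->
  exists2 b, forall s, graph_at j n c (ins i' (s, z)) =
             graph_at i n c (ins j' (- n ord0 i / n ord0 j * s + b, z)) & true.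
Proof.
move=> hi hj ni nj.
exists (plane_at j n c (ins i' (0, z))) => // s.
have Pj : plane_at j n c (ins i' (s, z)) =
    - n ord0 i / n ord0 j * s + plane_at j n c (ins i' (0, z)).
  rewrite /plane_at !(bigD1_ord i')//= -!hi !ins_at/= mulr0 add0r.
  under eq_bigr do rewrite ins_lift/=.
  under [in RHS]eq_bigr do rewrite ins_lift/=.
  by field.
rewrite -Pj [LHS](@graph_at_uniq _ i n c _ ni); last exact: dotp_graph_at.
congr graph_at.
by rewrite /graph_at -(ins_swap _ _ _ hi hj) del_ins.
Qed.

(** By Fubini in the coordinates other than i and j, this is the scaling of
   length under the affine map of graph_at_ins. *)
Lemma lebesgue_graph_at d (i j : 'I_d.+1) (n : 'rV[R]_d.+1) c
    (B : set 'rV[R]_d.+1) : measurable B -> n ord0 i != 0 -> n ord0 j != 0 ->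
  (`|n ord0 j|^-1%:E * lam d (graph_at j n c @^-1` B) =
   `|n ord0 i|^-1%:E * lam d (graph_at i n c @^-1` B))%E.
Proof.
move=> mB ni nj; case: (unliftP j i) => [i' hi|->//].
case: (unliftP i j) => [j' hj|hj]; last by rewrite hj.
case: d => [|d] in i j n B mB ni nj i' j' hi hj *; first by case: i' hi.
have mg k : measurable (graph_at k n c @^-1` B).
  by rewrite -[X in measurable X]setTI; exact: measurable_graph_at.
have nn : - n ord0 i / n ord0 j != 0 by rewrite mulf_neq0 ?oppr_eq0 ?invr_eq0.
rewrite (lebesgue_ysection i' (mg j)) (lebesgue_ysection j' (mg i)).
rewrite [in RHS](eq_integral (fun z => (`|- n ord0 i / n ord0 j|)%:E *
   leb [set t | (graph_at j n c @^-1` B) (ins i' (t, z))])%E).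
  rewrite ge0_integralZl//; first last.
  - exact: measurable_fun_line.
  rewrite muleA -EFinM; congr (_%:E * _)%E.
  rewrite normrM normrN normfV mulrA mulVf ?mul1r// normr_eq0//.
move=> z _ /=; have [b Hb _] := graph_at_ins c z hi hj ni nj.
rewrite (lebesgue_affine b nn).
  by congr (_ * leb _)%E; apply/seteqP; split => s /=; rewrite Hb.
exact: (measurable_line j' z (mg i)).
Qed.

Lemma dotp_neq0 d (n : 'rV[R]_d.+1) : enorm n = 1 -> exists k, n ord0 k != 0.
Proof.
move=> n1; apply: contrapT => /forallNP h.
have n0 : n = 0.
  by apply/rowP => k; rewrite mxE; apply/eqP/negPn/negP; exact: h.
move: n1; rewrite n0 /enorm /dotp big1 ?sqrtr0; first by lra.
by move=> k _; rewrite mxE mulr0.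
Qed.

Lemma pivotP d (n : 'rV[R]_d.+1) : enorm n = 1 -> n ord0 (pivot n) != 0.
Proof.
move=> /dotp_neq0[k nk]; rewrite /pivot; case: pickP => //= h.
by rewrite (h k) in nk.
Qed.

(** The surface measure is defined by projection along the pivot coordinate;
   integration over lines of direction i requires the projection along i. *)
Lemma surface_measureE d (i : 'I_d.+1) (n : 'rV[R]_d.+1) c B :
  enorm n = 1 -> n ord0 i != 0 -> measurable B ->
  (surface_measure n c B = `|n ord0 i|^-1%:E * lam d (graph_at i n c @^-1` B))%E.
Proof.
move=> n1 ni mB; rewrite -(@lebesgue_graph_at _ i (pivot n))//.
exact: pivotP.
Qed.

(** Every line of a direction transverse to the hyperplane meets it in one
   point. *)
Lemma lebesgue_hyperplane d (n : 'rV[R]_d.+1) c k : n ord0 k != 0 ->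
  lam d.+1 [set y | dotp n y = c] = 0%E.
Proof.
move=> nk.
have mH : measurable [set y | dotp n y = c].
  rewrite (_ : [set _ | _] = setT `&` (dotp n @^-1` [set c])); last first.
    by rewrite setTI; apply/seteqP; split.
  apply: (_ : measurable_fun setT (dotp n : _ -> measurableTypeR R)) => //.
  apply: measurable_sum => j.
  by apply: measurable_funM; [exact: measurable_cst|exact: measurable_coord].
rewrite (lebesgue_ysection k)//.
apply: integral0_eq => y _.
rewrite (_ : [set t | _] = [set plane_at k n c y]) ?lebesgue_measure_set1//.
apply/seteqP; split => t /=.
  move=> /(graph_at_uniq nk); rewrite del_ins /= => /(congr1 (fun x : 'rV_d.+1 => x ord0 k)).
  by rewrite !ins_at.
by move=> ->; exact: dotp_graph_at.
Qed.
End surface.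

(** * The fundamental theorem of calculus and the chain rule on an interval *)
Section line_calculus.
Context {R : realType}.
Local Notation leb := (@lebesgue_measure R).
Implicit Types (W G u g F : R -> R).

(** Cousin's form of the compactness of an interval: a relation between end
   points that is additive and holds on all small intervals around each point
   holds on the whole interval. It adds up local formulas without a choice of
   subdivision. *)
Lemma cousin (P : R -> R -> Prop) (a b : R) : a <= b ->
  (forall x y z, a <= x -> x <= y -> y <= z -> z <= b ->
     P x y -> P y z -> P x z) ->
  (forall c, a <= c -> c <= b -> exists2 e, 0 < e &
     forall x y, a <= x -> y <= b -> c - e < x -> x <= c -> c <= y -> y < c + e ->
     P x y) ->
  P a b.
Proof.
move=> ab Pcat Ploc; pose A := [set x | [/\ a <= x, x <= b & P a x]].
have Aa : A a.
  have [e e0 He] := Ploc a (lexx a) ab; split => //.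
  by apply: He => //; rewrite ?gtrBl ?ltrDl.
have ubA : ubound A b by move=> x [].
have supA : has_sup A by split; [exists a|exists b].
set c := sup A.
have ac : a <= c by apply: sup_upper_bound.
have cb : c <= b by apply: ge_sup => //; exists a.
have [e e0 He] := Ploc c ac cb.
have [x [ax xb Pax] cex] := sup_adherent e0 supA.
have xc : x <= c by apply: sup_upper_bound => //; split.
have Pac : P a c.
  by apply: (Pcat _ x) => //; apply: He => //; rewrite ltrDl.
have [bc|cltb] := leP b c; first by rewrite (_ : b = c)//; apply: le_anti; rewrite bc cb.
pose y := Num.min b (c + e / 2).
have cy : c < y by rewrite lt_min cltb ltrDl divr_gt0.
have yb : y <= b by rewrite ge_min lexx.
have yA : A y.
  split => //; first exact: le_trans (ltW cy).
  apply: (Pcat _ c) => //; first exact: ltW.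
  apply: He => //; rewrite ?gtrBl//; first exact: ltW.
  rewrite gt_min; apply/orP; right; rewrite ltrD2l ltr_pdivrMr// mulr_natr mulr2n.
  by rewrite ltrDl.
have : y <= c by apply: sup_upper_bound.
by rewrite leNgt cy.
Qed.

Lemma within_eps (f : R -> R) a b c e : {within `[a, b], continuous f} ->
  a <= c -> c <= b -> 0 < e -> exists2 d, 0 < d &
  forall t, a <= t -> t <= b -> `|t - c| < d -> `|f t - f c| < e.
Proof.
move=> /subspace_continuousP cf ac cb e0.
have /cf : `[a, b]%classic c by rewrite /= in_itv/= ac cb.
move=> /cvgrPdist_lt /(_ _ e0) [d /= d0 H].
exists d => // t at_ tb td; rewrite distrC; apply: H => //=.
  by rewrite distrC.
by rewrite in_itv/= at_ tb.
Qed.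

Definition intble G a b := leb.-integrable `[a, b]%classic (EFin \o G).
Definition itg G a b : R := \int[leb]_(t in `[a, b]) G t.
Definition ftc W G a b := W b - W a = itg G a b.

Lemma intbleS G a b x y : intble G a b -> a <= x -> y <= b -> intble G x y.
Proof.
move=> iG ax yb; apply: integrableS iG => //.
by apply: subset_itv; rewrite bnd_simp.
Qed.

Lemma itg_cat G x y z : intble G x z -> x <= y -> y <= z ->
  itg G x z = itg G x y + itg G y z.
Proof.
move=> iG xy yz; rewrite /itg.
have := @Rintegral_itvB R G (BLeft x) (BRight z) y iG.
rewrite !bnd_simp => /(_ xy yz) /eqP; rewrite subr_eq addrC => /eqP ->.
rewrite Rintegral_itv_obnd_cbnd//.
apply: integrableS iG => //; apply: subset_itv; rewrite ?bnd_simp//.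
Qed.

Lemma itgxx G x : itg G x x = 0.
Proof. by rewrite /itg set_itv1 Rintegral_set1. Qed.

Lemma ftc_cat W G x y z : intble G x z -> x <= y -> y <= z ->
  ftc W G x y -> ftc W G y z -> ftc W G x z.
Proof. by rewrite /ftc => iG xy yz h1 h2; rewrite (itg_cat iG xy yz) -h1 -h2; ring. Qed.

Lemma intbleM (h G : R -> R) a b : {within `[a, b], continuous h} ->
  intble G a b -> intble (fun t => h t * G t) a b.
Proof.
move=> ch iG.
have mh : measurable_fun `[a, b] h by apply: subspace_continuous_measurable_fun.
have bh : [bounded h x | x in `[a, b]%classic].
  have : compact (h @` `[a, b]) by apply: continuous_compact => //; exact: segment_compact.
  move=> /compact_bounded [M [Mr HM]]; exists M; split => // x Mx y xy /=.
  by apply: (HM x Mx); exists y.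
have := @integrableMr _ _ _ leb _ (measurable_itv _) _ _ mh bh iG.
by apply: eq_integrable.
Qed.

Lemma intbleD (g h : R -> R) a b : intble g a b -> intble h a b ->
  intble (fun t => g t + h t) a b.
Proof.
move=> ig ih; have := @integrableD _ _ _ leb _ (measurable_itv _) _ _ ig ih.
by apply: eq_integrable.
Qed.

Lemma intbleZ k g a b : intble g a b -> intble (fun t => k * g t) a b.
Proof.
move=> ig; have := @integrableZl _ _ _ leb _ (measurable_itv _) k _ ig.
by apply: eq_integrable.
Qed.

Lemma intble_cst k a b : intble (cst k) a b.
Proof.
rewrite /intble; apply: (@measurable_bounded_integrable _ _ _ leb) => //; last exact: bounded_cst.
by rewrite /= lebesgue_measure_itv/=; case: ifP => //; rewrite -EFinB ltry.
Qed.

Lemma itgD g h a b : intble g a b -> intble h a b ->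
  itg (fun t => g t + h t) a b = itg g a b + itg h a b.
Proof. by move=> ig ih; rewrite /itg RintegralD. Qed.

Lemma itgZ k g a b : intble g a b -> itg (fun t => k * g t) a b = k * itg g a b.
Proof. by move=> ig; rewrite /itg RintegralZl. Qed.

Lemma itg_le_norm g h a b : intble g a b -> intble h a b ->
  (forall t, a <= t -> t <= b -> `|g t| <= h t) -> `|itg g a b| <= itg h a b.
Proof.
move=> ig ih gh; apply: le_trans (le_normr_Rintegral _ ig) _ => //.
apply: le_Rintegral => //; first exact: integrable_norm.
by move=> t /=; rewrite in_itv/= => /andP[? ?]; exact: gh.
Qed.

Lemma intble_norm g a b : intble g a b -> intble (fun t => `|g t|) a b.
Proof. exact: integrable_norm. Qed.

Lemma mean_value_lip (F : R -> R) p q m r e :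
  (forall x, derivable F x 1) ->
  (forall x, `|x - m| < r -> `|(derive1 F) x - (derive1 F) m| <= e) ->
  `|p - m| < r -> `|q - m| < r ->
  `|F q - F p - (derive1 F) m * (q - p)| <= e * `|q - p|.
Proof.
move=> dF HF; wlog pq : p q / p <= q.
  move=> H pm qm; have [|/ltW qp] := leP p q; first by move=> pq; exact: H.
  by have := H _ _ qp qm pm; rewrite [`|p - q|]distrC -[X in X <= _]normrN; congr (`|_| <= _); ring.
move=> pm qm.
have cF x : {for x, continuous F}.
  by apply/differentiable_continuous/derivable1_diffP/dF.
have [c cpq ->] : exists2 c, c \in `[p, q] & F q - F p = (derive1 F) c * (q - p).
  apply: MVT_segment => //; last by apply: continuous_subspaceT => x; exact: cF.
  by move=> x _; rewrite derive1E; apply: DeriveDef.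
rewrite -mulrBl normrM ler_wpM2r//; apply: HF.
move: cpq; rewrite in_itv/= => /andP[pc cq].
by move: pm qm; rewrite !ltr_norml => /andP[? ?] /andP[? ?]; apply/andP; split; lra.
Qed.

(** F(u) - F(u c) is F'(u c) (u - u c) up to e |u - u c| near c, and F'(u) is
   e-close to F'(u c) there, so on a small interval around c the formula fails
   by at most e times the integral of |g|. This bound is additive, hence holds
   on [a, b] for every e. *)
Lemma ftc_comp (F u g : R -> R) a b : a <= b ->
  (forall x, derivable F x 1) -> continuous ((derive1 F) : R -> R) ->
  {within `[a, b], continuous u} -> intble g a b ->
  (forall x y, a <= x -> x <= y -> y <= b -> ftc u g x y) ->
  ftc (F \o u) (fun t => (derive1 F) (u t) * g t) a b.
Proof.
move=> ab dF cdF cu ig ug.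
have cFu : {within `[a, b], continuous (fun t => (derive1 F) (u t))}.
  by move=> t; apply: continuous_comp; [exact: cu|exact: cdF].
have iFg := intbleM cFu ig; have ing := intble_norm ig.
pose D x y := F (u y) - F (u x) - itg (fun t => (derive1 F) (u t) * g t) x y.
pose I x y := itg (fun t => `|g t|) x y.
suff H e : 0 < e -> `|D a b| <= e * I a b.
  apply/eqP; rewrite -subr_eq0 -normr_le0 -/(D a b).
  have I0 : 0 <= I a b by apply: Rintegral_ge0.
  apply/ler_addgt0Pl => e e0; rewrite addr0.
  have I1 : 0 < I a b + 1 by rewrite ltr_wpDl.
  (* I a b may be 0, hence the division by I a b + 1 *)
  have eI := divr_gt0 e0 I1.
  apply: le_trans (H _ eI) _; rewrite mulrAC ler_pdivrMr// ler_pM2l//.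
  by rewrite lerDl.
move=> e0; apply: (@cousin (fun x y => `|D x y| <= e * I x y)) => //.
  move=> x y z ax xy yz zb Hxy Hyz.
  have -> : D x z = D x y + D y z.
    rewrite /D (itg_cat _ xy yz); first by ring.
    exact: intbleS iFg _ _.
  rewrite /I (itg_cat _ xy yz); last exact: intbleS ing _ _.
  by rewrite mulrDr (le_trans (ler_normD _ _))// lerD.
move=> c ac cb.
have e2 : 0 < e / 2 by rewrite divr_gt0.
have /cvgrPdist_lt/(_ _ e2)[r /= r0 Hr] : (derive1 F) x @[x --> u c] --> (derive1 F) (u c).
  exact: cdF.
have [d d0 Hd] := within_eps cu ac cb r0.
exists d => // x y ax yb cdx xc cy ycd.
have xy := le_trans xc cy.
have near_c t : x <= t -> t <= y -> `|u t - u c| < r.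
  move=> xt ty; apply: Hd; [exact: le_trans xt|exact: le_trans yb|].
  by rewrite ltr_norml; apply/andP; split; lra.
have HF z : `|z - u c| < r -> `|(derive1 F) z - (derive1 F) (u c)| <= e / 2.
  by move=> zr; rewrite distrC; apply/ltW/Hr; rewrite /= distrC.
have xb := le_trans xy yb.
have ixy := intbleS ig ax yb.
have inxy := intbleS ing ax yb.
have iFxy := intbleS iFg ax yb.
have -> : D x y = (F (u y) - F (u x) - (derive1 F) (u c) * (u y - u x)) -
    itg (fun t => (derive1 F) (u t) * g t + (- (derive1 F) (u c)) * g t) x y.
  rewrite itgD//; last exact: intbleZ.
  by rewrite itgZ// -(ug x y)// /D; ring.
apply: le_trans (ler_normB _ _) _.
have -> : e * I x y = e / 2 * I x y + e / 2 * I x y by field.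
apply: lerD.
  apply: le_trans (mean_value_lip dF HF _ _) _.
  - exact: near_c.
  - exact: near_c.
  rewrite ler_pM2l// (ug x y)//; apply: itg_le_norm => //.
apply: le_trans (itg_le_norm (h := fun t => e / 2 * `|g t|) _ _ _) _.
- by apply: intbleD => //; exact: intbleZ.
- exact: intbleZ.
- move=> t xt ty; rewrite -mulrDl normrM ler_wpM2r//.
  exact/HF/near_c.
by rewrite itgZ.
Qed.
End line_calculus.

(** * Antiderivatives on an interval *)
Section antiderivatives.
Context {R : realType}.
Local Notation leb := (@lebesgue_measure R).
Implicit Types (W G u g F : R -> R).

(** W is an antiderivative of G in the sense of Lebesgue, that is, W is
   absolutely continuous with derivative G almost everywhere. *)
Definition ac W G (a b : R) :=
  [/\ {within `[a, b], continuous W}, intble G a b &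
      forall x y, a <= x -> x <= y -> y <= b -> ftc W G x y].

Lemma acS W G a b x y : ac W G a b -> a <= x -> y <= b -> ac W G x y.
Proof.
move=> [cW iG aW] ax yb; split.
- apply: continuous_subspaceW cW; apply: subset_itv; rewrite bnd_simp//.
- exact: intbleS iG _ _.
- by move=> s t xs st ty; apply: aW => //; [exact: le_trans xs|exact: le_trans yb].
Qed.

Lemma acD u v g h a b : ac u g a b -> ac v h a b ->
  ac (fun t => u t + v t) (fun t => g t + h t) a b.
Proof.
move=> [cu ig au] [cv ih av]; split.
- by move=> t; apply: cvgD; [exact: cu|exact: cv].
- exact: intbleD.
- move=> x y ax xy yb; rewrite /ftc itgD; [|exact: intbleS ig _ _|exact: intbleS ih _ _].
  by rewrite -au// -av//; ring.
Qed.

Lemma acZ k u g a b : ac u g a b -> ac (fun t => k * u t) (fun t => k * g t) a b.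
Proof.
move=> [cu ig au]; split.
- by move=> t; apply: cvgMr; exact: cu.
- exact: intbleZ.
- move=> x y ax xy yb; rewrite /ftc itgZ; last exact: intbleS ig _ _.
  by rewrite -au// -mulrBr.
Qed.

Lemma ac_comp (F u g : R -> R) a b :
  (forall x, derivable F x 1) -> continuous (derive1 F : R -> R) ->
  ac u g a b -> ac (F \o u) (fun t => derive1 F (u t) * g t) a b.
Proof.
move=> dF cF' [cu ig au].
have cFu : {within `[a, b], continuous (fun t => derive1 F (u t))}.
  by move=> t; apply: continuous_comp; [exact: cu|exact: cF'].
split.
- move=> t; apply: (continuous_comp (cu t)).
  by apply/differentiable_continuous/derivable1_diffP/dF.
- exact: intbleM.
- move=> x y ax xy yb; apply: ftc_comp => //.
  + by apply: continuous_subspaceW cu; apply: subset_itv; rewrite bnd_simp.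
  + exact: intbleS ig _ _.
  + by move=> s t xs st ty; apply: au => //; [exact: le_trans xs|exact: le_trans yb].
Qed.

Lemma derive1_sqr x : derive1 (fun x : R => x ^+ 2) x = 2 * x.
Proof. by rewrite derive1E exp_derive expr1 /GRing.scale/=; ring. Qed.

(** By polarisation, 2 u v = (u + v)^2 - u^2 - v^2, the product rule is the
   chain rule for squares. *)
Lemma acM u v g h a b : ac u g a b -> ac v h a b ->
  ac (fun t => u t * v t) (fun t => u t * h t + v t * g t) a b.
Proof.
have sq w k : ac w k a b -> ac (fun t => w t ^+ 2) (fun t => 2 * w t * k t) a b.
  move=> awk; have -> : (fun t => 2 * w t * k t) =
      (fun t => derive1 (fun x : R => x ^+ 2) (w t) * k t).
    by apply/funext => t; rewrite derive1_sqr.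
  apply: ac_comp awk => //.
  rewrite (_ : derive1 _ = fun x => 2 * x); first exact: mulrl_continuous.
  by apply/funext => x; exact: derive1_sqr.
move=> au av; have := sq _ _ (acD au av); have := acZ (-1) (acD (sq _ _ au) (sq _ _ av)).
move=> /acD /[apply] /(acZ (2^-1)).
by congr (ac _ _ a b); apply/funext => t; field.
Qed.

Lemma ac_id a b : ac id (cst 1) a b.
Proof.
split; first by apply: continuous_subspaceT => t; exact: cvg_id.
  exact: intble_cst.
move=> x y ax xy yb; rewrite /ftc /itg Rintegral_cst//= lebesgue_measure_itv/=.
rewrite mul1r lte_fin; case: ltP => //= yx.
by rewrite (_ : x = y) ?subrr//; apply: le_anti; rewrite xy yx.
Qed.

Lemma ac_C1 F a b : (forall x, derivable F x 1) ->
  continuous (derive1 F : R -> R) -> ac F (derive1 F) a b.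
Proof.
move=> dF cF; have := ac_comp dF cF (ac_id a b).
by congr (ac _ _ a b); apply/funext => t /=; rewrite mulr1.
Qed.

Lemma eq_itg g h a b : (forall t, a <= t -> t <= b -> g t = h t) ->
  itg g a b = itg h a b.
Proof.
by move=> gh; apply: eq_Rintegral => t; rewrite inE/= in_itv/= => /andP[? ?]; exact: gh.
Qed.

Lemma itg0 g a b : (forall t, a <= t -> t <= b -> g t = 0) -> itg g a b = 0.
Proof.
move=> g0; rewrite (eq_itg (h := cst 0))//.
by rewrite /itg Rintegral_cst//= mul0r.
Qed.

(** The local formula gives ftc on compact subintervals of the open interval,
   and both sides are continuous up to the end points. *)
Lemma ftc_closed W G a b : a <= b -> {within `[a, b], continuous W} ->
  intble G a b ->
  (forall c, a < c -> c < b -> exists2 e, 0 < e &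
     forall x y, c - e < x -> x <= y -> y < c + e -> ftc W G x y) ->
  ftc W G a b.
Proof.
rewrite le_eqVlt => /predU1P[<- _ _ _|ab cW iG H]; first by rewrite /ftc itgxx subrr.
have Hin x y : a < x -> x <= y -> y < b -> ftc W G x y.
  move=> ax xy yb; apply: (@cousin _ (ftc W G)) => //.
    move=> s t w xs st tw wy; apply: ftc_cat => //.
    by apply: intbleS iG _ _; [exact/ltW/(lt_le_trans ax)|exact/ltW/(le_lt_trans wy)].
  move=> c xc cy.
  have [e e0 He] := H c (lt_le_trans ax xc) (le_lt_trans cy yb).
  by exists e => // s t xs ty cs sc ct te; apply: He => //; exact: le_trans ct.
pose Phi y := W y - itg G a y.
have cPhi : {within `[a, b], continuous Phi}.
  move=> t; apply: cvgB; first exact: cW.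
  exact: (parameterized_integral_continuous (ltW ab) iG).
pose m := (a + b) / 2.
have am : a < m by rewrite /m; lra.
have mb : m < b by rewrite /m; lra.
have PhiE y : a < y -> y < b -> Phi y = Phi m.
  have aux s t : a < s -> s <= t -> t < b -> Phi s = Phi t.
    move=> as_ st tb; rewrite /Phi (itg_cat (y:=s) (z:=t))//; last 2 first.
      exact: intbleS iG (lexx a) (ltW tb).
      exact: ltW.
    by rewrite -(Hin s t)//; ring.
  by move=> ay yb; have [ym|/ltW my] := leP y m; [exact: aux|exact/esym/aux].
have [_ Pa Pb] := (continuous_within_itvP Phi ab).1 cPhi.
have PaE : Phi a = Phi m.
  apply: (cvg_unique (@norm_hausdorff _ R) Pa).
  apply: cvg_near_cst; near=> x; apply: PhiE; near: x; first exact: nbhs_right_gt.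
  exact: nbhs_right_lt.
have PbE : Phi b = Phi m.
  apply: (cvg_unique (@norm_hausdorff _ R) Pb).
  apply: cvg_near_cst; near=> x; apply: PhiE; near: x; first exact: nbhs_left_gt.
  exact: nbhs_left_lt.
have : Phi b = Phi a by rewrite PaE PbE.
by rewrite /Phi itgxx /ftc => E; rewrite -[W b](subrK (itg G a b)) E; ring.
Unshelve. all: by end_near. Qed.

Lemma finite_gap (I : finType) (r : I -> R) : (forall j, 0 < r j) ->
  exists2 e, 0 < e & forall j, e <= r j.
Proof.
move=> r0; exists (\big[Num.min/1]_j r j); last by move=> j; exact: bigmin_le_cond.
by elim/big_ind: _ => // x y x0 y0; rewrite lt_min x0.
Qed.

End antiderivatives.

(** * The divergence theorem on a line *)
Section divergence_line.
Context {R : realType}.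
Local Notation leb := (@lebesgue_measure R).

Lemma window_dist (c e x y t : R) :
  c - e < x -> x <= t -> t <= y -> y < c + e -> `|t - c| < e.
Proof. by move=> *; rewrite ltr_norml; apply/andP; split; lra. Qed.

Lemma shrink_window (e1 e2 : R) : 0 < e1 -> 0 < e2 -> exists e,
  [/\ 0 < e, forall c x, c - e < x -> c - e1 < x /\ c - e2 < x &
      forall c y, y < c + e -> y < c + e1 /\ y < c + e2].
Proof.
move=> e10 e20; exists (Num.min e1 e2); split; first by rewrite lt_min e10.
  move=> c x; rewrite ltrBlDr -ltrBlDl lt_min => /andP[].
  by rewrite !(ltrBlDl c x) -!ltrBlDr.
by move=> c y; rewrite -ltrBlDl lt_min !ltrBlDl => /andP[].
Qed.

Variables (I : finType) (act : pred I) (p s : I -> R).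
Variables (L C : set R) (W G : R -> R) (N : R).
Hypothesis LN : forall t, L t -> `|t| < N.
Hypothesis pN : forall j, act j -> `|p j| < N.
Hypothesis iG : leb.-integrable setT (EFin \o G \_ L).
Hypothesis cW : {within C, continuous W}.
Hypothesis LC : L `<=` C.
Hypothesis pC : forall j, act j -> C (p j).
Hypothesis p_inj : forall j k, act j -> act k -> p j = p k -> j = k.
Hypothesis s1 : forall j, act j -> (s j == 1) || (s j == -1).
Hypothesis crossing : forall j, act j -> exists2 e, 0 < e &
  forall t, `|t - p j| < e -> L t <-> s j * (t - p j) < 0.
Hypothesis inside : forall c, L c -> exists2 e, 0 < e &
  (forall t, `|t - c| < e -> L t) /\
  forall x y, c - e < x -> x <= y -> y < c + e -> ftc W G x y.
Hypothesis outside : forall c, ~ L c -> (exists2 j, act j & p j = c) \/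
  exists2 e, 0 < e & forall t, `|t - c| < e -> ~ L t.

Let f := G \_ L.

Let fi a b : intble f a b. Proof. exact: integrableS iG. Qed.

Let f_in t : L t -> f t = G t. Proof. by move=> Lt; rewrite /f patchE mem_set. Qed.

Let f_out t : ~ L t -> f t = 0. Proof. by move=> Lt; rewrite /f patchE memNset. Qed.

Let crossing_out j : act j -> ~ L (p j).
Proof.
move=> aj; have [e e0 He] := crossing aj.
by move=> /He; rewrite subrr normr0 mulr0 ltxx => /(_ e0).
Qed.

(** The limit from the left of the extension of W by 0 outside of L. With this
   convention the crossings to be counted between x and y are those of the
   half-open interval [x, y), so that the balance below is additive. *)
Let left_value t :=
  if `[< L t \/ exists2 j, act j & p j = t /\ s j = 1 >] then W t else 0.

Let crossings x y :=
  \sum_(j | act j) (if (x <= p j) && (p j < y) then s j * W (p j) else 0).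

Let balance x y := itg f x y = left_value y - left_value x + crossings x y.

Let balance_cat x y z : x <= y -> y <= z ->
  balance x y -> balance y z -> balance x z.
Proof.
move=> xy yz; rewrite /balance => Pxy Pyz.
have -> : crossings x z = crossings x y + crossings y z.
  rewrite /crossings -big_split; apply: eq_bigr => j _ /=.
  case: (leP y (p j)) => h1; case: (leP x (p j)) => h2 /=.
  - by rewrite add0r.
  - by have := lt_le_trans h2 (le_trans xy h1); rewrite ltxx.
  - by rewrite (lt_le_trans h1 yz) addr0.
  - by rewrite addr0.
by rewrite (itg_cat (y := y))// Pxy Pyz; ring.
Qed.

Let balance_refl x : balance x x.
Proof.
rewrite /balance itgxx subrr add0r /crossings big1// => j _.
by case: ifP => // /andP[h1]; rewrite ltNge h1.
Qed.

Let left_value_in t : L t -> left_value t = W t.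
Proof. by move=> Lt; rewrite /left_value; case: asboolP => // -[]; left. Qed.

Let left_value_out t : ~ L t -> (forall j, act j -> p j <> t) -> left_value t = 0.
Proof.
move=> nLt nt; rewrite /left_value; case: asboolP => // -[//|[j aj [pj _]]].
by case: (nt j aj).
Qed.

Let isolated c : exists2 e, 0 < e & forall j, `|p j - c| < e -> p j = c.
Proof.
have [e e0 He] := @finite_gap R I (fun j => if p j == c then 1 else `|p j - c|)
  ltac:(move=> j /=; case: eqVneq => // pjc; rewrite normr_gt0 subr_eq0//).
exists e => // j pje; apply/eqP; apply: contraT => pjc.
by have := He j; rewrite (negbTE pjc) leNgt pje.
Qed.

Let crossings0 c e x y : (forall j, `|p j - c| < e -> p j = c) ->
  c - e < x -> y < c + e ->
  (forall j, act j -> p j = c -> x <= p j -> p j < y -> False) -> crossings x y = 0.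
Proof.
move=> iso ex ye H; rewrite /crossings big1// => j aj; case: ifPn => // /andP[h1 h2].
by case: (H j aj) => //; apply: iso; exact: window_dist h1 (ltW h2) ye.
Qed.

Let balance_inside c : L c -> exists2 e, 0 < e & forall x y,
  c - e < x -> x <= y -> y < c + e -> balance x y.
Proof.
move=> Lc; have [e1 e10 iso] := isolated c.
have [e2 e20 [He2 Hftc]] := inside Lc.
have [e [e0 Hx Hy]] := shrink_window e10 e20.
exists e => // x y /Hx[x1 x2] xy /Hy[y1 y2].
have near_L t : x <= t -> t <= y -> L t.
  by move=> xt ty; apply: He2; exact: window_dist xt ty y2.
rewrite /balance (crossings0 iso)//; last first.
  by move=> j aj pj _ _; apply: (crossing_out aj); rewrite pj.
rewrite addr0 !left_value_in; [|exact: near_L|exact: near_L].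
rewrite -[LHS](eq_itg (g := G)); first by rewrite Hftc.
by move=> t xt ty; rewrite f_in//; exact: near_L.
Qed.

Let balance_outside c : ~ L c -> ~ (exists2 j, act j & p j = c) ->
  exists2 e, 0 < e & forall x y, c - e < x -> x <= y -> y < c + e -> balance x y.
Proof.
move=> nLc nc; have [e1 e10 iso] := isolated c.
have [//|[e2 e20 He2]] := outside nLc.
have [e [e0 Hx Hy]] := shrink_window e10 e20.
exists e => // x y /Hx[x1 x2] xy /Hy[y1 y2].
have far_L t : x <= t -> t <= y -> ~ L t.
  by move=> xt ty; apply: He2; exact: window_dist xt ty y2.
have nop t j : x <= t -> t <= y -> act j -> p j <> t.
  move=> xt ty aj pj; apply: nc; exists j => //; apply: iso.
  by rewrite pj; exact: window_dist xt ty y1.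
rewrite /balance (crossings0 iso)//; last by move=> j aj pj; case: nc; exists j.
rewrite !left_value_out ?subrr ?addr0; first last.
- by move=> j; exact: nop.
- exact: far_L.
- by move=> j; exact: nop.
- exact: far_L.
by apply: itg0 => t xt ty; rewrite f_out//; exact: far_L.
Qed.

Let itg_half c x y : C c -> (forall t, x <= t -> t <= y -> L t \/ t = c) ->
  (forall t, x < t -> t < y -> L t) -> x <= y -> itg f x y = W y - W x.
Proof.
move=> Cc H1 H2 xy; symmetry; apply: ftc_closed => //.
  apply: continuous_subspaceW cW => t /=; rewrite in_itv/= => /andP[xt ty].
  by case: (H1 t xt ty) => [/LC//|->].
move=> d xd dy; have [e e0 [He Hftc]] := inside (H2 d xd dy).
exists e => // u v du uv vd.
rewrite /ftc -[RHS](eq_itg (g := G)); first exact: Hftc.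
by move=> t ut tv; rewrite f_in//; apply: He; exact: window_dist ut tv vd.
Qed.

Let balance_crossing j : act j -> exists2 e, 0 < e &
  (forall x, p j - e < x -> x < p j -> balance x (p j)) /\
  (forall y, p j < y -> y < p j + e -> balance (p j) y).
Proof.
move=> aj; set c := p j; have [e1 e10 iso] := isolated c.
have [e2 e20 He2] := crossing aj.
have [e [e0 Hx Hy]] := shrink_window e10 e20.
have cl := pC aj.
have value0 t : `|t - c| < e1 -> t <> c -> ~ L t -> left_value t = 0.
  move=> te tc nL; apply: left_value_out => // k ak pk; apply: tc; rewrite -pk.
  by apply: iso; rewrite pk.
have Sl x : c - e1 < x -> crossings x c = 0.
  move=> ex; apply: (crossings0 iso) => //; first by rewrite ltrDl.
  by move=> k _ -> _; rewrite ltxx.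
have Sr y : c < y -> y < c + e1 -> crossings c y = s j * W c.
  move=> cy ye; rewrite /crossings (bigD1 j)//= lexx cy big1 ?addr0// => k /andP[ak kj].
  case: ifP => // /andP[h1 h2]; case/eqP: kj; apply: p_inj => //.
  by apply: iso; apply: window_dist h1 (ltW h2) ye; rewrite gtrBl.
exists e => //; case/orP: (s1 aj) => /eqP sj.
- have Bc : left_value c = W c.
    by rewrite /left_value; case: asboolP => // -[]; right; exists j.
  split=> [x /Hx[x1 x2] xc|y cy /Hy[y1 y2]].
    have Lx t : x <= t -> t < c -> L t.
      move=> xt tc; apply/He2; last by rewrite sj mul1r subr_lt0.
      by apply: window_dist xt (ltW tc) _; rewrite // ltrDl.
    rewrite /balance Sl// addr0 Bc left_value_in; last exact: Lx.
    apply: (itg_half cl); [|by move=> t /ltW; exact: Lx|exact: ltW].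
    by move=> t xt; rewrite le_eqVlt => /predU1P[->|tc]; [right|left; exact: Lx].
  have Ly t : c <= t -> t <= y -> ~ L t.
    move=> ct ty Lt; have te : `|t - c| < e2.
      by apply: window_dist ct ty y2; rewrite gtrBl.
    by have := (He2 t te).1 Lt; rewrite sj mul1r subr_lt0 ltNge ct.
  rewrite /balance Sr// Bc value0//; first last.
  + by apply: Ly => //; exact: ltW.
  + by move=> yc; rewrite yc ltxx in cy.
  + by apply: window_dist (ltW cy) (lexx _) y1; rewrite gtrBl.
  by rewrite sj mul1r sub0r addNr; apply: itg0 => t ct ty; rewrite f_out//; exact: Ly.
- have Bc : left_value c = 0.
    rewrite /left_value; case: asboolP => // -[/(crossing_out aj)//|[k ak [pk sk]]].
    have kj : k = j by exact: p_inj.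
    by move: sk; rewrite kj sj => /eqP; rewrite eqNr oner_eq0.
  split=> [x /Hx[x1 x2] xc|y cy /Hy[y1 y2]].
    have Lx t : x <= t -> t <= c -> ~ L t.
      move=> xt tc Lt; have te : `|t - c| < e2.
        by apply: window_dist xt tc _; rewrite // ltrDl.
      by have := (He2 t te).1 Lt; rewrite sj mulN1r oppr_lt0 subr_gt0 ltNge tc.
    rewrite /balance Sl// addr0 Bc value0//; first last.
    + by apply: Lx => //; exact: ltW.
    + by move=> yc; rewrite yc ltxx in xc.
    + by apply: window_dist (lexx _) (ltW xc) _; rewrite // ltrDl.
    by rewrite subrr; apply: itg0 => t ct ty; rewrite f_out//; exact: Lx.
  have Ly t : c < t -> t <= y -> L t.
    move=> ct ty; apply/He2; last by rewrite sj mulN1r oppr_lt0 subr_gt0.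
    by apply: window_dist (ltW ct) ty y2; rewrite gtrBl.
  rewrite /balance Sr// Bc left_value_in; last exact: Ly.
  rewrite sj mulN1r subr0; apply: (itg_half cl).
  + by move=> t; rewrite le_eqVlt => /predU1P[<-|ct ty]; [right|left; exact: Ly].
  + by move=> t ? /ltW; exact: Ly.
  + exact: ltW.
Qed.

Let balance_local c : exists2 e, 0 < e & forall x y,
  c - e < x -> x <= c -> c <= y -> y < c + e -> balance x y.
Proof.
have [Lc|nLc] := pselect (L c).
  have [e e0 He] := balance_inside Lc.
  by exists e => // x y ex xc cy ye; apply: He => //; exact: le_trans cy.
have [[j aj <-]|nc] := pselect (exists2 j, act j & p j = c); last first.
  have [e e0 He] := balance_outside nLc nc.
  by exists e => // x y ex xc cy ye; apply: He => //; exact: le_trans cy.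
have [e e0 [Hl Hr]] := balance_crossing aj.
exists e => // x y ex xc cy ye; apply: (balance_cat xc cy).
  by move: xc; rewrite le_eqVlt => /predU1P[->|]; [exact: balance_refl|exact: Hl].
by move: cy; rewrite le_eqVlt => /predU1P[->|cy]; [exact: balance_refl|exact: Hr].
Qed.

(** Here L is the trace on a line of a region whose boundary the line crosses
   at the points p j, leaving the region when s j = 1 and entering it when s j
   = -1. The formula is local and additive, so that the components of L never
   have to be described. *)
Theorem divergence_line :
  \int[leb]_t (G \_ L) t = \sum_(j | act j) s j * W (p j).
Proof.
have [N0|N0] := ltP 0 N; last first.
  have nL t : ~ L t by move=> /LN; rewrite ltNge (le_trans N0).
  rewrite big_pred0; last by move=> j; apply/negP => /pN; rewrite ltNge (le_trans N0).
  rewrite (_ : G \_ L = cst 0) ?Rintegral_cst ?mul0r//.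
  by apply/funext => t; exact: f_out.
have : balance (- N) N.
  apply: cousin.
  - by rewrite ltW// gtrN.
  - by move=> x y z _ xy yz _; exact: balance_cat.
  - move=> c _ _; have [e e0 He] := balance_local c.
    by exists e => // x y _ _; exact: He.
have value0 t : `|t| = N -> left_value t = 0.
  move=> tE; apply: left_value_out => [/LN|j /pN + pj]; first by rewrite tE ltxx.
  by rewrite pj tE ltxx.
rewrite /balance !value0 ?normrN ?gtr0_norm// subrr add0r => E.
transitivity (itg f (- N) N).
  rewrite /itg [RHS]Rintegral_mkcond; congr (Rintegral _ _ _); apply/funext => t.
  rewrite [RHS]patchE; case: ifPn => // /negP tN; apply: f_out => /LN.
  rewrite ltr_norml => /andP[h1 h2]; apply: tN.
  by rewrite inE/= in_itv/= (ltW h1) ltW.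
rewrite E; apply: eq_bigr => j aj; have := pN aj; rewrite ltr_norml => /andP[h1 h2].
by rewrite (ltW h1) h2.
Qed.
End divergence_line.

(** * A smooth step on the line *)
Section smooth_functions.
Context {R : realType}.
Local Notation leb := (@lebesgue_measure R).

Fixpoint Ck (n : nat) (f : R -> R) : Prop :=
  match n with
  | 0 => continuous f
  | n.+1 => (forall x, derivable f x 1) /\ Ck n (derive1 f)
  end.

Definition smooth1 (f : R -> R) := forall n, Ck n f.

Lemma derivable_continuous (f : R -> R) :
  (forall x, derivable f x 1) -> continuous f.
Proof. by move=> df x; apply/differentiable_continuous/derivable1_diffP/df. Qed.

Lemma Ck_S n f : Ck n.+1 f -> Ck n f.
Proof.
elim: n f => [|n IH] f [df]; first by move=> _; exact: derivable_continuous.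
by move=> Cf; split => //; exact: IH.
Qed.

Lemma Ck_intro n (f f' : R -> R) : (forall x : R, is_derive x 1 f (f' x)) -> Ck n f' ->
  Ck n.+1 f.
Proof.
move=> ff'; rewrite (_ : f' = derive1 f); first by split => // x; apply: ex_derive.
by apply/funext => x; rewrite derive1E derive_val.
Qed.

Lemma Ck_is_derive n f (x : R) : Ck n.+1 f -> is_derive x 1 f (derive1 f x).
Proof. by move=> [df _]; rewrite derive1E; exact: DeriveDef. Qed.

Lemma CkD n (f g : R -> R) : Ck n f -> Ck n g -> Ck n (fun t => f t + g t).
Proof.
elim: n f g => [|n IH] f g; first by move=> cf cg t; apply: cvgD; [exact: cf|exact: cg].
move=> Cf Cg; apply: (@Ck_intro n _ (fun t => derive1 f t + derive1 g t)).
  by move=> x; exact: (is_deriveD (Ck_is_derive x Cf) (Ck_is_derive x Cg)).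
by apply: IH; [case: Cf|case: Cg].
Qed.

Lemma Ck_cst n (c : R) : Ck n (cst c).
Proof.
elim: n c => [|n IH] c; first by move=> t; exact: cvg_cst.
by apply: (@Ck_intro n _ (cst 0)) => // x; exact: is_derive_cst.
Qed.

Lemma CkM n (f g : R -> R) : Ck n f -> Ck n g -> Ck n (fun t => f t * g t).
Proof.
elim: n f g => [|n IH] f g; first by move=> cf cg t; apply: cvgM; [exact: cf|exact: cg].
move=> Cf Cg; apply: (@Ck_intro n _ (fun t => f t * derive1 g t + g t * derive1 f t)).
  by move=> x; exact: (is_deriveM (Ck_is_derive x Cf) (Ck_is_derive x Cg)).
by apply: CkD; apply: IH; [exact: Ck_S|case: Cg|exact: Ck_S|case: Cf].
Qed.

Lemma is_derive_affine (f : R -> R) (df a b x : R) : is_derive (a * x + b) 1 f df ->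
  is_derive x 1 (fun t => f (a * t + b)) (a * df).
Proof.
move=> fdf.
have g' : is_derive x 1 (fun t : R => a * t + b) a.
  have := is_deriveD (is_deriveZ a (is_derive_id x (1 : R))) (is_derive_cst b x (1 : R)).
  by rewrite addr0 /GRing.scale/= mulr1.
have := @is_derive1_comp _ f (fun t => a * t + b) x _ _ fdf g'.
by rewrite mulrC.
Qed.

Lemma Ck_affine n f a b : Ck n f -> Ck n (fun t => f (a * t + b)).
Proof.
elim: n f => [|n IH] f.
  move=> cf t; apply: (@continuous_comp _ _ _ (fun t => a * t + b) f); last exact: cf.
  by apply: cvgD; [exact: mulrl_continuous|exact: cvg_cst].
move=> Cf; apply: (@Ck_intro n _ (fun t => a * derive1 f (a * t + b))).
  by move=> x; exact: (is_derive_affine (Ck_is_derive (a * x + b) Cf)).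
by apply: CkM; [exact: Ck_cst|apply: IH; case: Cf].
Qed.

(** The factor t^-k makes the family closed under differentiation; exp(-1/t)
   dominates it at 0, so that all members are smooth. *)
Definition flat (k : nat) (t : R) : R := if 0 < t then t^-1 ^+ k * expR (- t^-1) else 0.

Lemma flat_ge0 k t : 0 <= flat k t.
Proof.
by rewrite /flat; case: ifP => // t0; rewrite mulr_ge0 ?expR_ge0// exprn_ge0// invr_ge0 ltW.
Qed.

(** The term of degree k in the exponential series of 1/t. *)
Lemma flat_bounded k t : flat k t <= k`!%:R.
Proof.
rewrite /flat; case: ifPn => // t0; rewrite expRN ler_pdivrMr ?expR_gt0//.
have t1 : 0 <= t^-1 by rewrite invr_ge0 ltW.
case: k => [|k].
  by rewrite expr0 fact0 mul1r; have := expR_ge1Dx t^-1; lra.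
have := expR_ge1Dxn k t1; set y := _ ^+ _ => H.
have : y / k.+1`!%:R <= expR t^-1 by apply: le_trans H; rewrite lerDr.
by rewrite ler_pdivrMr ?ltr0n ?fact_gt0// mulrC.
Qed.

Lemma flat_shift k t : 0 < t -> flat k t = t ^+ 2 * flat k.+2 t.
Proof.
move=> t0; rewrite /flat t0 !exprS; field.
by rewrite gt_eqF.
Qed.

(** At 0 the difference quotient is h flat k.+2 h, which tends to 0 as flat
   k.+2 is bounded. *)
Lemma is_derive_flat k (x : R) : is_derive x 1 (flat k) (- k%:R * flat k.+1 x + flat k.+2 x).
Proof.
have [x0|x0|->] := ltgtP x 0.
- rewrite /flat !ltNge !(ltW x0)/= mulr0 addr0.
  apply: (@near_eq_is_derive _ _ _ (cst 0)); near=> t.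
  rewrite /flat ltNge ltW//; near: t; exact: lt_nbhsl.
- have xn0 : x != 0 by rewrite gt_eqF.
  apply: (@near_eq_is_derive R R R (fun t : R => t^-1 ^+ k * expR (- t^-1))).
    near=> t; rewrite /flat ifT//; near: t; exact: lt_nbhsr.
  have dV : is_derive x 1 (fun t : R => t^-1) (- x^-1 ^+ 2).
    have := is_deriveV xn0 (is_derive_id x 1).
    by rewrite /GRing.scale/= mulr1 exprVn.
  have dE : is_derive x 1 (fun t : R => expR (- t^-1)) (expR (- x^-1) * x^-1 ^+ 2).
    have := @is_derive1_comp _ expR (fun t => - t^-1) x _ _ (is_derive_expR _) (is_deriveN dV).
    by rewrite opprK.
  have := is_deriveM (is_deriveX k dV) dE.
  rewrite /GRing.scale/= !exprfctE => H; apply: (is_derive_eq H).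
  rewrite /flat x0; case: k {H} => [|k] /=; first by rewrite !exprS; ring.
  by rewrite !exprS; ring.
- have E0 j : flat j 0 = 0 by rewrite /flat ltxx.
  rewrite !E0 mulr0 addr0.
  have C : (fun h : R => h^-1 *: ((flat k \o shift 0) (h *: 1) - flat k 0)) @ 0^' --> (0 : R).
    apply/cvgrPdist_le => e e0.
    near=> h; rewrite /= E0 subr0 addr0 sub0r normrN.
    rewrite /GRing.scale/= mulr1.
    have [h0|h0] := leP h 0; first by rewrite /flat ltNge h0/= mulr0 normr0 ltW.
    rewrite flat_shift// mulrA exprS mulKf ?gt_eqF// expr1.
    rewrite ger0_norm; last by rewrite mulr_ge0 ?flat_ge0// ltW.
    have M0 : (0 : R) < (k.+2)`!%:R by rewrite ltr0n fact_gt0.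
    apply: (@le_trans _ _ (h * (k.+2)`!%:R)); first by rewrite ler_pM2l// flat_bounded.
    rewrite -ler_pdivlMr//.
    have : `|h| <= e / (k.+2)`!%:R.
      near: h; apply: dnbhs0_le; exact: divr_gt0.
    by rewrite ger0_norm// ltW.
  apply: DeriveDef; first by apply/cvg_ex; exists 0.
  by apply/cvg_lim.
Unshelve. all: by end_near. Qed.

Lemma Ck_flat n k : Ck n (flat k).
Proof.
elim: n k => [|n IH] k.
  by apply: derivable_continuous => x; apply: ex_derive; exact: is_derive_flat.
apply: Ck_intro; first by move=> x; exact: is_derive_flat.
by apply: CkD => //; apply: CkM => //; exact: Ck_cst.
Qed.

Definition bump (t : R) : R := flat 0 t * flat 0 (- 1 * t + 1).

Lemma smooth_bump : smooth1 bump.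
Proof. by move=> n; apply: CkM; [exact: Ck_flat|exact/Ck_affine/Ck_flat]. Qed.

Lemma bump_ge0 t : 0 <= bump t.
Proof. by rewrite mulr_ge0 ?flat_ge0. Qed.

Lemma bump_gt0 t : 0 < t -> t < 1 -> 0 < bump t.
Proof.
move=> t0 t1; rewrite /bump /flat t0 ifT; last by lra.
by rewrite !expr0 !mul1r mulr_gt0// expR_gt0.
Qed.

Lemma bump_out t : t <= 0 \/ 1 <= t -> bump t = 0.
Proof.
rewrite /bump /flat => -[t0|t1]; first by rewrite ltNge t0/= mul0r.
by rewrite [X in _ * X]ifF ?mulr0//; apply/negP; lra.
Qed.

Lemma integrable_bump : leb.-integrable setT (EFin \o bump).
Proof.
have : leb.-integrable `[0, 1] (EFin \o bump).
  apply: continuous_compact_integrable; first exact: segment_compact.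
  by apply: continuous_subspaceT => x; exact: (smooth_bump 0%N).
move=> H; have : leb.-integrable setT ((EFin \o bump) \_ `[0, 1]%classic).
  by apply: (@integrable_mkcond _ _ _ leb _ _ _).1 => //; exact: measurable_itv.
apply: eq_integrable => // t _; rewrite patchE; case: ifPn => // /negP nt /=.
rewrite bump_out//; have [t0|t0] := leP t 0; [by left|right].
by rewrite leNgt; apply/negP => t1; apply: nt; rewrite inE/= in_itv/= !ltW.
Qed.

Definition bump_prim (x : R) : R := \int[leb]_(t in `]-oo, x]) bump t.

Lemma is_derive_bump_prim (x : R) : is_derive x 1 bump_prim (bump x).
Proof.
have [] := @continuous_FTC1 R bump (BInfty R true) x (x + 1).
- by rewrite ltrDl.
- exact: integrableS integrable_bump.
- by rewrite ltNyr.
- exact: (smooth_bump 0%N).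
by move=> d e; rewrite -e derive1E; exact: DeriveDef.
Qed.

Lemma bump_primE x : bump_prim x = \int[leb]_t (bump \_ `]-oo, x]) t.
Proof. by rewrite /bump_prim Rintegral_mkcond. Qed.

Lemma bump_prim0 x : x <= 0 -> bump_prim x = 0.
Proof.
move=> x0; rewrite bump_primE (_ : _ \_ _ = cst 0) ?Rintegral_cst ?mul0r//.
apply/funext => t; rewrite patchE; case: ifPn => //; rewrite inE/= in_itv/= => tx.
by rewrite bump_out//; left; exact: le_trans x0.
Qed.

Lemma bump_prim1 x : 1 <= x -> bump_prim x = bump_prim 1.
Proof.
move=> x1; rewrite !bump_primE; congr (Rintegral _ _ _); apply/funext => t.
rewrite !patchE !mem_setE !in_itv/=; case: (leP t 1) => t1.
  by rewrite (le_trans t1 x1).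
by case: ifP => // _; rewrite bump_out//; right; exact: ltW.
Qed.

Lemma bump_prim_le x y : x <= y -> bump_prim x <= bump_prim y.
Proof.
move=> xy; have [c _] : exists2 c, c \in `[x, y] & bump_prim y - bump_prim x = bump c * (y - x).
  apply: MVT_segment => //.
    by move=> t _; exact: is_derive_bump_prim.
  apply: continuous_subspaceT; apply: derivable_continuous => t.
  by apply: ex_derive; exact: is_derive_bump_prim.
move=> E; rewrite -subr_ge0 E mulr_ge0 ?bump_ge0//; lra.
Qed.

Lemma bump_prim_gt0 : 0 < bump_prim 1.
Proof.
have [c] : exists2 c, c \in `]0, 1[ & bump_prim 1 - bump_prim 0 = bump c * (1 - 0).
  apply: MVT => //.
    by move=> t _; exact: is_derive_bump_prim.
  apply: continuous_subspaceT; apply: derivable_continuous => t.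
  by apply: ex_derive; exact: is_derive_bump_prim.
rewrite in_itv/= => /andP[c0 c1]; rewrite (@bump_prim0 0)// !subr0 mulr1 => ->.
exact: bump_gt0.
Qed.

(** The primitive of a bump function supported in [0, 1], normalised. *)
Lemma smooth_step : exists S : R -> R,
  [/\ smooth1 S, forall t, t <= 0 -> S t = 0, forall t, 1 <= t -> S t = 1,
      forall t, 0 <= S t <= 1 & forall t, 0 <= derive1 S t].
Proof.
have c0 := bump_prim_gt0; set c := bump_prim 1 in c0.
have dS (x : R) : is_derive x 1 (fun t => bump_prim t * c^-1) (bump x * c^-1).
  have := is_deriveM (is_derive_bump_prim x) (is_derive_cst c^-1 x 1).
  by rewrite /GRing.scale/= mulr0 add0r [_ * bump x]mulrC.
exists (fun t => bump_prim t * c^-1); split.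
- move=> n; apply: Ck_S; apply: Ck_intro dS _.
  by apply: CkM; [exact: smooth_bump|exact: Ck_cst].
- by move=> t t0; rewrite bump_prim0// mul0r.
- by move=> t t1; rewrite bump_prim1// divff// gt_eqF.
- move=> t; apply/andP; split.
    rewrite divr_ge0 ?(ltW c0)//.
    have [t0|/ltW t0] := leP t 0; first by rewrite bump_prim0.
    by rewrite -(bump_prim0 (lexx 0)) bump_prim_le.
  rewrite ler_pdivrMr// mul1r.
  have [t1|/ltW t1] := leP t 1; first exact: bump_prim_le.
  by rewrite bump_prim1.
- by move=> t; rewrite derive1E derive_val divr_ge0 ?bump_ge0 ?(ltW c0).
Qed.
End smooth_functions.

(** * Test functions of product form *)
Section tensor.
Context {R : realType}.

(** Products of functions of one coordinate: their partial derivatives are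
   again products, and they integrate coordinatewise. *)
Definition tens n (f : 'I_n -> R -> R) (x : 'rV[R]_n) : R := \prod_k f k (x ord0 k).

Lemma continuous_coord_comp n (g : R -> R) (k : 'I_n) : continuous g ->
  continuous (fun x : 'rV[R]_n => g (x ord0 k)).
Proof.
move=> cg x; apply: (@continuous_comp 'rV[R]_n R R (fun y => y ord0 k) g x); last exact: cg.
exact: coord_continuous.
Qed.

Lemma continuous_tens n (f : 'I_n -> R -> R) : (forall k, continuous (f k)) ->
  continuous (tens f).
Proof.
move=> cf; rewrite /tens.
elim: (index_enum _) => [|k r IH].
  rewrite (_ : (fun x => _) = cst 1); first exact: cst_continuous.
  by apply/funext => x; rewrite big_nil.
rewrite (_ : (fun x => _) =
    (fun x : 'rV[R]_n => f k (x ord0 k) * \prod_(j <- r) f j (x ord0 j))).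
  by move=> x; apply: continuousM; [exact: continuous_coord_comp|exact: IH].
by apply/funext => x; rewrite big_cons.
Qed.

Lemma tens_ins n (i : 'I_n.+1) (f : 'I_n.+1 -> R -> R) t (y : 'rV[R]_n) :
  tens f (ins i (t, y)) = f i t * tens (fun k => f (lift i k)) y.
Proof.
rewrite /tens (bigD1_ord i)//= ins_at; congr (_ * _).
by apply: eq_bigr => k _; rewrite ins_lift.
Qed.

Lemma shift_basis n (i : 'I_n.+1) (x : 'rV[R]_n.+1) h :
  h *: basis_vec i + x = ins i (h + x ord0 i, del i x).
Proof.
by apply: ins_eq => /=; [|apply/rowP => k]; rewrite !mxE eqxx/= ?eqxx ?mulr1//
   eq_sym (negbTE (neq_lift _ _)) mulr0 add0r.
Qed.

(** Partial derivatives only see the lines of the corresponding direction. *)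
Lemma partial_line n (i : 'I_n.+1) (f : 'rV[R]_n.+1 -> R) (t : R) y :
  (derivable f (ins i (t, y)) (basis_vec i) <->
   derivable (fun t => f (ins i (t, y))) t 1) /\
  partial i f (ins i (t, y)) = derive1 (fun t => f (ins i (t, y))) t.
Proof.
rewrite /partial derive1E /derivable /derive.
have -> : (fun h : R => h^-1 *:
     ((f \o shift (ins i (t, y))) (h *: basis_vec i) - f (ins i (t, y)))) =
   (fun h : R => h^-1 *:
     (((fun t => f (ins i (t, y))) \o shift t) (h *: (1 : R)) - f (ins i (t, y)))).
  apply/funext => h /=; congr (_ *: (f _ - _)).
  by rewrite shift_basis ins_at del_ins /= /GRing.scale/= mulr1.
by [].
Qed.

Lemma partial_tens n (i : 'I_n.+1) (f : 'I_n.+1 -> R -> R) x :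
  (forall t, derivable (f i) t 1) ->
  derivable (tens f) x (basis_vec i) /\
  partial i (tens f) x = tens (fun k => if k == i then derive1 (f k) else f k) x.
Proof.
move=> df; rewrite -(ins_del i x).
set t := x ord0 i; set y := del i x.
have [dE ->] := partial_line i (tens f) t y.
have -> : (fun t => tens f (ins i (t, y))) =
    (fun t => tens (fun k => f (lift i k)) y * f i t).
  by apply/funext => s; rewrite tens_ins mulrC.
set c := tens _ y.
have H : is_derive t 1 (fun t => c * f i t) (c * derive1 (f i) t).
  have dfi : is_derive t 1 (f i) (derive1 (f i) t) by rewrite derive1E; exact: DeriveDef.
  exact: (is_deriveZ c dfi).
split.
  apply/dE; rewrite (_ : (fun t => _) = (fun t => c * f i t)).
    by case: H.
  by apply/funext => s; rewrite tens_ins mulrC.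
rewrite derive1E derive_val tens_ins eqxx mulrC; congr (_ * _).
by apply: eq_bigr => k _; rewrite eq_sym (negbTE (neq_lift _ _)).
Qed.

(** The class of products of smooth functions is stable under partial
   derivatives. *)
Lemma smooth_tens n (f : 'I_n.+1 -> R -> R) : (forall k, smooth1 (f k)) ->
  smooth (tens f).
Proof.
move=> sf s.
suff [g sg ->] : exists2 g : 'I_n.+1 -> R -> R, (forall k, smooth1 (g k)) &
    foldr partial (tens f) s = tens g.
  split; first by apply: continuous_tens => k; exact: (sg k 0%N).
  by move=> x i; apply: (partial_tens (i := i) (f := g) x _).1; case: (sg i 1%N).
elim: s => [|i s [g sg IH]]; first by exists f.
exists (fun k => if k == i then derive1 (g k) else g k).
  by move=> k; case: eqVneq => // _ m; case: (sg k m.+1).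
rewrite /= IH; apply/funext => x.
by apply: (partial_tens (i := i) (f := g) x _).2; case: (sg i 1%N).
Qed.

Lemma compact_cbox n (p q : 'rV[R]_n) : compact (cbox p q).
Proof.
apply: (@rV_compact _ _ (fun k => `[p ord0 k, q ord0 k]%classic)) => k.
exact: segment_compact.
Qed.

Lemma test_function_tens n (K : set 'rV[R]_n.+1) (f : 'I_n.+1 -> R -> R) p q :
  (forall k, smooth1 (f k)) -> cbox p q `<=` K ->
  (forall k t, t \notin `[p ord0 k, q ord0 k] -> f k t = 0) ->
  test_function K (tens f).
Proof.
move=> sf pqK f0; split; first exact: smooth_tens.
exists (cbox p q); first by split => //; exact: compact_cbox.
move=> x /existsNP[k /negP xk]; rewrite /tens (bigD1 k)//= f0//.
by rewrite mul0r.
Qed.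
End tensor.

(** * Continuous functions with a weak derivative on the line *)
Section weak_line.
Context {R : realType}.
Local Notation leb := (@lebesgue_measure R).

Variable S : R -> R.
Hypothesis sS : smooth1 S.
Hypothesis S0 : forall t, t <= 0 -> S t = 0.
Hypothesis S1 : forall t, 1 <= t -> S t = 1.
Hypothesis S01 : forall t, 0 <= S t <= 1.
Hypothesis dS0 : forall t, 0 <= derive1 S t.

(** Smooth functions tending to the indicator of the half-line ]a, +oo[, and
   constant outside of [a, a + 1/n] for positive n. *)
Definition ramp (n : nat) (a t : R) : R := S (n%:R * t + - (n%:R * a)).

Lemma rampE n a t : ramp n a t = S (n%:R * (t - a)).
Proof. by rewrite /ramp mulrBr. Qed.

Lemma smooth_ramp n a : smooth1 (ramp n a).
Proof. by move=> k; exact: Ck_affine. Qed.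

Lemma ramp0 n a t : t <= a -> ramp n a t = 0.
Proof. by move=> ta; rewrite rampE S0// mulr_ge0_le0// subr_le0. Qed.

Lemma ramp1 n a t : a + n.+1%:R^-1 <= t -> ramp n.+1 a t = 1.
Proof.
move=> ta; rewrite rampE S1//.
have n0 : (0 : R) < n.+1%:R by rewrite ltr0n.
by rewrite mulrC -ler_pdivrMr// mul1r lerBrDl.
Qed.

Lemma ramp01 n a t : 0 <= ramp n a t <= 1.
Proof. exact: S01. Qed.

Lemma is_derive_ramp n a (t : R) :
  is_derive t 1 (ramp n a) (n%:R * derive1 S (n%:R * t + - (n%:R * a))).
Proof. by apply: is_derive_affine; apply: Ck_is_derive; exact: (sS 1%N). Qed.

Lemma derive1_ramp n a t :
  derive1 (ramp n a) t = n%:R * derive1 S (n%:R * t + - (n%:R * a)).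
Proof. by have H := is_derive_ramp n a t; rewrite derive1E [LHS](@derive_val _ _ _ _ _ _ _ H). Qed.

Lemma derive1_ramp_ge0 n a t : 0 <= derive1 (ramp n a) t.
Proof. by rewrite derive1_ramp mulr_ge0. Qed.

Lemma derive1_near_cst (f : R -> R) c t : (\near t, f t = c) -> derive1 f t = 0.
Proof.
move=> fc; rewrite derive1E (@near_eq_derive R R R f (cst c))//.
exact: derive_cst.
Qed.

Lemma derive1_ramp_out n a t : t < a \/ a + n.+1%:R^-1 < t ->
  derive1 (ramp n.+1 a) t = 0.
Proof.
case=> ta.
  apply: (@derive1_near_cst _ 0); near=> s; apply: ramp0; apply: ltW; near: s.
  exact: lt_nbhsl.
apply: (@derive1_near_cst _ 1); near=> s; apply: ramp1; apply: ltW; near: s.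
exact: lt_nbhsr.
Unshelve. all: by end_near. Qed.

Lemma cvg_ramp a t : ramp n a t @[n --> \oo] --> (if a < t then 1 else 0 : R).
Proof.
case: ltP => ta; last by apply: cvg_near_cst; near=> n; exact: ramp0.
apply: cvg_near_cst; near=> n.
have n0 : (0 : R) < n%:R.
  by rewrite ltr0n; near: n; exact: nbhs_infty_gt.
rewrite rampE S1// -ler_pdivrMr ?subr_gt0// mul1r.
by near: n; exact: nbhs_infty_ger.
Unshelve. all: by end_near. Qed.

Lemma ac_ramp n a x y : ac (ramp n a) (derive1 (ramp n a)) x y.
Proof.
apply: ac_C1; first by move=> t; case: (smooth_ramp n a 1%N).
by case: (smooth_ramp n a 1%N).
Qed.

Lemma eps_inv (e : R) : 0 < e -> \forall n \near \oo, n.+1%:R^-1 < e.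
Proof.
move=> e0; near=> n; rewrite invf_plt ?posrE//.
apply: (@lt_trans _ _ n%:R); last by rewrite ltr_nat.
by near: n; exact: nbhs_infty_gtr.
Unshelve. all: by end_near. Qed.

(** The derivative of a ramp is nonnegative, has integral 1, and its support
   shrinks to the point a. *)
Lemma approximate_identity (u : R -> R) P Q a : P < a -> a < Q ->
  {within `[P, Q], continuous u} ->
  itg (fun t => u t * derive1 (ramp n.+1 a) t) P Q @[n --> \oo] --> u a.
Proof.
move=> Pa aQ cu; apply/cvgrPdist_le => e e0.
have [d d0 Hd] := within_eps cu (ltW Pa) (ltW aQ) e0.
near=> n.
have n1 : n.+1%:R^-1 < d by near: n; exact: eps_inv.
have n2 : n.+1%:R^-1 < Q - a by near: n; apply: eps_inv; rewrite subr_gt0.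
have [cr ir ar] := ac_ramp n.+1 a P Q.
have PQ := lt_trans Pa aQ.
have I1 : itg (derive1 (ramp n.+1 a)) P Q = 1.
  rewrite -(ar P Q)// ?(ltW PQ)// ramp1; last by rewrite -lerBrDl ltW.
  by rewrite ramp0 ?subr0// ltW.
have iu := intbleM cu ir.
have -> : u a - itg (fun t => u t * derive1 (ramp n.+1 a) t) P Q =
   - itg (fun t => u t * derive1 (ramp n.+1 a) t + (- u a) * derive1 (ramp n.+1 a) t) P Q.
  by rewrite itgD//; [rewrite itgZ// I1; ring|exact: intbleZ].
rewrite normrN -[e]mulr1 -I1 -itgZ//.
apply: itg_le_norm; [by apply: intbleD => //; exact: intbleZ|exact: intbleZ|].
move=> t Pt tQ; rewrite -mulrDl normrM [`|derive1 _ _|]ger0_norm ?derive1_ramp_ge0//.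
have [ta|at_] := ltP t a; first by rewrite derive1_ramp_out ?mulr0//; left.
have [ta|ta] := ltP (a + n.+1%:R^-1) t; first by rewrite derive1_ramp_out ?mulr0//; right.
rewrite ler_wpM2r ?derive1_ramp_ge0// ltW// Hd//.
by rewrite ger0_norm ?subr_ge0// (le_lt_trans _ n1)// lerBlDl.
Unshelve. all: by end_near. Qed.

(** Smooth functions tending to the indicator of ]a, b]. *)
Definition plateau n a b t : R := ramp n a t - ramp n b t.

Lemma derive1_plateau n a b t :
  derive1 (plateau n a b) t = derive1 (ramp n a) t - derive1 (ramp n b) t.
Proof.
have da := is_derive_ramp n a t; have db := is_derive_ramp n b t.
have H := is_deriveB da db.
by rewrite derive1E [LHS](@derive_val _ _ _ _ _ _ _ H) -!derive1_ramp.
Qed.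

Lemma smooth_plateau n a b : smooth1 (plateau n a b).
Proof.
move=> k; rewrite (_ : plateau n a b = fun t => ramp n a t + cst (-1) t * ramp n b t).
  by apply: CkD; [exact: smooth_ramp|apply: CkM; [exact: Ck_cst|exact: smooth_ramp]].
by apply/funext => t; rewrite mulN1r.
Qed.

Lemma plateau_out n a b t : a <= b -> t < a \/ b + n.+1%:R^-1 < t ->
  plateau n.+1 a b t = 0 /\ derive1 (plateau n.+1 a b) t = 0.
Proof.
move=> ab H; have n0 : (0 : R) < n.+1%:R^-1 by rewrite invr_gt0 ltr0n.
rewrite derive1_plateau /plateau; case: H => ta.
  have tb := lt_le_trans ta ab.
  by rewrite !ramp0 ?ltW// !derive1_ramp_out ?subrr//; left.
have ta' : a + n.+1%:R^-1 < t by apply: le_lt_trans ta; rewrite lerD2r.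
by rewrite !ramp1 ?ltW// !derive1_ramp_out ?subrr//; right.
Qed.

Lemma plateau_le1 n a b t : `|plateau n a b t| <= 1.
Proof.
have /andP[a0 a1] := ramp01 n a t; have /andP[b0 b1] := ramp01 n b t.
by rewrite /plateau ler_norml; apply/andP; split; lra.
Qed.

Lemma smooth1_cont (f : R -> R) : smooth1 f -> continuous f.
Proof. by move/(_ 0%N). Qed.

(** The weak equation is tested with plateaus. Their derivatives tend to the
   difference of the Dirac masses at a and b, so the two terms tend to u a - u
   b and to the integral of g over ]a, b]. *)
Lemma du_bois_reymond (u g : R -> R) P Q a b : P < a -> a < b -> b < Q ->
  {within `[P, Q], continuous u} -> intble g P Q ->
  (\forall n \near \oo, itg (fun t => u t * derive1 (plateau n.+1 a b) t +
       g t * plateau n.+1 a b t) P Q = 0) ->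
  ftc u g a b.
Proof.
move=> Pa ab bQ cu ig H.
have aQ := lt_trans ab bQ; have Pb := lt_trans Pa ab.
have cp n : continuous (plateau n a b) by exact/smooth1_cont/smooth_plateau.
have ir n c : intble (derive1 (ramp n c)) P Q by case: (ac_ramp n c P Q).
have igp n : intble (fun t => g t * plateau n a b t) P Q.
  have := @intbleM R (plateau n a b) g P Q (continuous_subspaceT (@cp n)) ig.
  by congr (intble _ P Q); apply/funext => t; rewrite mulrC.
have iud n c : intble (fun t => u t * derive1 (ramp n c) t) P Q by exact: intbleM.
have E : \forall n \near \oo, itg (fun t => g t * plateau n.+1 a b t) P Q =
    itg (fun t => u t * derive1 (ramp n.+1 b) t) P Q -
    itg (fun t => u t * derive1 (ramp n.+1 a) t) P Q.
  move: H; apply: filterS => n.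
  have -> : (fun t => u t * derive1 (plateau n.+1 a b) t + g t * plateau n.+1 a b t) =
      (fun t => (u t * derive1 (ramp n.+1 a) t + (-1) * (u t * derive1 (ramp n.+1 b) t))
               + g t * plateau n.+1 a b t).
    by apply/funext => t; rewrite derive1_plateau; ring.
  have iN : intble (fun t => -1 * (u t * derive1 (ramp n.+1 b) t)) P Q by exact: intbleZ.
  rewrite !itgD//; last exact: intbleD.
  by rewrite itgZ// mulN1r => /eqP; rewrite addrC addr_eq0 opprB => /eqP.
have L1 : itg (fun t => g t * plateau n.+1 a b t) P Q @[n --> \oo] --> u b - u a.
  apply: (cvg_trans _ (cvgB (approximate_identity Pb bQ cu) (approximate_identity Pa aQ cu))).
  by apply: near_eq_cvg; move: E; apply: filterS => n ->.
pose gab t := g t * \1_(`]a, b]%classic : set R) t.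
have L2 : itg (fun t => g t * plateau n.+1 a b t) P Q @[n --> \oo] --> itg gab P Q.
  have mg : measurable_fun `[P, Q]%classic g.
    by case/integrableP : ig => /measurable_EFinP.
  have [|||||] := @dominated_convergence _ _ _ leb `[P, Q]%classic (measurable_itv _)
      (fun n t => (g t * plateau n.+1 a b t)%:E) (fun t => (gab t)%:E)
      (fun t => (`|g t|)%:E).
  - by move=> n; case/integrableP : (igp n.+1).
  - apply/measurable_EFinP; apply: measurable_funM => //.
  - apply: aeW => t _; apply: cvg_EFin; first by near=> n.
    rewrite /gab indicE mem_setE/= in_itv/=.
    have : (g t * (ramp n.+1 a t - ramp n.+1 b t)) @[n --> \oo] -->
        g t * ((if a < t then 1 else 0) - (if b < t then 1 else 0)).
      apply: cvgMr; apply: cvgB.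
        by rewrite (cvg_shiftS (fun n => ramp n a t)); exact: cvg_ramp.
      by rewrite (cvg_shiftS (fun n => ramp n b t)); exact: cvg_ramp.
    rewrite leNgt; congr (_ --> _); congr (_ * _).
    case: (ltP a t) => at_; case: (ltP b t) => bt //=; rewrite ?subrr ?subr0//.
    by have := lt_le_trans (lt_trans ab bt) at_; rewrite ltxx.
  - exact: (intble_norm ig).
  - apply: aeW => t n _; rewrite /= lee_fin normrM ler_piMr//; exact: plateau_le1.
  move=> igab _ L.
  have fin : (\int[leb]_(t in `[P, Q]) (gab t)%:E)%E \is a fin_num.
    exact: integrable_fin_num igab.
  by rewrite -(fineK fin) in L; move/fine_cvg: L.
rewrite /ftc (_ : u b - u a = itg gab P Q); last exact: (cvg_unique _ L1 L2).
have iab : leb.-integrable `]a, b]%classic (EFin \o g).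
  by apply: integrableS ig => //; apply: subset_itv; rewrite bnd_simp// ltW.
rewrite /itg -(Rintegral_itv_obnd_cbnd iab) Rintegral_mkcond [RHS]Rintegral_mkcond.
congr (Rintegral _ _ _); apply/funext => t.
rewrite !patchE !mem_setE /gab indicE mem_setE !in_itv/=.
case: (ltP a t) => at_ /=; last by rewrite mulr0 if_same.
case: (leP t b) => tb /=; last by rewrite mulr0 if_same.
by rewrite mulr1 (ltW (lt_trans Pa at_)) (ltW (le_lt_trans tb bQ)).
Unshelve. all: by end_near. Qed.

(** u minus the integral of g is continuous and takes one value at all
   rational points. *)
Lemma ftc_dense (u g : R -> R) P Q :
  {within `[P, Q], continuous u} -> intble g P Q ->
  (forall a b : rat, P < ratr a -> ratr a < ratr b :> R -> ratr b < Q ->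
     ftc u g (ratr a) (ratr b)) ->
  forall s t, P < s -> s <= t -> t < Q -> ftc u g s t.
Proof.
move=> cu ig H.
pose Phi y := u y - itg g P y.
have [PQ|QP] := ltP P Q; last first.
  move=> s t Ps st tQ.
  by have := lt_le_trans (lt_le_trans Ps st) (le_trans (ltW tQ) QP); rewrite ltxx.
have cPhi : {within `[P, Q], continuous Phi}.
  move=> t; apply: cvgB; first exact: cu.
  exact: (parameterized_integral_continuous (ltW PQ) ig).
have cat s t : P <= s -> s <= t -> t <= Q -> Phi t - Phi s = u t - u s - itg g s t.
  move=> Ps st tQ; rewrite /Phi (itg_cat (y := s) (z := t))//; first by ring.
  exact: intbleS ig _ _.
have Hrat (a b : rat) : P < ratr a -> ratr a < Q -> P < ratr b -> ratr b < Q ->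
    Phi (ratr a) = Phi (ratr b).
  wlog ab : a b / ratr a < ratr b :> R.
    move=> W Pa aQ Pb bQ; case: (ltgtP (ratr a : R) (ratr b)) => [ab|ab|->//].
      exact: W.
    by symmetry; apply: W.
  move=> Pa aQ Pb bQ; apply/esym/eqP; rewrite -subr_eq0 cat ?(ltW Pa) ?(ltW ab) ?(ltW bQ)//.
  by rewrite (H a b Pa ab bQ) subrr.
have [q0] := rat_in_itvoo PQ; rewrite in_itv/= => /andP[Pq0 q0Q].
have Hreal t : P < t -> t < Q -> Phi t = Phi (ratr q0).
  move=> Pt tQ; apply/eqP/negPn/negP => ne.
  have e0 : 0 < `|Phi t - Phi (ratr q0)| by rewrite normr_gt0 subr_eq0.
  have [d d0 Hd] := within_eps cPhi (ltW Pt) (ltW tQ) e0.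
  have lt1 : t < Num.min Q (t + d) by rewrite lt_min tQ ltrDl.
  have [q] := rat_in_itvoo lt1; rewrite in_itv/= lt_min => /andP[tq /andP[qQ qd]].
  have : `|Phi (ratr q) - Phi t| < `|Phi t - Phi (ratr q0)|.
    apply: Hd; [exact: ltW (lt_trans Pt tq)|exact: ltW|].
    by rewrite ger0_norm ?subr_ge0 ?(ltW tq)// ltrBlDl.
  by rewrite (Hrat q q0)//; [rewrite distrC ltxx|exact: lt_trans tq].
move=> s t Ps st tQ.
have := cat s t (ltW Ps) st (ltW tQ).
rewrite (Hreal s)//; last exact: le_lt_trans tQ.
rewrite (Hreal t)//; last exact: lt_le_trans st.
by rewrite subrr => /esym/eqP; rewrite subr_eq0 => /eqP.
Qed.
End weak_line.

(** * Functions determined by their integrals over boxes, and slices *)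
Section boxes.
Context {R : realType}.
Local Notation lam := (@lebesgue_rV R).
Local Notation leb := (@lebesgue_measure R).

Definition oboxes n : set (set 'rV[R]_n) := [set A | exists c e, A = obox c e].

Lemma obox_setI n (c e c' e' : 'rV[R]_n) : obox c e `&` obox c' e' =
  obox (\row_k Num.max (c ord0 k) (c' ord0 k)) (\row_k Num.min (e ord0 k) (e' ord0 k)).
Proof.
apply/seteqP; split => x /=.
  move=> [h h'] k; move: (h k) (h' k).
  by rewrite !in_itv/= !mxE gt_max lt_min => /andP[-> ->] /andP[-> ->].
move=> h; split => k; have := h k; rewrite !in_itv/= !mxE gt_max lt_min;
  by move=> /andP[/andP[h1 h2] /andP[h3 h4]]; apply/andP.
Qed.

Lemma setI_closed_oboxes n : setI_closed (@oboxes n).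
Proof.
by move=> _ _ [c [e ->]] [c' [e' ->]]; rewrite obox_setI; do 2 eexists.
Qed.

Lemma measurable_oboxes n : @measurable _ 'rV[R]_n = <<s @oboxes n >>.
Proof.
apply/seteqP; split; last first.
  apply: smallest_sub; first exact: sigma_algebra_measurable.
  by move=> _ [c [e ->]]; exact: measurable_obox.
apply: smallest_sub; first exact: smallest_sigma_algebra.
move=> A /=; rewrite -bigcup_seq/= => -[k _ [B mB <-]].
rewrite setTI.
suff : measurable `<=` [set B : set (measurableTypeR R) |
   <<s @oboxes n >> ((fun x : 'rV[R]_n => x ord0 k) @^-1` B)] by exact.
rewrite [X in X `<=` _]RGenOpens.measurableE.
have [S0 SC SU] := smallest_sigma_algebra setT (@oboxes n).
apply: smallest_sub.
  split => /=.
  - by rewrite preimage_set0.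
  - by move=> C hC; rewrite setTD preimage_setC -setTD; exact: SC.
  - by move=> F hF; rewrite preimage_bigcup; exact: SU.
move=> _ [x [y ->]] /=.
pose c m : 'rV[R]_n := \row_j if j == k then x else - m%:R.
pose e m : 'rV[R]_n := \row_j if j == k then y else m%:R.
rewrite (_ : _ @^-1` _ = \bigcup_m obox (c m) (e m)).
  by apply: SU => m; apply: sub_sigma_algebra; exists (c m), (e m).
apply/seteqP; split => z /=; last first.
  by move=> [m _ /(_ k)]; rewrite !mxE eqxx.
move=> zk.
have : \forall m \near \oo, forall j : 'I_n, `|z ord0 j| < m%:R.
  apply: filter_forall => j.
  by apply: nbhs_infty_gtr; exact: num_real.
move=> [m _ /(_ m (leqnn m)) Hm]; exists m => // j; rewrite !mxE.
case: eqP => [->//|_]; rewrite in_itv/=; by have := Hm j; rewrite ltr_norml.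
Qed.

(** Boxes form a pi-system generating the Borel sets, so by Dynkin the
   integral of h vanishes on all Borel subsets of the given box. *)
Lemma ae0_of_boxes n (h : 'rV[R]_n -> R) p q :
  (lam n).-integrable setT (EFin \o h) ->
  (forall c e, \int[lam n]_(y in obox c e `&` obox p q) h y = 0) ->
  {ae lam n, forall y, obox p q y -> h y = 0}.
Proof.
move=> ih H; set O := obox p q.
have mO : measurable O by exact: measurable_obox.
have ihS A : measurable A -> (lam n).-integrable A (EFin \o h).
  by move=> mA; apply: integrableS ih.
pose P A := \int[lam n]_(y in A `&` O) h y = 0.
have PT : P setT by have := H p q; rewrite /P setIid setTI.
have PS : forall S, <<s @oboxes n >> S -> P S.
  apply: (dynkin_induction (measurable_oboxes n) (@setI_closed_oboxes n)) => //.
  - by move=> _ [c [e ->]]; exact: H.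
  - move=> S mS PSS; move: PT; rewrite /P -(setUv S) setIUl.
    rewrite Rintegral_setU//; first by rewrite PSS add0r.
    + exact: measurableI.
    + by apply: measurableI => //; exact: measurableC.
    + by apply: ihS; rewrite -setIUl; apply: measurableI => //; apply: measurableU => //; exact: measurableC.
    + by apply/disj_setPS => x [[? _] [? _]].
  - move=> F mF tF PF; rewrite /P setI_bigcupl /Rintegral integral_bigcup//.
    + rewrite eseries0//= => k _ _; have := PF k; rewrite /P /Rintegral => PFk.
      have fin : (\int[lam n]_(x in F k `&` O) (h x)%:E)%E \is a fin_num.
        by apply: integrable_fin_num => //; [exact: measurableI|apply: ihS; exact: measurableI].
      by rewrite -(fineK fin) PFk.
    + by apply: trivIset_setIr.
    + by move=> k; exact: measurableI.
    + by apply: ihS; apply: bigcup_measurable => k _; exact: measurableI.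
have : ae_eq (lam n) O (EFin \o h) (cst 0%E).
  apply: integral_ae_eq => //; first exact: ihS.
  move=> E EO mE; rewrite integral0.
  have := PS E; rewrite -measurable_oboxes => /(_ mE).
  rewrite /P setIidl// /Rintegral => PE.
  have fin : (\int[lam n]_(x in E) (h x)%:E)%E \is a fin_num.
    by apply: integrable_fin_num => //; apply: ihS.
  by rewrite -(fineK fin) PE.
by apply: filterS => y /= Hy Oy; have [] := Hy Oy.
Qed.

Definition slice n (i : 'I_n.+1) (H : 'rV[R]_n.+1 -> R) (y : 'rV[R]_n) : R :=
  \int[leb]_t H (ins i (t, y)).

Lemma integrable_sliceR n (i : 'I_n.+1) (H : 'rV[R]_n.+1 -> R) :
  (lam n.+1).-integrable setT (EFin \o H) ->
  (lam n).-integrable setT (EFin \o slice i H).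
Proof.
move=> /(integrable_slice_integral i) iE; have mE := measurable_int _ iE.
apply: le_integrable iE => //.
  apply/measurable_EFinP.
  exact: (measurableT_comp (fine_measurable measurableT)).
move=> y _ /=; rewrite /slice /Rintegral.
by case: (\int[_]_t _)%E => [r| |] //=; rewrite ?leey// normr0 leey.
Qed.

Lemma integral_sliceR n (i : 'I_n.+1) (H : 'rV[R]_n.+1 -> R) (eta : 'rV[R]_n -> R) :
  (lam n.+1).-integrable setT (EFin \o H) ->
  measurable_fun setT eta -> (forall y, `|eta y| <= 1) ->
  \int[lam n.+1]_x (eta (del i x) * H x) = \int[lam n]_y (eta y * slice i H y).
Proof.
move=> iH meta eta1.
have iHe : (lam n.+1).-integrable setT (EFin \o (fun x => eta (del i x) * H x)).
  have mH := measurable_int _ iH.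
  apply: le_integrable iH => //.
    apply/measurable_EFinP; apply: measurable_funM.
      exact: (measurableT_comp meta (measurable_del i)).
    exact/measurable_EFinP.
  by move=> x _ /=; rewrite lee_fin normrM ler_piMl.
rewrite /Rintegral (integral_ins i iHe); congr fine.
have iS := integrable_sliceR i iH.
apply: ae_eq_integral => //.
- by have := integrable_slice_integral i iHe; case/integrableP.
- apply/measurable_EFinP; apply: measurable_funM => //.
  by case/integrableP : iS => /measurable_EFinP.
have := integrable_slice i iH; apply: filterS => y /= iy _.
rewrite /slice /Rintegral EFinM fineK; last exact: integrable_fin_num.
rewrite -integralZl//; apply: eq_integral => t _.
by rewrite /= del_ins.
Qed.
End boxes.

(** * The weak derivative on almost every line *)
Section weak_acl.
Context {R : realType}.
Local Notation lam := (@lebesgue_rV R).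
Local Notation leb := (@lebesgue_measure R).

Lemma integrable_mul_bounded dT (T : measurableType dT) (mu : {measure set T -> \bar R})
    (D : set T) (f h : T -> R) B : measurable D ->
  mu.-integrable D (EFin \o f) -> measurable_fun D h ->
  (forall x, D x -> `|h x| <= B) -> mu.-integrable D (EFin \o (fun x => f x * h x)).
Proof.
move=> mD fi mh hB.
have bh : [bounded h x | x in D].
  by exists B; split; [exact: num_real|move=> M BM x Dx /=; exact: le_trans (hB x Dx) (ltW BM)].
have := @integrableMl _ _ _ mu D mD (EFin \o f) h fi mh bh.
by apply: eq_integrable.
Qed.

Lemma smooth1_derive (f : R -> R) : smooth1 f -> smooth1 (derive1 f).
Proof. by move=> sf n; case: (sf n.+1). Qed.

Lemma derive1_out (f : R -> R) P Q : (forall t, t \notin `[P, Q] -> f t = 0) ->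
  forall t, t \notin `[P, Q] -> derive1 f t = 0.
Proof.
move=> f0 t; rewrite in_itv/= negb_and -!ltNge => /orP[tP|Qt];
  apply: (@derive1_near_cst _ _ 0); near=> s; apply: f0;
  rewrite in_itv/= negb_and -!ltNge; apply/orP; [left|right]; near: s.
- exact: lt_nbhsl.
- exact: lt_nbhsr.
Unshelve. all: by end_near. Qed.

Lemma smooth1_bounded (f : R -> R) P Q : smooth1 f ->
  (forall t, t \notin `[P, Q] -> f t = 0) -> exists B, forall t, `|f t| <= B.
Proof.
move=> sf f0.
have : compact (f @` `[P, Q]).
  apply: continuous_compact; last exact: segment_compact.
  by apply: continuous_subspaceT; exact: (sf 0%N).
move=> /compact_bounded [M [_ HM]]; exists (`|M| + 1) => t.
have [tI|tI] := boolP (t \in `[P, Q]); last by rewrite f0// normr0 addr_ge0.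
apply: (HM (`|M| + 1)); last by exists t.
by rewrite (le_lt_trans (ler_norm M))// ltrDl.
Qed.

Lemma measurable_coord_comp n (D : set 'rV[R]_n) (f : R -> R) k : continuous f ->
  measurable_fun D (fun x : 'rV[R]_n => f (x ord0 k)).
Proof.
move=> cf; apply: (measurable_funS measurableT) => //.
have mf : measurable_fun setT f by exact: continuous_measurable_fun.
exact: (measurableT_comp mf (@measurable_coord R n k)).
Qed.

Lemma measurable_tens n (f : 'I_n -> R -> R) : (forall k, continuous (f k)) ->
  measurable_fun setT (tens f).
Proof.
move=> cf; have := @within_continuous_measurable R n setT (tens f) measurableT.
by apply; apply: continuous_subspaceT; exact: continuous_tens.
Qed.

Variable S : R -> R.
Hypothesis sS : smooth1 S.
Hypothesis S0 : forall t, t <= 0 -> S t = 0.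
Hypothesis S1 : forall t, 1 <= t -> S t = 1.
Hypothesis S01 : forall t, 0 <= S t <= 1.
Hypothesis dS0 : forall t, 0 <= derive1 S t.

Definition tooth (m : nat) (c e t : R) : R := ramp S m c t * ramp S m (- e) (- t).

Lemma smooth_tooth m c e : smooth1 (tooth m c e).
Proof.
move=> n; apply: CkM; first exact: smooth_ramp.
have := @Ck_affine R n (ramp S m (- e)) (-1) 0 (smooth_ramp sS m (- e) n).
by congr (Ck n _); apply/funext => t; rewrite mulN1r addr0.
Qed.

Lemma tooth_out m c e t : t \notin `]c, e[ -> tooth m c e t = 0.
Proof.
rewrite in_itv/= negb_and -!leNgt /tooth => /orP[tc|et].
  by rewrite ramp0// mul0r.
by rewrite [X in _ * X]ramp0 ?mulr0// lerN2.
Qed.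

Lemma tooth01 m c e t : 0 <= tooth m c e t <= 1.
Proof.
have /andP[a0 a1] := ramp01 S01 m c t; have /andP[b0 b1] := ramp01 S01 m (- e) (- t).
by rewrite mulr_ge0//= mulr_ile1.
Qed.

Lemma cvg_tooth c e t : tooth m c e t @[m --> \oo] --> ((t \in `]c, e[)%:R : R).
Proof.
have := cvgM (cvg_ramp S0 S1 (a:=c) (t:=t)) (cvg_ramp S0 S1 (a:= - e) (t:= - t)).
have -> : (if c < t then 1 else 0) * (if - e < - t then 1 else 0) =
    (t \in `]c, e[)%:R :> R.
  by rewrite ltrN2 in_itv/=; case: (c < t); case: (t < e); rewrite ?mulr1 ?mulr0.
exact.
Qed.

(** Smooth functions of product form supported in the box of corners c and e,
   and tending to its indicator. *)
Definition bell n m (c e : 'rV[R]_n) : 'rV[R]_n -> R :=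
  tens (fun k => tooth m (c ord0 k) (e ord0 k)).

Lemma bell_le1 n m (c e : 'rV[R]_n) y : `|bell m c e y| <= 1.
Proof.
have H k : 0 <= tooth m (c ord0 k) (e ord0 k) (y ord0 k) <= 1 by exact: tooth01.
rewrite ger0_norm; last by apply: prodr_ge0 => k _; case/andP: (H k).
by apply: prodr_ile1 => k _; exact: H.
Qed.

Lemma cvg_bell n (c e : 'rV[R]_n) y : bell m c e y @[m --> \oo] --> (\1_(obox c e) y : R).
Proof.
have -> : \1_(obox c e) y = \prod_(k < n) (y ord0 k \in `]c ord0 k, e ord0 k[)%:R :> R.
  rewrite indicE; case: (asboolP (obox c e y)) => H.
    by rewrite mem_set// big1// => k _; rewrite H.
  rewrite memNset//; move/existsNP : H => [k /negP/negbTE yk].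
  by rewrite (bigD1 k)//= yk mul0r.
rewrite /bell /tens; elim: (index_enum _) => [|k r IH].
  rewrite big_nil; under eq_fun do rewrite big_nil.
  exact: cvg_cst.
rewrite big_cons; under eq_fun do rewrite big_cons.
by apply: cvgM => //; exact: cvg_tooth.
Qed.

Lemma measurable_bell n m (c e : 'rV[R]_n) : measurable_fun setT (bell m c e).
Proof. by apply: measurable_tens => k; exact: (smooth_tooth _ _ _ 0%N). Qed.

Lemma cvg_integral_bell n (c e : 'rV[R]_n) (h : 'rV[R]_n -> R) :
  (lam n).-integrable setT (EFin \o h) ->
  \int[lam n]_y (bell m c e y * h y) @[m --> \oo] --> \int[lam n]_(y in obox c e) h y.
Proof.
move=> ih; have mh : measurable_fun setT h by case/integrableP : ih => /measurable_EFinP.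
have [|||||] := @dominated_convergence _ _ _ (lam n) setT measurableT
   (fun m y => (bell m c e y * h y)%:E) (fun y => (\1_(obox c e) y * h y)%:E)
   (fun y => (`|h y|)%:E).
- by move=> m; apply/measurable_EFinP; apply: measurable_funM => //; exact: measurable_bell.
- apply/measurable_EFinP; apply: measurable_funM => //.
  by apply: measurable_indic; exact: measurable_obox.
- apply: aeW => y _; apply: cvg_EFin; first by near=> m.
  by apply: cvgMl; exact: cvg_bell.
- exact: (integrable_norm ih).
- by apply: aeW => y m _; rewrite /= lee_fin normrM ler_piMl// bell_le1.
move=> iL _ L; rewrite Rintegral_mkcond.
have -> : \int[lam n]_y (h \_ (obox c e)) y = \int[lam n]_y (\1_(obox c e) y * h y).
  congr (Rintegral _ _ _); apply/funext => y.
  by rewrite patchE indicE; case: ifP => yc; rewrite /= ?mul1r ?mul0r.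
have fin : (\int[lam n]_(y in setT) (\1_(obox c e) y * h y)%:E)%E \is a fin_num.
  exact: integrable_fin_num iL.
by rewrite -(fineK fin) in L; move/fine_cvg: L.
Unshelve. all: by end_near. Qed.

(** In the weak equation take as test function theta in the direction i times
   a bell in the other directions. By Fubini the integral over y of the bell
   times the slice vanishes; as the bell tends to the indicator of an
   arbitrary box, the slice is zero almost everywhere. *)
Lemma weak_slice n (i : 'I_n.+1) (K : set 'rV[R]_n.+1) (u g : 'rV[R]_n.+1 -> R)
    (p q : 'rV[R]_n.+1) (theta : R -> R) :
  open K -> (lam n.+1).-integrable K (EFin \o u) -> weak_partial K i u g ->
  cbox p q `<=` K -> smooth1 theta ->
  (forall t, t \notin `[p ord0 i, q ord0 i] -> theta t = 0) ->
  {ae lam n, forall y, obox (del i p) (del i q) y ->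
     slice i ((fun x => u x * derive1 theta (x ord0 i) + g x * theta (x ord0 i)) \_ K) y = 0}.
Proof.
move=> oK iu [ig weak] pqK sth th0.
have mK : measurable K by exact: open_measurable_rV.
have sdth := smooth1_derive sth.
have dth0 := derive1_out th0.
have [B1 HB1] := smooth1_bounded sth th0.
have [B2 HB2] := smooth1_bounded sdth dth0.
have cth : continuous theta by exact: (sth 0%N).
have cdth : continuous (derive1 theta) by exact: (sdth 0%N).
have iut : (lam n.+1).-integrable K (EFin \o (fun x => u x * derive1 theta (x ord0 i))).
  apply: (@integrable_mul_bounded _ _ (lam n.+1) K u (fun x => derive1 theta (x ord0 i)) B2 mK iu) => //.
  exact: measurable_coord_comp.
have igt : (lam n.+1).-integrable K (EFin \o (fun x => g x * theta (x ord0 i))).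
  apply: (@integrable_mul_bounded _ _ (lam n.+1) K g (fun x => theta (x ord0 i)) B1 mK ig) => //.
  exact: measurable_coord_comp.
set H := _ \_ K.
have iH : (lam n.+1).-integrable setT (EFin \o H).
  rewrite /H -restrict_EFin; apply/integrable_restrict => //; rewrite setTI.
  have := integrableD mK iut igt; exact: eq_integrable.
apply: ae0_of_boxes; first exact: integrable_sliceR.
move=> c0 e0; rewrite obox_setI; set c := \row_k _; set e := \row_k _.
have ibell := cvg_integral_bell (c := c) (e := e) (integrable_sliceR i iH).
suff L0 : \int[lam n]_y (bell m c e y *
    slice i H y) @[m --> \oo] --> (0 : R) by exact: (cvg_unique _ ibell L0).
apply: cvg_near_cst; near=> m.
rewrite -(integral_sliceR i iH (measurable_bell m c e) (bell_le1 m c e)).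
pose f k := oapp (fun k' => tooth m (c ord0 k') (e ord0 k')) theta (unlift i k).
have fi : f i = theta by rewrite /f unlift_none.
have fl k : f (lift i k) = tooth m (c ord0 k) (e ord0 k) by rewrite /f liftK.
have fE x : tens f x = bell m c e (del i x) * theta (x ord0 i).
  rewrite -{1}(ins_del i x) tens_ins fi mulrC; congr (_ * _).
  by apply: eq_bigr => k _; rewrite fl.
have pfE x : partial i (tens f) x = bell m c e (del i x) * derive1 theta (x ord0 i).
  rewrite (partial_tens (i := i) (f := f) x _).2; last first.
    by rewrite fi; case: (sth 1%N).
  rewrite -{1}(ins_del i x) tens_ins eqxx fi mulrC; congr (_ * _).
  by apply: eq_bigr => k _; rewrite fl eq_sym (negbTE (neq_lift _ _)).
have tf : test_function K (tens f).
  apply: (test_function_tens _ pqK).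
    by move=> k; rewrite /f; case: (unliftP i k) => [j _|_] //=; exact: smooth_tooth.
  move=> k t; case: (unliftP i k) => [j ->|->]; last by rewrite fi; exact: th0.
  move=> tn; rewrite fl tooth_out//; apply: contra tn.
  rewrite !in_itv/= !mxE gt_max lt_min => /andP[/andP[_ h1] /andP[_ h2]].
  by rewrite (ltW h1) (ltW h2).
have := weak _ tf => E.
have mb : measurable_fun K (bell m c e \o del i).
  apply: (measurable_funS measurableT) => //.
  exact: (measurableT_comp (measurable_bell m c e) (measurable_del i)).
have bb x : K x -> `|(bell m c e \o del i) x| <= 1 by move=> _; exact: bell_le1.
rewrite (_ : (fun x => _) = (fun x => u x * partial i (tens f) x + g x * tens f x) \_ K).
  rewrite -Rintegral_mkcond RintegralD//.
  - by rewrite E addNr.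
  - have := integrable_mul_bounded mK iut mb bb.
    by apply: eq_integrable => // x _ /=; rewrite pfE; congr EFin; ring.
  - have := integrable_mul_bounded mK igt mb bb.
    by apply: eq_integrable => // x _ /=; rewrite fE; congr EFin; ring.
apply/funext => x; rewrite /H !patchE; case: ifP => _; last by rewrite mulr0.
by rewrite pfE fE; ring.
Unshelve. all: by end_near. Qed.
End weak_acl.

(** * Absolute continuity on lines *)
Section acl.
Context {R : realType}.
Local Notation lam := (@lebesgue_rV R).
Local Notation leb := (@lebesgue_measure R).

Lemma ae_forall_countable dT (T : measurableType dT) (mu : {measure set T -> \bar R})
    (I : countType) (P : I -> T -> Prop) :
  (forall j, {ae mu, forall x, P j x}) -> {ae mu, forall x, forall j, P j x}.
Proof.
move=> H.
have : {ae mu, forall x, forall m : nat, if unpickle m is Some j then P j x else True}.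
  by apply/ae_foralln => m; case: (unpickle m) => [j|]; [exact: H|exact: aeW].
by apply: filterS => x Hx j; have := Hx (pickle j); rewrite pickleK.
Qed.

Lemma continuous_ins n (i : 'I_n.+1) y : continuous (fun t : R => ins i (t, y)).
Proof.
move=> t; apply/cvg_ballP => e e0.
have : \forall s \near t, `|t - s| < e by apply: nbhsx_ballx.
apply: filterS => s ts; split => // j k; rewrite (ord1 j) {j}.
case: (unliftP i k) => [k' ->|->]; first by rewrite !ins_lift; exact: ballxx.
by rewrite !ins_at.
Qed.

Lemma within_line n (i : 'I_n.+1) y (C : set 'rV[R]_n.+1) (D : set R) (W : 'rV[R]_n.+1 -> R) :
  {within C, continuous W} -> (forall t, D t -> C (ins i (t, y))) ->
  {within D, continuous (fun t => W (ins i (t, y)))}.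
Proof.
move=> /subspace_continuousP cW DC; apply/subspace_continuousP => t Dt.
apply: cvg_comp (cW _ (DC t Dt)) => A /= wA.
have H : \forall s \near t, C (ins i (s, y)) -> A (ins i (s, y)).
  exact: (continuous_ins (i := i) (y := y) wA).
change (\forall s \near t, D s -> A (ins i (s, y))).
by apply: filterS H => s Hs Ds; apply: Hs; exact: DC.
Qed.

(** Absolute continuity on almost every line of direction i, locally in K. The
   closed window |t - c| <= e keeps the interval on which the antiderivative
   is required inside K. Unlike weak differentiability, this property visibly
   passes to products and compositions. *)
Definition acl n (i : 'I_n.+1) (K : set 'rV[R]_n.+1) (W G : 'rV[R]_n.+1 -> R) :=
  [/\ {within closure K, continuous W}, (lam n.+1).-integrable K (EFin \o G) &
   {ae lam n, forall y c, K (ins i (c, y)) -> exists2 e, 0 < e &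
      (forall t, `|t - c| <= e -> K (ins i (t, y))) /\
      ac (fun t => W (ins i (t, y))) (fun t => G (ins i (t, y))) (c - e) (c + e)}].

Lemma ae_intble_line n (i : 'I_n.+1) (K : set 'rV[R]_n.+1) (G : 'rV[R]_n.+1 -> R) :
  measurable K -> (lam n.+1).-integrable K (EFin \o G) ->
  {ae lam n, forall y a b, (forall t, t \in `[a, b] -> K (ins i (t, y))) ->
     intble (fun t => G (ins i (t, y))) a b}.
Proof.
move=> mK iG.
have iGK : (lam n.+1).-integrable setT (EFin \o (G \_ K)).
  by rewrite -restrict_EFin; apply/integrable_restrict => //; rewrite setTI.
have := integrable_slice i iGK; apply: filterS => y iy a b abK.
have : leb.-integrable `[a, b]%classic (fun t => (EFin \o G \_ K) (ins i (t, y))).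
  exact: integrableS iy.
apply: eq_integrable => // t; rewrite inE => tab /=.
by rewrite patchE mem_set//; exact: abK.
Qed.

(** The null set of lines to discard must serve all segments at once. It is
   obtained from countably many cut-offs: plateaus with rational end points
   inside boxes with rational corners contained in K. On the other lines
   du_bois_reymond gives the formula between rational points, and ftc_dense
   between all points. *)
Lemma weak_acl n (i : 'I_n.+1) (K : set 'rV[R]_n.+1) (u g : 'rV[R]_n.+1 -> R) :
  open K -> {within closure K, continuous u} -> (lam n.+1).-integrable K (EFin \o u) ->
  weak_partial K i u g -> acl i K u g.
Proof.
move=> oK cu iu wug; have [ig _] := wug; split => //.
have [S [sS S0 S1 S01 dS0]] := @smooth_step R.
have mK : measurable K by exact: open_measurable_rV.
(* corners of a box, end points of a plateau, and its index *)
pose idx := ('rV[rat]_n.+1 * 'rV[rat]_n.+1 * (rat * rat) * nat)%type.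
pose theta (j : idx) : R -> R := plateau S j.2.+1 (ratr j.1.2.1) (ratr j.1.2.2).
pose p (j : idx) : 'rV[R]_n.+1 := ratv j.1.1.1.
pose q (j : idx) : 'rV[R]_n.+1 := ratv j.1.1.2.
pose Pr (j : idx) y := cbox (p j) (q j) `<=` K ->
  p j ord0 i < ratr j.1.2.1 -> ratr j.1.2.1 < ratr j.1.2.2 :> R ->
  ratr j.1.2.2 + j.2.+1%:R^-1 < q j ord0 i ->
  obox (del i (p j)) (del i (q j)) y ->
  slice i ((fun x => u x * derive1 (theta j) (x ord0 i) + g x * theta j (x ord0 i)) \_ K) y = 0.
have out j t : p j ord0 i < ratr j.1.2.1 -> ratr j.1.2.1 < ratr j.1.2.2 :> R ->
   ratr j.1.2.2 + j.2.+1%:R^-1 < q j ord0 i -> t \notin `[p j ord0 i, q j ord0 i] ->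
   theta j t = 0 /\ derive1 (theta j) t = 0.
  move=> h1 h2 h3; rewrite in_itv/= negb_and -!ltNge => tn.
  apply: (plateau_out sS S0 S1 (ltW h2)).
  by case/orP: tn => [tp|qt]; [left; exact: lt_trans h1|right; exact: lt_trans qt].
have HP : {ae lam n, forall y, forall j, Pr j y}.
  apply: ae_forall_countable => j.
  have [h1|h1] := pselect (cbox (p j) (q j) `<=` K); last by apply: aeW => y /h1.
  have [h2|h2] := boolP (p j ord0 i < ratr j.1.2.1); last first.
    by apply: aeW => y _; rewrite /Pr (negbTE h2).
  have [h3|h3] := boolP ((ratr j.1.2.1 : R) < ratr j.1.2.2); last first.
    by apply: aeW => y _ _; rewrite (negbTE h3).
  have [h4|h4] := boolP (ratr j.1.2.2 + j.2.+1%:R^-1 < q j ord0 i); last first.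
    by apply: aeW => y _ _ _; rewrite (negbTE h4).
  have sth : smooth1 (theta j) by exact: smooth_plateau.
  have th0 t : t \notin `[p j ord0 i, q j ord0 i] -> theta j t = 0.
    by move=> tn; have [] := out j t h2 h3 h4 tn.
  have := weak_slice sS S0 S1 S01 oK iu wug h1 sth th0.
  by apply: filterS => y Hy _ _ _ _; exact: Hy.
have := ae_intble_line i mK ig.
apply: filterS2 HP => y HPy Hint c Kc.
have [p0 [q0 [xpq pqK]]] := open_rat_box (open_nbhs_nbhs (conj oK Kc)).
have := xpq i; rewrite ins_at in_itv/= => /andP[].
set P := ratv p0 ord0 i; set Q := ratv q0 ord0 i => Pc cQ.
have ybox : obox (del i (ratv p0 : 'rV[R]_n.+1)) (del i (ratv q0)) y.
  by move=> k; have := xpq (lift i k); rewrite ins_lift !mxE.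
have lineK t : t \in `[P, Q] -> K (ins i (t, y)).
  move=> tPQ; apply: pqK => k; case: (unliftP i k) => [k' ->|->]; last by rewrite ins_at.
  have := ybox k'; rewrite ins_lift !in_itv/= !mxE => /andP[a b].
  by rewrite !ltW.
have igl := Hint P Q lineK.
have cul : {within `[P, Q], continuous (fun t => u (ins i (t, y)))}.
  apply: within_line cu _ => t tPQ; apply: subset_closure; exact: lineK.
have Hftc : forall s t, P < s -> s <= t -> t < Q ->
    ftc (fun t => u (ins i (t, y))) (fun t => g (ins i (t, y))) s t.
  apply: ftc_dense => // a b Pa ab bQ.
  apply: (du_bois_reymond sS S0 S1 S01 dS0 Pa ab bQ cul igl).
  have Qb : 0 < Q - ratr b by rewrite subr_gt0.
  have := eps_inv Qb; apply: filterS => k hk.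
  have h4 : ratr b + k.+1%:R^-1 < Q by rewrite -ltrBrDl.
  have := HPy (p0, q0, (a, b), k) pqK Pa ab h4 ybox.
  rewrite /slice /itg => E; rewrite Rintegral_mkcond -[RHS]E.
  congr (Rintegral _ _ _); apply/funext => t.
  have outt := out (p0, q0, (a, b), k) t Pa ab h4.
  rewrite [LHS]patchE [RHS]patchE mem_setE; case: ifPn => tPQ.
    by rewrite mem_set ?ins_at//; exact: lineK.
  by rewrite !ins_at; have [-> ->] := outt tPQ; rewrite !mulr0 addr0 if_same.
pose e := Num.min (c - P) (Q - c) / 2.
have e1 : 0 < Num.min (c - P) (Q - c) by rewrite lt_min !subr_gt0 Pc.
have e0 : 0 < e by rewrite divr_gt0.
have eh : e < Num.min (c - P) (Q - c) by rewrite ltr_pdivrMr// mulr_natr mulr2n ltrDl.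
have [eP eQ] : P < c - e /\ c + e < Q.
  by move: eh; rewrite lt_min ltrBrDl ltrBrDl -ltrBrDr => /andP[].
exists e => //; split.
  move=> t; rewrite ler_distl => /andP[h1 h2]; apply: lineK.
  rewrite in_itv/=; apply/andP; split; first exact: ltW (lt_le_trans eP h1).
  exact: ltW (le_lt_trans h2 eQ).
split.
- apply: continuous_subspaceW cul; apply: subset_itv; rewrite bnd_simp; exact: ltW.
- by apply: intbleS igl _ _; exact: ltW.
- by move=> s t es st te; apply: Hftc => //; [exact: lt_le_trans es|exact: le_lt_trans eQ].
Qed.
End acl.

(** * Products, compositions and smooth functions *)
Section acl_closure.
Context {R : realType}.
Local Notation lam := (@lebesgue_rV R).
Local Notation leb := (@lebesgue_measure R).
Variables (n : nat) (i : 'I_n.+1) (K : set 'rV[R]_n.+1).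
Hypothesis oK : open K.
Hypothesis cK : compact (closure K).

Let mK : measurable K. Proof. exact: open_measurable_rV. Qed.

Lemma compact_bounded_fun (C : set 'rV[R]_n.+1) (W : 'rV[R]_n.+1 -> R) :
  compact C -> {within C, continuous W} -> exists B, forall x, C x -> `|W x| <= B.
Proof.
move=> cC cW; have : compact (W @` C) by apply: continuous_compact.
move=> /compact_bounded [M [_ HM]]; exists (`|M| + 1) => x Cx.
apply: (HM (`|M| + 1)); last by exists x.
by rewrite (le_lt_trans (ler_norm M))// ltrDl.
Qed.

Lemma closure_within_measurable (W : 'rV[R]_n.+1 -> R) :
  {within closure K, continuous W} -> measurable_fun K W.
Proof.
move=> cW; apply: within_continuous_measurable => //.
by apply: continuous_subspaceW cW; exact: subset_closure.
Qed.

(** Continuity on the compact closure bounds W; this is what makes products of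
   an integrable derivative with a continuous function integrable. *)
Lemma integrable_mul_closure (f W : 'rV[R]_n.+1 -> R) :
  (lam n.+1).-integrable K (EFin \o f) -> {within closure K, continuous W} ->
  (lam n.+1).-integrable K (EFin \o (fun x => f x * W x)).
Proof.
move=> fi cW; have [B HB] := compact_bounded_fun cK cW.
apply: (integrable_mul_bounded mK fi (closure_within_measurable cW) (B := B)).
by move=> x Kx; apply: HB; exact: subset_closure.
Qed.

Lemma closure_bounded : exists N, closure K `<=` cube N.
Proof.
have /choice[N HN] : forall k : 'I_n.+1, exists N, forall x, closure K x -> `|x ord0 k| <= N.
  move=> k; apply: compact_bounded_fun => //; apply: continuous_subspaceT.
  exact: coord_continuous.
exists (\sum_k `|N k|) => x Kx k; apply: le_trans (HN k x Kx) _.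
by rewrite (bigD1 k)//= (le_trans (ler_norm _))// lerDl sumr_ge0.
Qed.

Lemma finite_closure : (lam n.+1 K < +oo)%E.
Proof.
have [N HN] := closure_bounded; have := lebesgue_cube (R:=R) n.+1 N; apply: le_lt_trans.
apply: le_measure; rewrite ?inE//; first exact: measurable_cube.
by apply: subset_trans HN; exact: subset_closure.
Qed.

Lemma closure_within_integrable (W : 'rV[R]_n.+1 -> R) :
  {within closure K, continuous W} -> (lam n.+1).-integrable K (EFin \o W).
Proof.
move=> cW; have [B HB] := compact_bounded_fun cK cW.
apply: (@measurable_bounded_integrable _ _ _ (lam n.+1)) => //.
- exact: finite_closure.
- exact: closure_within_measurable.
exists B; split; [exact: num_real|move=> M BM x Kx /=].
by apply: le_trans (ltW BM); apply: HB; exact: subset_closure.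
Qed.

(** The chain rule on each line. Integrability comes from the continuity of
   F'(u) on the compact closure of K. *)
Lemma acl_comp (F : R -> R) (u g : 'rV[R]_n.+1 -> R) :
  (forall x, derivable F x 1) -> continuous (derive1 F) ->
  acl i K u g -> acl i K (fun x => F (u x)) (fun x => derive1 F (u x) * g x).
Proof.
move=> dF cF' [cu ig Hl].
split.
- move=> x; apply: (continuous_comp (cu x)).
  by apply/differentiable_continuous/derivable1_diffP/dF.
- have cFu : {within closure K, continuous (fun x => derive1 F (u x))}.
    by move=> x; apply: (continuous_comp (cu x)); exact: cF'.
  have := integrable_mul_closure ig cFu.
  by apply: eq_integrable => // x _ /=; rewrite mulrC.
- apply: filterS Hl => y Hy c Kc; have [e e0 [He ace]] := Hy c Kc.
  by exists e => //; split => //; exact: ac_comp ace.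
Qed.

Lemma acl_mul (u v g h : 'rV[R]_n.+1 -> R) :
  acl i K u g -> acl i K v h ->
  acl i K (fun x => u x * v x) (fun x => u x * h x + v x * g x).
Proof.
move=> [cu ig Hu] [cv ih Hv]; split.
- by move=> x; apply: continuousM; [exact: cu|exact: cv].
- have iuh := integrable_mul_closure ih cu; have ivg := integrable_mul_closure ig cv.
  have := integrableD mK iuh ivg.
  by apply: eq_integrable => // x _ /=; rewrite EFinD mulrC [v x * _]mulrC.
- apply: filterS2 Hu Hv => y Hu Hv c Kc.
  have [e e0 [He ace]] := Hu c Kc; have [e' e'0 [He' ace']] := Hv c Kc.
  exists (Num.min e e'); first by rewrite lt_min e0.
  split; first by move=> t; rewrite le_min => /andP[te _]; exact: He.
  apply: acM; [apply: (acS ace)|apply: (acS ace')];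
    by rewrite ?lerD2l ?lerN2 ge_min lexx ?orbT.
Qed.

(** On a line, a continuously differentiable function is an antiderivative of
   its derivative. *)
Lemma acl_C1 (phi : 'rV[R]_n.+1 -> R) : continuous phi ->
  (forall x, derivable phi x (basis_vec i)) -> continuous (partial i phi) ->
  acl i K phi (partial i phi).
Proof.
move=> cphi dphi cdphi; split.
- by apply: continuous_subspaceT; exact: cphi.
- by apply: closure_within_integrable; apply: continuous_subspaceT; exact: cdphi.
apply: aeW => y c Kc.
have : \forall t \near c, K (ins i (t, y)).
  exact: (continuous_ins (i := i) (y := y) (open_nbhs_nbhs (conj oK Kc))).
move=> /nbhs_ballP[e /= e0 He]; exists (e / 2); first by rewrite divr_gt0.
split.
  move=> t te; apply: He; rewrite /ball/= distrC (le_lt_trans te)//.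
  by rewrite ltr_pdivrMr// mulr_natr mulr2n ltrDl.
have -> : (fun t => partial i phi (ins i (t, y))) =
    derive1 (fun t => phi (ins i (t, y))).
  by apply/funext => t; rewrite (partial_line i phi t y).2.
apply: ac_C1 => [t|t].
  exact: ((partial_line i phi t y).1.1 (dphi _)).
have -> : derive1 (fun t => phi (ins i (t, y))) = (fun t => partial i phi (ins i (t, y))).
  by apply/funext => s; rewrite (partial_line i phi s y).2.
by apply: continuous_comp; [exact: continuous_ins|exact: cdphi].
Qed.
End acl_closure.

(** * Integrals over flat faces *)
Section faces.
Context {R : realType}.
Local Notation lam := (@lebesgue_rV R).
Local Notation leb := (@lebesgue_measure R).
Variable (d : nat).
Implicit Types (nu x y : 'rV[R]_d.+1) (c : R) (E : set 'rV[R]_d.+1).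

Lemma continuous_dotp nu : continuous (dotp nu).
Proof.
rewrite /dotp; elim: (index_enum _) => [|k r IH].
  rewrite (_ : (fun x => _) = cst 0); first exact: cst_continuous.
  by apply/funext => x; rewrite big_nil.
rewrite (_ : (fun x => _) =
    (fun x => nu ord0 k * x ord0 k + \sum_(j <- r) nu ord0 j * x ord0 j)).
  move=> x; have H : {for x, continuous (fun x => nu ord0 k * x ord0 k)}.
    by apply: (continuous_coord_comp (g := fun t => nu ord0 k * t)); exact: mulrl_continuous.
  exact: (continuousD H (IH x)).
by apply/funext => x; rewrite big_cons.
Qed.

Definition hyperplane nu c : set 'rV[R]_d.+1 := [set x | dotp nu x = c].

Lemma closed_hyperplane nu c : closed (hyperplane nu c).
Proof.
rewrite (_ : hyperplane nu c = dotp nu @^-1` [set c])//.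
by apply: preimage_closed => // x _; exact: continuous_dotp.
Qed.

(** A relatively open part of a hyperplane is the intersection of the
   hyperplane with an open set. *)
Lemma relopen_measurable nu c E :
  (forall x, E x -> dotp nu x = c) ->
  (forall x, E x -> \forall y \near x, dotp nu y = c -> E y) -> measurable E.
Proof.
move=> flat relopen.
have -> : E = hyperplane nu c `&` interior [set y | dotp nu y = c -> E y].
  apply/seteqP; split => [x Ex|x [xc xi]]; last exact: (interior_subset xi xc).
  by split; [exact: flat|exact: relopen].
apply: measurableI; first exact: (closed_measurable_rV (@closed_hyperplane nu c)).
apply: open_measurable_rV; exact: open_interior.
Qed.

Lemma graph_at_preimage_bounded (i : 'I_d.+1) nu c E N :
  E `<=` cube N -> graph_at i nu c @^-1` E `<=` cube N.
Proof. by move=> EN y /EN + k => /(_ (lift i k)); rewrite /graph_at ins_lift. Qed.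

Lemma measurable_graph_preimage (i : 'I_d.+1) nu c E :
  measurable E -> measurable (graph_at i nu c @^-1` E).
Proof. by move=> mE; rewrite -[X in measurable X]setTI; exact: measurable_graph_at. Qed.

Lemma bounded_measure_finite n (A : set 'rV[R]_n) N :
  measurable A -> A `<=` cube N -> (lam n A < +oo)%E.
Proof.
move=> mA AN; have := lebesgue_cube (R:=R) n N; apply: le_lt_trans.
by apply: le_measure; rewrite ?inE//; exact: measurable_cube.
Qed.

Lemma surface_finite nu c E N : enorm nu = 1 -> measurable E -> E `<=` cube N ->
  (surface_measure nu c E < +oo)%E.
Proof.
move=> nu1 mE EN; rewrite (surface_measureE c nu1 (pivotP nu1) mE).
have H : (lam d (graph_at (pivot nu) nu c @^-1` E) < +oo)%E.
  apply: (bounded_measure_finite (N := N)); first exact: measurable_graph_preimage.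
  exact: graph_at_preimage_bounded.
by rewrite lte_mul_pinfty.
Qed.

Lemma integrable_bounded_measurable dT (T : measurableType dT) (mu : {measure set T -> \bar R})
    (D : set T) (f : T -> R) (B : R) : measurable D -> (mu D < +oo)%E ->
  measurable_fun D f -> (forall z, D z -> `|f z| <= B) -> mu.-integrable D (EFin \o f).
Proof.
move=> mD Dfin mf fB; apply: (@measurable_bounded_integrable _ _ _ mu) => //.
by exists B; split; [exact: num_real|move=> M BM x Dx /=; exact: le_trans (fB x Dx) (ltW BM)].
Qed.

Lemma integral_mscale_signed dT (T : measurableType dT) (mu : {measure set T -> \bar R})
    (D : set T) (f : T -> \bar R) (k : {nonneg R}) : measurable D ->
  mu.-integrable D f ->
  (\int[mscale k mu]_(x in D) f x = k%:num%:E * \int[mu]_(x in D) f x)%E.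
Proof.
move=> mD fi; have mf := measurable_int _ fi.
rewrite [LHS]integralE [X in _ = (_ * X)%E]integralE.
rewrite ge0_integral_mscale//; last exact: measurable_funepos.
rewrite ge0_integral_mscale//; last exact: measurable_funeneg.
rewrite -muleBr//; apply: fin_num_adde_defl.
rewrite fin_numN; apply: integrable_fin_num => //; exact: integrable_funeneg.
Qed.

(** Change of variables through surface_measureE: the factor |nu_i|^-1 cancels
   the slope of the face relative to the direction i when crossings are
   counted line by line. *)
Lemma surface_integral (i : 'I_d.+1) nu c E N B (f : 'rV[R]_d.+1 -> R) :
  enorm nu = 1 -> nu ord0 i != 0 -> measurable E -> E `<=` cube N ->
  measurable_fun E f -> (forall x, E x -> `|f x| <= B) ->
  (lam d).-integrable setT (EFin \o ((f \_ E) \o graph_at i nu c)) /\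
  \int[surface_measure nu c]_(x in E) f x =
  `|nu ord0 i|^-1 * \int[lam d]_y ((f \_ E) (graph_at i nu c y)).
Proof.
move=> nu1 ni mE EN mf fB.
have mgE := measurable_graph_preimage i nu c mE.
have mg := @measurable_graph_at R d i nu c.
have mfE : measurable_fun setT (f \_ E).
  by apply/(measurable_restrict f mE measurableT); rewrite setTI.
have ig : (lam d).-integrable setT (EFin \o ((f \_ E) \o graph_at i nu c)).
  have : (lam d).-integrable (graph_at i nu c @^-1` E) (EFin \o ((f \_ E) \o graph_at i nu c)).
    apply: (integrable_bounded_measurable (B := B)) => //.
    - apply: (bounded_measure_finite (N := N)) => //.
      exact: graph_at_preimage_bounded.
    - by apply: (measurable_funS measurableT) => //; exact: (measurableT_comp mfE mg).
    - by move=> y Ey /=; rewrite patchE mem_set//; exact: fB.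
  move=> /(integrable_mkcond _ mgE).1.
  apply: eq_integrable => // y _; rewrite patchE /=; case: ifPn => // /negP yE.
  by rewrite patchE memNset// => Ey; apply: yE; rewrite inE.
split => //.
have k0 : 0 <= `|nu ord0 i|^-1 by rewrite invr_ge0.
pose k : {nonneg R} := NngNum k0.
pose P := pushforward_measure (lam d) mg.
rewrite /Rintegral.
have -> : (\int[surface_measure nu c]_(x in E) (f x)%:E)%E =
    (\int[mscale k P]_(x in E) (f x)%:E)%E.
  apply: eq_measure_integral => A mA _.
  by rewrite (surface_measureE c nu1 ni mA).
have PE : (\int[P]_(x in setT) ((f \_ E) x)%:E =
    \int[lam d]_y ((f \_ E) (graph_at i nu c y))%:E)%E.
  by rewrite (integral_pushforward mg)//; exact/measurable_EFinP.
have iP : P.-integrable setT (EFin \o (f \_ E)).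
  by apply: (integrable_pushforward mg) => //; exact/measurable_EFinP.
have -> : (\int[mscale k P]_(x in E) (f x)%:E = \int[mscale k P]_x ((f \_ E) x)%:E)%E.
  by rewrite integral_mkcond; apply: eq_integral => x _; rewrite /= !patchE; case: ifP.
rewrite integral_mscale_signed// PE.
by rewrite fineM//; apply: integrable_fin_num.
Qed.
End faces.

(** * The divergence theorem on a cell *)
Section cell_divergence.
Context {R : realType}.
Local Notation lam := (@lebesgue_rV R).
Local Notation leb := (@lebesgue_measure R).

Lemma Rintegral_bigsum dT (T : measurableType dT) (mu : {measure set T -> \bar R})
    (J : Type) (r : seq J) (f : J -> T -> R) :
  (forall j, mu.-integrable setT (EFin \o f j)) ->
  mu.-integrable setT (EFin \o (fun x => \sum_(j <- r) f j x)) /\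
  \int[mu]_x (\sum_(j <- r) f j x) = \sum_(j <- r) \int[mu]_x f j x.
Proof.
move=> fi; elim: r => [|j r [IH1 IH2]].
  rewrite big_nil (_ : (fun x => _) = cst 0); last by apply/funext => x; rewrite big_nil.
  by split; [exact: integrable0|rewrite Rintegral_cst// mul0r].
rewrite (_ : (fun x => _) = (fun x => f j x + \sum_(k <- r) f k x)); last first.
  by apply/funext => x; rewrite big_cons.
rewrite big_cons -IH2; split; last by rewrite RintegralD.
by have := integrableD measurableT (fi j) IH1; apply: eq_integrable.
Qed.

Lemma dotpB d (nu x y : 'rV[R]_d.+1) : dotp nu (x - y) = dotp nu x - dotp nu y.
Proof.
by rewrite /dotp -sumrB; apply: eq_bigr => k _; rewrite !mxE mulrBr.
Qed.

Lemma dotpZr d (a : R) (nu x : 'rV[R]_d.+1) : dotp nu (a *: x) = a * dotp nu x.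
Proof.
by rewrite /dotp mulr_sumr; apply: eq_bigr => k _; rewrite !mxE mulrCA.
Qed.

Lemma dotpZl d (a : R) (nu x : 'rV[R]_d.+1) : dotp (a *: nu) x = a * dotp nu x.
Proof.
by rewrite /dotp mulr_sumr; apply: eq_bigr => k _; rewrite !mxE mulrA.
Qed.

Lemma dotp_unit d (nu : 'rV[R]_d.+1) : enorm nu = 1 -> dotp nu nu = 1.
Proof.
have d0 : 0 <= dotp nu nu by apply: sumr_ge0 => k _; rewrite -expr2 sqr_ge0.
by move=> n1; rewrite -(sqr_sqrtr d0) -/(enorm nu) n1 expr1n.
Qed.

(** The points x - h nu, for small positive h, lie in K and tend to x. *)
Lemma outward_normal_closure d (K : set 'rV[R]_d.+1) nu x :
  0 < dotp nu nu -> outward_normal K nu x -> closure K x.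
Proof.
move=> nu0 out U Ux.
have H : \forall y \near x, (K y <-> dotp nu (y - x) < 0) /\ U y by apply: filterI.
have cvg_line : x - h *: nu @[h --> (0 : R)] --> x.
  have : x - h *: nu @[h --> (0 : R)] --> x - (0 : R) *: nu.
    apply: cvgB; first exact: cvg_cst.
    by apply: cvgZr_tmp; exact: cvg_id.
  by rewrite scale0r subr0.
have {}H := cvg_line _ H.
have /nbhs_ballP[e /= e0 He] : \forall h \near (0 : R),
  (K (x - h *: nu) <-> dotp nu (x - h *: nu - x) < 0) /\ U (x - h *: nu) by exact: H.
have [HK HU] : (K (x - (e / 2) *: nu) <-> dotp nu (x - (e / 2) *: nu - x) < 0) /\
    U (x - (e / 2) *: nu).
  apply: He; rewrite /ball/= sub0r normrN ger0_norm ?divr_ge0 ?ltW//.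
  by rewrite gtr_pMr// invf_lt1// ltr1n.
exists (x - (e / 2) *: nu); split => //; apply/HK.
rewrite addrAC subrr add0r -scaleNr dotpZr nmulr_rlt0// oppr_lt0.
by rewrite divr_gt0.
Qed.

(** A hyperplane parallel to the direction i is a cylinder over a hyperplane
   of the remaining coordinates, which is a null set. *)
Lemma lebesgue_line_hyperplane d (i : 'I_d.+1) (nu : 'rV[R]_d.+1) c :
  enorm nu = 1 -> nu ord0 i = 0 ->
  {ae lam d, forall y, forall t, dotp nu (ins i (t, y)) != c}.
Proof.
move=> nu1 nui; have [k nk] := dotp_neq0 nu1.
case: (unliftP i k) => [k' kE|kE]; last by rewrite kE nui eqxx in nk.
case: d i nu c nu1 nui k nk k' kE => [|d] i nu c nu1 nui k nk k' kE; first by case: (k').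
have delk : del i nu ord0 k' != 0 by rewrite mxE -kE.
exists [set y | dotp (del i nu) y = c]; split.
- exact: (closed_measurable_rV (@closed_hyperplane R d (del i nu) c)).
- exact: (lebesgue_hyperplane c delk).
move=> y /= /existsNP[t /negP]; rewrite negbK dotp_ins nui mul0r add0r /= => /eqP <-.
by apply: eq_bigr => j _; rewrite mxE.
Qed.

Variables (d : nat) (i : 'I_d.+1) (K : set 'rV[R]_d.+1) (I : finType).
Variables (adj : pred I) (sg : I -> R) (E : I -> set 'rV[R]_d.+1).
Variables (nu : I -> 'rV[R]_d.+1) (off : I -> R).
Hypothesis oK : open K.
Hypothesis cK : compact (closure K).
Hypothesis sg1 : forall j, adj j -> (sg j == 1) || (sg j == -1).
Hypothesis nu1 : forall j, enorm (nu j) = 1.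
Hypothesis flat : forall j x, E j x -> dotp (nu j) x = off j.
Hypothesis relopen : forall j x, E j x ->
  \forall y \near x, dotp (nu j) y = off j -> E j y.
Hypothesis boundary_null : forall j,
  surface_measure (nu j) (off j) (closure (E j) `\` E j) = 0%E.
Hypothesis disj : forall j k x, E j x -> E k x -> j = k.
Hypothesis outward : forall j x, adj j -> E j x -> outward_normal K (sg j *: nu j) x.
Hypothesis boundary : closure K `\` K `<=` \bigcup_(j in [set j | adj j]) closure (E j).

Let mE j : measurable (E j).
Proof.
by apply: (relopen_measurable (nu := nu j) (c := off j)) => x;
  [exact: flat|exact: relopen].
Qed.

Let sgsq j : adj j -> sg j * sg j = 1.
Proof. by move=> /sg1 /orP[] /eqP ->; rewrite ?mulr1// mulrNN mulr1. Qed.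

Lemma face_sub_closure j : adj j -> E j `<=` closure K.
Proof.
move=> aj x Ex; apply: (outward_normal_closure _ (outward aj Ex)).
by rewrite dotpZl dotpZr mulrA sgsq// mul1r dotp_unit.
Qed.

Let tt y j := plane_at i (nu j) (off j) y.
Let act y j := [&& adj j, nu j ord0 i != 0 & `[< E j (graph_at i (nu j) (off j) y) >]].
(** 1 if the line, traversed upwards, leaves K through the face j, and -1 if it
   enters K. *)
Let s j := sg j * Num.sg (nu j ord0 i).

(** Almost every line avoids the relative boundaries of the faces, which are
   null sets, and the faces parallel to it. Such a line leaves or enters K at
   each boundary point through exactly one face, transversally, so that
   divergence_line applies. *)
Lemma line_formula W G : acl i K W G ->
  {ae lam d, forall y, slice i (G \_ K) y =
      \sum_(j | act y j) s j * W (graph_at i (nu j) (off j) y)}.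
Proof.
move=> [cW iG Hac].
have mK : measurable K by exact: open_measurable_rV.
have [N KN] := closure_bounded cK.
have iGK : (lam d.+1).-integrable setT (EFin \o (G \_ K)).
  by rewrite -restrict_EFin; apply/integrable_restrict => //; rewrite setTI.
have Hline := integrable_slice i iGK.
have Hvert : {ae lam d, forall y, forall j t, nu j ord0 i = 0 ->
    dotp (nu j) (ins i (t, y)) != off j}.
  apply: ae_forall_countable => j.
  have [nj|nj] := eqVneq (nu j ord0 i) 0; last by apply: aeW => y t /eqP; rewrite (negbTE nj).
  by have := lebesgue_line_hyperplane (off j) (nu1 j) nj; apply: filterS => y Hy t _; exact: Hy.
have Hnull : {ae lam d, forall y, forall j, nu j ord0 i != 0 ->
    ~ (closure (E j) `\` E j) (graph_at i (nu j) (off j) y)}.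
  apply: ae_forall_countable => j.
  have [nj|nj] := eqVneq (nu j ord0 i) 0; first exact: aeW.
  have mCE : measurable (closure (E j) `\` E j).
    by apply: measurableD => //; apply: closed_measurable_rV; exact: closed_closure.
  have := boundary_null j; rewrite (surface_measureE (off j) (nu1 j) nj mCE) => /eqP.
  rewrite mule_eq0 eqe invr_eq0 normr_eq0 (negbTE nj)/= => /eqP null.
  exists (graph_at i (nu j) (off j) @^-1` (closure (E j) `\` E j)); split => //.
    exact: measurable_graph_preimage.
  by move=> y /= /not_implyP[_ /contrapT].
apply: filterS2 (filterI Hac Hline) (filterI Hvert Hnull) => y [Hacy Hliney] [Hverty Hnully].
have lineN t : closure K (ins i (t, y)) -> `|t| < N + 1.
  by move=> /KN /(_ i); rewrite ins_at/= => /le_lt_trans; apply; rewrite ltrDl.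
rewrite /slice.
have actE j : act y j -> [/\ adj j, nu j ord0 i != 0 & E j (ins i (tt y j, y))].
  by move=> /and3P[aj nj /asboolP Ej].
have lineE t : (G \_ K) (ins i (t, y)) =
    ((fun t => G (ins i (t, y))) \_ [set t | K (ins i (t, y))]) t.
  by rewrite !patchE; congr (if _ then _ else _); apply/asbool_equiv_eq.
rewrite (_ : (fun t => (G \_ K) (ins i (t, y))) =
    (fun t => G (ins i (t, y))) \_ [set t | K (ins i (t, y))]); last exact/funext.
apply: (@divergence_line R I (act y) (tt y) s [set t | K (ins i (t, y))]
   [set t | closure K (ins i (t, y))] (fun t => W (ins i (t, y)))
   (fun t => G (ins i (t, y))) (N + 1)).
- by move=> t Kt; apply: lineN; exact: (@subset_closure _ K).
- by move=> j /actE[aj _ Ej]; apply: lineN; exact: (face_sub_closure aj).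
- have := Hliney; apply: eq_integrable; first exact: measurableT.
  by move=> t _; congr EFin; exact: lineE.
- by apply: within_line cW _.
- by move=> t Kt; exact: (@subset_closure _ K).
- by move=> j /actE[aj _ Ej]; exact: (face_sub_closure aj).
- move=> j k /actE[_ _ Ej] /actE[_ _ Ek] tjk; apply: (@disj _ _ (ins i (tt y j, y))) => //.
  by rewrite tjk.
- move=> j /actE[aj nj _].
  rewrite /s; have [n0|n0] : 0 < nu j ord0 i \/ nu j ord0 i < 0.
      by apply/orP; rewrite -neq_lt eq_sym.
    by rewrite gtr0_sg// mulr1; exact: sg1.
  by rewrite ltr0_sg// mulrN1 eqr_oppLR orbC eqr_opp; exact: sg1.
- move=> j /actE[aj nj Ej].
  have /= out := outward aj Ej.
  have := continuous_ins (i := i) (y := y) out.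
  move=> /nbhs_ballP[e /= e0 He]; exists e => // t te.
  have := He t; rewrite /ball/= distrC => /(_ te) ->.
  rewrite dotpZl dotpB !dotp_ins /= opprD addrACA subrr addr0 -mulrBr mulrA.
  have -> : sg j * nu j ord0 i * (t - tt y j) = s j * (t - tt y j) * `|nu j ord0 i|.
    by rewrite /s {1}(numEsg (nu j ord0 i)); ring.
  by rewrite pmulr_llt0// normr_gt0.
- move=> c Kc; have [e e0 [He [_ _ ace]]] := Hacy c Kc.
  exists e => //; split; first by move=> t /ltW; exact: He.
  by move=> x z cx xz zc; apply: ace => //; exact: ltW.
- move=> c nKc; have [clK|nclK] := pselect (closure K (ins i (c, y))); last first.
    right; have : nbhs (ins i (c, y)) (~` closure K).
      by apply: open_nbhs_nbhs; split => //; apply: closed_openC; exact: closed_closure.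
    move=> /(continuous_ins (i := i) (y := y)) /nbhs_ballP[e /= e0 He].
    exists e => // t te Kt; have := He t; rewrite /ball/= distrC => /(_ te).
    by apply; exact: subset_closure.
  left; have [j aj Ejc] := boundary (conj clK nKc).
  have offj : dotp (nu j) (ins i (c, y)) = off j.
    have : closure (E j) `<=` hyperplane (nu j) (off j).
      rewrite [X in _ `<=` X](closure_id _).1; last exact: closed_hyperplane.
      by apply: closureS => x; exact: flat.
    by move=> /(_ _ Ejc).
  have nj : nu j ord0 i != 0.
    by apply/eqP => nj; have := Hverty j c nj; rewrite offj eqxx.
  have gE := graph_at_uniq nj offj; rewrite del_ins /= in gE.
  have Ej : E j (graph_at i (nu j) (off j) y).
    apply: contrapT => nE; apply: (Hnully j nj); split; last exact: nE.
    by move: Ejc; rewrite [X in closure _ X]gE.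
  exists j; first by rewrite /act aj nj; apply/asboolP.
  by have := congr1 (fun x : 'rV_d.+1 => x ord0 i) gE; rewrite /graph_at !ins_at.
Qed.

(** line_formula is integrated over all lines: the left side becomes the
   volume integral by Fubini, and each face contributes its surface integral
   times nu_i by surface_integral. *)
Theorem cell_divergence W G : acl i K W G ->
  \int[lam d.+1]_(x in K) G x =
  \sum_(j | adj j) sg j * nu j ord0 i *
     \int[surface_measure (nu j) (off j)]_(x in E j) W x.
Proof.
move=> aclW; have [cW iG _] := aclW.
have mK : measurable K by exact: open_measurable_rV.
have [N KN] := closure_bounded cK.
have [B WB] := compact_bounded_fun cK cW.
have iGK : (lam d.+1).-integrable setT (EFin \o (G \_ K)).
  by rewrite -restrict_EFin; apply/integrable_restrict => //; rewrite setTI.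
pose w j y := (W \_ (E j)) (graph_at i (nu j) (off j) y).
pose b j := adj j && (nu j ord0 i != 0).
have surf j : b j -> (lam d).-integrable setT (EFin \o w j) /\
    \int[surface_measure (nu j) (off j)]_(x in E j) W x =
    `|nu j ord0 i|^-1 * \int[lam d]_y w j y.
  move=> /andP[aj nj]; have EK := face_sub_closure aj.
  apply: (@surface_integral R d i (nu j) (off j) (E j) N B W (nu1 j) nj (mE j)
    (subset_trans EK KN)).
  - by apply: within_continuous_measurable => //; exact: continuous_subspaceW cW.
  - by move=> x /EK; exact: WB.
pose f j y := if b j then s j * w j y else 0.
have fi j : (lam d).-integrable setT (EFin \o f j).
  rewrite /f; case bj : (b j); last exact: integrable0.
  by have := @integrableZl _ _ _ (lam d) setT measurableT (s j) _ (surf j bj).1; apply: eq_integrable.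
have [fsumi fsum] := Rintegral_bigsum (index_enum I) fi.
transitivity (\int[lam d]_y (\sum_j f j y)).
  rewrite Rintegral_mkcond /Rintegral; congr fine.
  rewrite (integral_ins i iGK).
  apply: ae_eq_integral => //.
  - by have := integrable_slice_integral i iGK; case/integrableP.
  - by case/integrableP : fsumi.
  apply: filterS2 (line_formula aclW) (integrable_slice i iGK) => y Hy iy _ /=.
  have -> : \sum_j f j y = slice i (G \_ K) y.
    rewrite Hy [RHS]big_mkcond; apply: eq_bigr => j _.
    rewrite /f /w /act patchE -/(b j) andbA -/(b j).
    case: (b j) => //=; case: asboolP => Ej; first by rewrite mem_set.
    by rewrite memNset// mulr0.
  rewrite /slice /Rintegral fineK//; exact: integrable_fin_num.
rewrite fsum [RHS]big_mkcond; apply: eq_bigr => j _.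
rewrite /f /b; case: ifP => aj /=; last by rewrite Rintegral_cst// mul0r.
have [nj|nj] := eqVneq (nu j ord0 i) 0.
  by rewrite /= Rintegral_cst// !mul0r nj mulr0 mul0r.
have bj : b j by rewrite /b aj nj.
have [wi ->] := surf j bj.
rewrite /= RintegralZl// mulrA; congr (_ * _); rewrite /s -mulrA; congr (_ * _).
rewrite [X in _ = X * _](numEsg (nu j ord0 i)) mulfK//.
by rewrite normr_eq0.
Qed.
End cell_divergence.

(** * Polynomials *)
Section polynomials.
Context {R : realType} {d : nat}.
Variable i : 'I_d.+1.

Definition C1_along (phi : 'rV[R]_d.+1 -> R) :=
  [/\ continuous phi, forall x, derivable phi x (basis_vec i) &
      continuous (partial i phi)].

Lemma smooth1_exp k : smooth1 (fun t : R => t ^+ k).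
Proof.
move=> n; elim: k => [|k IH].
  rewrite (_ : (fun _ => _) = cst 1); first exact: Ck_cst.
  by apply/funext => t; rewrite expr0.
rewrite (_ : (fun _ => _) = fun t => t * t ^+ k); last by apply/funext => t; rewrite exprS.
apply: CkM => //.
suff H m : Ck m (fun t : R => t) by exact: H.
case: m => [|m]; first by move=> t; exact: cvg_id.
by apply: (@Ck_intro R m _ (cst 1)); exact: Ck_cst.
Qed.

Lemma C1_along_tens (f : 'I_d.+1 -> R -> R) : (forall k, smooth1 (f k)) ->
  C1_along (tens f).
Proof.
move=> sf; have sm := smooth_tens sf; split.
- by case: (sm [::]).
- by move=> x; case: (sm [::]) => _; exact.
- by case: (sm [:: i]).
Qed.

Lemma C1_along_cst c : C1_along (cst c).
Proof.
split; first exact: cst_continuous.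
  by move=> x; exact: derivable_cst.
rewrite (_ : partial i (cst c) = cst 0); first exact: cst_continuous.
by apply/funext => x; rewrite /partial derive_cst.
Qed.

Lemma C1_alongDZ c phi psi : C1_along phi -> C1_along psi ->
  C1_along (fun x => c * phi x + psi x).
Proof.
move=> [c1 d1 p1] [c2 d2 p2].
have dZ x : derivable (c \*: phi) x (basis_vec i) by exact: derivableZ.
have pE : partial i (fun x => c * phi x + psi x) =
    (fun x => c * partial i phi x + partial i psi x).
  apply/funext => x; have := deriveD (dZ x) (d2 x).
  by rewrite deriveZ.
have contZ (f : 'rV[R]_d.+1 -> R) (g : 'rV[R]_d.+1 -> R) : continuous f -> continuous g ->
    continuous (fun x => c * f x + g x).
  move=> cf cg x.
  have cZ : {for x, continuous (fun x => c * f x)}.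
    by apply: (continuousM (s := cst c)); [exact: cst_continuous|exact: cf].
  exact: (continuousD cZ (cg x)).
split; [exact: contZ| |by rewrite pE; exact: contZ].
by move=> x; exact: (derivableD (dZ x) (d2 x)).
Qed.

(** A monomial is a product of functions of one coordinate. *)
Lemma C1_along_Pr r (phi : 'rV[R]_d.+1 -> R) : Pr r phi -> C1_along phi.
Proof.
move=> [q _ ->].
rewrite (_ : (fun x => _) = fun x : 'rV[R]_d.+1 =>
    \sum_(m <- mpoly.msupp q) mpoly.mcoeff m q *
       tens (fun k (t : R) => t ^+ mpoly.fun_of_multinom m k) x); last first.
  by apply/funext => x; rewrite mpoly.mevalE.
elim: (mpoly.msupp q) => [|m s IH].
  rewrite (_ : (fun x => _) = cst 0); first exact: C1_along_cst.
  by apply/funext => x; rewrite big_nil.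
rewrite (_ : (fun x => _) = fun x : 'rV[R]_d.+1 => mpoly.mcoeff m q *
    tens (fun k (t : R) => t ^+ mpoly.fun_of_multinom m k) x + \sum_(m <- s) mpoly.mcoeff m q *
       tens (fun k (t : R) => t ^+ mpoly.fun_of_multinom m k) x).
  by apply: C1_alongDZ => //; apply: C1_along_tens => k; exact: smooth1_exp.
by apply/funext => x; rewrite big_cons.
Qed.
End polynomials.

(** * Discrete derivatives of functions without jumps *)
Section assembly.
Context {R : realType} {d : nat} (M : mesh R d).
Local Notation V := 'rV[R]_d.+1.
Local Notation lambda := (lebesgue_rV d.+1).
Local Notation face_index := ('I_(nifaces M) + 'I_(nbfaces M))%type.
Implicit Types (w G phi : pwfun M).

Definition adjacent (k : 'I_(ncells M)) (e : face_index) : bool :=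
  match e with
  | inl e => (k == (icells M e).1) || (k == (icells M e).2)
  | inr e => k == bcell M e
  end.

(** fnormal M e points out of the first of the two cells adjacent to e, hence
   into the second one. *)
Definition normal_sign (k : 'I_(ncells M)) (e : face_index) : R :=
  match e with
  | inl e => if k == (icells M e).1 then 1 else -1
  | inr e => 1
  end.

Lemma compact_cell k : compact (closure (cell M k)).
Proof.
apply: bounded_closed_compact; last exact: closed_closure.
have [N [Nr HN]] := domain_bounded M; exists N; split => // N' NN'.
have cl : closed [set x : V | `|x| <= N'].
  rewrite (_ : [set _ | _] = (fun x : V => `|x|) @^-1` [set t | t <= N'])//.
  apply: preimage_closed; last exact: closed_le.
  by move=> x _; exact: norm_continuous.
move=> x xk /=; have : closure [set x : V | `|x| <= N'] x.
  by move: x xk; apply: closureS => x /cell_sub; exact: HN.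
by rewrite -(closure_id _).1.
Qed.

Lemma icells_neq e : (icells M e).1 != (icells M e).2.
Proof. by have := iface_order e; apply: contraTneq => ->; rewrite ltnn. Qed.

Lemma outward_adjacent k e x : adjacent k e -> face M e x ->
  outward_normal (cell M k) (normal_sign k e *: fnormal M e) x.
Proof.
case: e => e /= adj ex.
  case: eqVneq adj => [-> _|_ /= /eqP ->].
    by rewrite scale1r; exact: iface_normal1.
  by rewrite scaleN1r; exact: iface_normal2.
by rewrite scale1r (eqP adj); exact: bface_normal.
Qed.

Lemma face_closure k e : adjacent k e -> face M e `<=` closure (cell M k).
Proof.
move=> adj x ex; apply: (outward_normal_closure _ (outward_adjacent adj ex)).
have s1 : normal_sign k e * normal_sign k e = 1.
  by case: e adj ex => e /= _ _; [case: ifP|]; rewrite ?mulrNN mulr1.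
by rewrite dotpZl dotpZr mulrA s1 mul1r dotp_unit// fnormal_unit.
Qed.

Lemma mesh_cell_divergence i k (W G : V -> R) : acl i (cell M k) W G ->
  \int[lambda]_(x in cell M k) G x =
  \sum_(e | adjacent k e) normal_sign k e * fnormal M e ord0 i * face_integral e W.
Proof.
apply: cell_divergence.
- exact: cell_open.
- exact: compact_cell.
- by case=> e /= _; [case: ifP|]; rewrite eqxx ?orbT.
- exact: fnormal_unit.
- exact: face_flat.
- exact: face_relopen.
- exact: face_boundary_null.
- move=> e e' x ex ex'; apply: (face_disjoint (m := M)) => //.
  by exists x.
- by move=> e x; exact: outward_adjacent.
- move=> x /cell_boundary[[e|e] /= he ex].
    by exists (inl e) => //=; case: he => ->; rewrite eqxx ?orbT.
  by exists (inr e) => //=; rewrite he eqxx.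
Qed.

Lemma integrable_face k e (W : V -> R) : adjacent k e ->
  {within closure (cell M k), continuous W} ->
  (surface_measure (fnormal M e) (foffset M e)).-integrable (face M e) (EFin \o W).
Proof.
move=> adj cW; have ek := face_closure adj.
have [N KN] := closure_bounded (@compact_cell k).
have [B WB] := compact_bounded_fun (@compact_cell k) cW.
have mE : measurable (face M e).
  by apply: (relopen_measurable (nu := fnormal M e) (c := foffset M e)) => x;
    [exact: face_flat|exact: face_relopen].
apply: (integrable_bounded_measurable (B := B)) => //.
- exact: (@surface_finite R d _ (foffset M e) (face M e) N (fnormal_unit e) mE (subset_trans ek KN)).
- by apply: within_continuous_measurable => //; exact: continuous_subspaceW cW.
- by move=> x /ek; exact: WB.
Qed.

(** The points of cell M k near x, where both functions agree, exist since x
   is in its closure; both functions are continuous at x along the cell. *)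
Lemma C0_closure (u : pwfun M) (f : V -> R) k x :
  {within closure (cell M k), continuous (u k)} -> {within domain M, continuous f} ->
  (forall k x, cell M k x -> u k x = f x) ->
  domain M x -> closure (cell M k) x -> u k x = f x.
Proof.
move=> /subspace_continuousP cu /subspace_continuousP cf uf Mx kx.
apply/eqP; rewrite -subr_eq0 -normr_le0 leNgt; apply/negP.
set e := `|_| => e0.
have e2 : 0 < e / 2 by rewrite divr_gt0.
have /cvgrPdist_lt/(_ _ e2) Hu := cu x kx.
have /cvgrPdist_lt/(_ _ e2) Hf := cf x Mx.
have {}Hu : \forall t \near x, closure (cell M k) t -> `|u k x - u k t| < e / 2 := Hu.
have {}Hf : \forall t \near x, domain M t -> `|f x - f t| < e / 2 := Hf.
have [y [ky [Huy Hfy]]] := kx _ (filterI Hu Hf).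
have := Huy (subset_closure ky); have := Hfy (cell_sub ky).
rewrite (uf _ _ ky) => h1 h2.
have : e < e / 2 + e / 2.
  apply: le_lt_trans (ltrD h2 h1); apply: le_trans (ler_normB _ _).
  by rewrite /e opprB addrA subrK.
by rewrite -splitr ltxx.
Qed.

(** An interior face lies in the domain and in the closure of both adjacent
   cells. *)
Lemma C0_face (u : pwfun M) e x :
  (forall k, {within closure (cell M k), continuous (u k)}) -> C0_domain M u ->
  face M (inl e) x -> u (icells M e).1 x = u (icells M e).2 x.
Proof.
move=> cu [f cf uf] ex; have Mx := iface_domain ex.
have H k : adjacent k (inl e) -> u k x = f x.
  by move=> adj; apply: C0_closure => //; exact: (face_closure adj).
by rewrite !H//= eqxx ?orbT.
Qed.

(** By the divergence theorem for w phi on each cell, the volume integral of w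
   partial phi + G phi is a sum over the faces of the cell. Summed over all
   cells, an interior face contributes w [phi] n_i, since w has no jump; both
   traces of w are this common value, and the penalty vanishes with the jump. *)
Lemma deriv_form_acl r gamma s i w G phi :
  (forall k, acl i (cell M k) (w k) (G k)) ->
  (forall e x, face M (inl e) x -> w (icells M e).1 x = w (icells M e).2 x) ->
  Vrh r phi -> deriv_form gamma s i w phi = innerT G phi.
Proof.
move=> aw wface Pphi.
have aphi k : acl i (cell M k) (phi k) (partial i (phi k)).
  have [c1 d1 p1] := C1_along_Pr i (Pphi k).
  exact: (acl_C1 (@cell_open _ _ M k) (@compact_cell k)).
have awphi k := acl_mul (@cell_open _ _ M k) (@compact_cell k) (aw k) (aphi k).
have cphi k : {within closure (cell M k), continuous (phi k)} by case: (aphi k).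
have cw k : {within closure (cell M k), continuous (w k)} by case: (aw k).
have cwphi k : {within closure (cell M k), continuous (fun x => w k x * phi k x)}.
  by case: (awphi k).
have mk k : measurable (cell M k) by apply: open_measurable_rV; exact: cell_open.
have jump0 : \sum_e face_integral (inl e)
    (fun x => gamma e * jump w (inl e) x * jump phi (inl e) x) = 0.
  apply: big1 => e _; rewrite /face_integral (@eq_Rintegral _ _ _ _ _ (cst 0)).
    rewrite Rintegral_cst ?mul0r//.
    by apply: (relopen_measurable (nu := fnormal M (inl e)) (c := foffset M (inl e))) => x;
      [exact: face_flat|exact: face_relopen].
  by move=> x; rewrite inE => ex /=; rewrite wface// subrr mulr0 mul0r.
rewrite /deriv_form jump0 addr0; apply/eqP; rewrite subr_eq; apply/eqP.
rewrite /innerT -big_split /=.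
transitivity (\sum_k \sum_(e | adjacent k e) normal_sign k e * fnormal M e ord0 i *
    face_integral e (fun x => w k x * phi k x)); last first.
  apply: eq_bigr => k _; rewrite -(mesh_cell_divergence (awphi k)).
  have [_ iG _] := aw k; have [_ idphi _] := aphi k.
  have i1 := integrable_mul_closure (@cell_open _ _ M k) (@compact_cell k) iG (cphi k).
  have i2 := integrable_mul_closure (@cell_open _ _ M k) (@compact_cell k) idphi (cw k).
  rewrite -RintegralD//; last by move: i2; apply: eq_integrable => // x _ /=; rewrite mulrC.
  by apply: eq_Rintegral => x _; rewrite addrC; congr (_ + _); rewrite mulrC.
rewrite (exchange_big_dep xpredT)//=; apply: eq_bigr => -[e|e] _.
- have sum2 (H : 'I_(ncells M) -> R) :
      \sum_(k | adjacent k (inl e)) H k = H (icells M e).1 + H (icells M e).2.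
    rewrite (bigD1 (icells M e).1) /= ?eqxx//; congr (_ + _).
    rewrite (big_pred1 (icells M e).2)// => k /=.
    case: (eqVneq k (icells M e).2) => [->|_].
      by rewrite orbT eq_sym icells_neq.
    by rewrite orbF andbN.
  rewrite {}sum2 /=.
  rewrite eqxx eq_sym (negbTE (icells_neq e)) mul1r mulN1r mulNr -mulrBr.
  have a1 : adjacent (icells M e).1 (inl e) by rewrite /= eqxx.
  have a2 : adjacent (icells M e).2 (inl e) by rewrite /= eqxx orbT.
  have i1 := integrable_face a1 (cwphi _).
  have i2 := integrable_face a2 (cwphi _).
  have mE : measurable (face M (inl e)).
    by apply: (relopen_measurable (nu := fnormal M (inl e)) (c := foffset M (inl e))) => x;
      [exact: face_flat|exact: face_relopen].
  rewrite /face_integral -RintegralB// -RintegralZl//; last first.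
    by have := integrableB mE i1 i2; apply: eq_integrable.
  apply: eq_Rintegral => x; rewrite inE => ex.
  have tr : trace_op s i w (inl e) x = w (icells M e).1 x.
    rewrite /trace_op; case: s; case: (icells M e) (wface _ _ ex) => k1 k2 /= E;
      by case: ifP.
  rewrite -/(trace_op s i w (inl e)) tr /= -(wface _ _ ex).
  by ring.
- rewrite (big_pred1 (bcell M e))//= mul1r.
  have a1 : adjacent (bcell M e) (inr e) by rewrite /= eqxx.
  have i1 := integrable_face a1 (cwphi _).
  have mE : measurable (face M (inr e)).
    by apply: (relopen_measurable (nu := fnormal M (inr e)) (c := foffset M (inr e))) => x;
      [exact: face_flat|exact: face_relopen].
  rewrite /face_integral -RintegralZl//.
  by apply: eq_Rintegral => x _; rewrite /=; ring.
Qed.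

(** Both one-sided derivatives and the projection solve the same variational
   problem, so the three are the same chosen solution. *)
Lemma disc_deriv_acl r gamma i w G :
  (forall k, acl i (cell M k) (w k) (G k)) ->
  (forall e x, face M (inl e) x -> w (icells M e).1 x = w (icells M e).2 x) ->
  disc_deriv M r gamma i w = L2proj M r G.
Proof.
move=> aw wface.
have side_eq s : disc_deriv_side r (gamma s i) s i w = L2proj M r G.
  rewrite /disc_deriv_side /L2proj; congr (xget _ _).
  apply/seteqP; split => g [Vg Hg]; split => // phi Pphi; rewrite Hg//.
    exact: (deriv_form_acl _ _ aw wface Pphi).
  exact/esym/(deriv_form_acl _ _ aw wface Pphi).
apply/funext => k; apply/funext => x; rewrite /disc_deriv !side_eq.
by field.
Qed.

Lemma wpartial_acl i k (u : V -> R) :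
  W11 (cell M k) u -> {within closure (cell M k), continuous u} ->
  acl i (cell M k) u (wpartial (cell M k) i u).
Proof.
move=> [iu /(_ i) eg] cu; apply: weak_acl => //; first exact: cell_open.
have [g wg] := eg.
exact: (@xgetPex _ (cst 0) [set g | weak_partial (cell M k) i u g]).
Qed.
End assembly.

Unset Implicit Arguments.

Theorem theorem4p2 (R : realType) (d : nat) (M : mesh R d) (sigma kappa : R)
    (Msigma : shape_regular M sigma) (Mkappa : locally_quasi_uniform M kappa)
    (r : nat) (gamma : side -> 'I_d.+1 -> 'I_(nifaces M) -> R)
    (F : R -> R) (dF : forall x : R, derivable F x 1)
    (cF' : continuous (F^`()%classic : R -> R))
    (bF' : F^`()%classic \in Lfun (@lebesgue_measure R) +oo%E)
    (u v : pwfun M) (uVh : Vh M u) (uC0 : C0_domain M u)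
    (vVh : Vh M v) (vC0 : C0_domain M v) (i : 'I_d.+1) :
  disc_deriv M r gamma i (fun k x => u k x * v k x) =
    L2proj M r (fun k x => u k x * wpartial (cell M k) i (v k) x +
                           v k x * wpartial (cell M k) i (u k) x) /\
  disc_deriv M r gamma i (fun k x => F (u k x)) =
    L2proj M r (fun k x =>
      F^`()%classic (u k x) * wpartial (cell M k) i (u k) x).
Proof.
have cu k : {within closure (cell M k), continuous (u k)} by case: (uVh k).
have cv k : {within closure (cell M k), continuous (v k)} by case: (vVh k).
have au k := wpartial_acl i (uVh k).1 (cu k).
have av k := wpartial_acl i (vVh k).1 (cv k).
split; apply: disc_deriv_acl => [k|e x ex].
- exact (acl_mul (@cell_open _ _ M k) (@compact_cell _ _ M k) (au k) (av k)).
- by rewrite (C0_face cu uC0 ex) (C0_face cv vC0 ex).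
- exact (acl_comp (@cell_open _ _ M k) (@compact_cell _ _ M k) dF cF' (au k)).
- by rewrite (C0_face cu uC0 ex).
Qed.
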